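(* Let $H\in(1/2,1)$, $\alpha\in(1-H,1/2)$, $\beta\in(1-\alpha,H)$, $\gamma>1/2$, $\kappa=\gamma/\beta$. Let $a,b:\mathbb{R}\to\mathbb{R}$ satisfy assumptions (A)–(D) listed in the context, let $\theta\in\mathbb{R}$, and let $X$ be the solution of $$X_t=X_0+\theta\int_0^t a(X_s)\,ds+\int_0^t b(X_s)\,dB^{H}_s,\quad t\ge 0,$$ with non-random $X_0$, where $B^H$ is a fractional Brownian motion with Hurst parameter $H$. For $n\ge1$ let $t^n_k=k2^{-n}$, $k=0,1,\dots,2^{2n}$, and $$ \hat\theta_n^{(2)}=\frac{\sum_{k=1}^{2^{2n}-1}b^{-1}\left(X_{t_{k-1}^n}\right)\left(X_{t_{k}^n}-X_{t_{k-1}^n}\right)}{\frac{1}{2^n}\sum_{k=1}^{2^{2n}-1}b^{-1}\left(X_{t_{k-1}^n}\right)a\left(X_{t_{k-1}^n}\right)}. $$ Then, with probability one, $\hat\theta_n^{(2)}\to\theta$ as $n\to\infty$. Moreover, there exists a random variable $\eta'$ with all moments finite such that, almost surely for all $n\ge1$, $$|\hat\theta_n^{(2)}-\theta|\le\eta'\,n^{\kappa+\gamma}2^{-\rho n},\qquad\text{where }\rho=(1-H)\wedge(2\beta-1).$$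
   Context: Here $b^{-1}(x)=1/b(x)$. A fractional Brownian motion with Hurst parameter $H$ is a centered Gaussian process $\{B^H_t,t\ge0\}$ with covariance $\mathsf{E}[B^H_tB^H_s]=\frac12(s^{2H}+t^{2H}-|t-s|^{2H})$, with (locally Hölder) continuous paths. Statistical setting: $(\Omega,\mathcal F)$ is a measurable space, $X:\Omega\to C[0,\infty)$ is a stochastic process, $\{\mathsf{P}^\theta,\theta\in\mathbb{R}\}$ is a family of probability measures such that for each $\theta$ the $\sigma$-algebra $\mathcal F$ is $\mathsf{P}^\theta$-complete and there is a fractional Brownian motion $B^{H,\theta}$ on $(\Omega,\mathcal F,\mathsf{P}^\theta)$ for which $X$ solves the equation $X_t=X_0+\theta\int_0^t a(X_s)\,ds+\int_0^t b(X_s)\,dB^{H}_s$, $t\ge0$, with $B^H=B^{H,\theta}$. The value $\theta$ is arbitrary but fixed, and $B^H=B^{H,\theta}$, $\mathsf{P}=\mathsf{P}^\theta$; probabilities and moments are with respect to $\mathsf{P}^\theta$. Assumptions on coefficients: there exist constants $\delta\in(1/H-1,1]$, $K>0$, $L>0$, $M>0$ and for every $N\ge1$ a constant $R_N>0$ such that (A) $|a(x)|+|b(x)|\le K$ for all $x\in\mathbb{R}$; (B) $|a(x)-a(y)|+|b(x)-b(y)|\le L|x-y|$ for all $x,y\in\mathbb{R}$; (C) $b$ is differentiable and $|b'(x)-b'(y)|\le R_N|x-y|^{\delta}$ for all $x,y\in[-N,N]$; (D) $|a(x)|\ge M$ and $|b(x)|\ge M$ for all $x\in\mathbb{R}$.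 Under (A)–(C) the equation is known to have a unique solution; its paths are almost surely locally Hölder continuous of every order less than $H$. Integrals with respect to $B^H$ are generalized Lebesgue–Stieltjes integrals: for $a_0<b_0$, $$\int_{a_0}^{b_0} f(x)\,dg(x)=e^{i\pi\alpha}\int_{a_0}^{b_0}\big(D^{\alpha}_{a_0+}f\big)(x)\big(D^{1-\alpha}_{b_0-}g_{b_0-}\big)(x)\,dx,\qquad g_{b_0-}(x)=g(x)-g(b_0),$$ provided $D^\alpha_{a_0+}f\in L_1[a_0,b_0]$ and $D^{1-\alpha}_{b_0-}g_{b_0-}\in L_\infty[a_0,b_0]$, where $$\big(D_{a_0+}^{\alpha}f\big)(x)=\frac{1}{\Gamma(1-\alpha)}\bigg(\frac{f(x)}{(x-a_0)^\alpha}+\alpha\int_{a_0}^x\frac{f(x)-f(u)}{(x-u)^{1+\alpha}}du\bigg),$$ $$\big(D_{b_0-}^{1-\alpha}g\big)(x)=\frac{e^{-i\pi\alpha}}{\Gamma(\alpha)}\bigg(\frac{g(x)}{(b_0-x)^{1-\alpha}}+(1-\alpha)\int_{x}^{b_0}\frac{g(x)-g(u)}{(u-x)^{2-\alpha}}du\bigg).$$ *)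

(* Defs.v *)
From HB Require Import structures.
From mathcomp Require Import all_boot all_order all_algebra.
From mathcomp Require Import all_classical all_reals all_analysis.
From mathcomp Require Import complex.

Set Implicit Arguments.
Unset Strict Implicit.
Unset Printing Implicit Defensive.

Import Order.TTheory GRing.Theory Num.Theory.
Import numFieldNormedType.Exports.

Local Open Scope classical_set_scope.
Local Open Scope ring_scope.

Definition Gamma (R : realType) (s : R) : R :=
  (\int[lebesgue_measure]_(x in `]0%R, +oo[) (x `^ (s - 1) * expR (- x)))%R.

Definition expi (R : realType) (x : R) : R[i] := Complex (cos x) (sin x).

(* At a point where a denominator vanishes, powR and the inverse give 0; this
   only concerns endpoints, i.e. null sets. *)
Definition frac_left_integrand (R : realType) (alpha : R) (f : R -> R) (x u : R)
    : R :=
  (f x - f u) / (x - u) `^ (1 + alpha).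

Definition frac_left (R : realType) (alpha a0 : R) (f : R -> R) (x : R) : R :=
  (Gamma (1 - alpha))^-1 *
  (f x / (x - a0) `^ alpha +
   alpha * (\int[lebesgue_measure]_(u in `[a0, x])
              frac_left_integrand alpha f x u)%R).

Definition frac_right_integrand (R : realType) (alpha : R) (g : R -> R)
    (x u : R) : R :=
  (g x - g u) / (u - x) `^ (2 - alpha).

(* The right-sided derivative has order 1 - alpha. *)
Definition frac_right (R : realType) (alpha b0 : R) (g : R -> R) (x : R)
    : R[i] :=
  expi (- (pi * alpha)) * ((Gamma alpha)^-1)%:C%C *
  (g x / (b0 - x) `^ (1 - alpha) +
   (1 - alpha) * (\int[lebesgue_measure]_(u in `[x, b0])
                    frac_right_integrand alpha g x u)%R)%:C%C.

(* Rintegral is total, so membership of the fractional derivatives in L_1 and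
   L_oo is accompanied by the convergence, for almost every x, of the inner
   integrals that define them. *)
Definition frac_left_L1 (R : realType) (alpha a0 b0 : R) (f : R -> R) : Prop :=
  {ae lebesgue_measure, forall x : R, x \in `]a0, b0[ ->
     lebesgue_measure.-integrable `[a0, x]
       (EFin \o frac_left_integrand alpha f x)} /\
  lebesgue_measure.-integrable `[a0, b0] (EFin \o frac_left alpha a0 f).

Definition frac_right_Loo (R : realType) (alpha a0 b0 : R) (g : R -> R) : Prop :=
  [/\ {ae lebesgue_measure, forall x : R, x \in `]a0, b0[ ->
         lebesgue_measure.-integrable `[x, b0]
           (EFin \o frac_right_integrand alpha g x)},
      measurable_fun `[a0, b0] (fun x => complex.Re (frac_right alpha b0 g x)),
      measurable_fun `[a0, b0] (fun x => complex.Im (frac_right alpha b0 g x)) &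
      exists C : R, {ae lebesgue_measure, forall x : R, x \in `[a0, b0] ->
         ComplexField.Normc.normc (frac_right alpha b0 g x) <= C}].

Definition Cintegral (R : realType) (D : set R) (h : R -> R[i]) : R[i] :=
  Complex (\int[lebesgue_measure]_(x in D) complex.Re (h x))%R
          (\int[lebesgue_measure]_(x in D) complex.Im (h x))%R.

Definition gls_integrable (R : realType) (alpha a0 b0 : R) (f g : R -> R)
    : Prop :=
  frac_left_L1 alpha a0 b0 f /\
  frac_right_Loo alpha a0 b0 (fun x => g x - g b0).

(* The two phases multiply to 1, so the value is real. With the phase
   exp(-i pi alpha) in the derivative of order 1 - alpha, the integral of the
   constant 1 against g is g a0 - g b0; replacing that phase by
   exp(i pi (1 - alpha)) would restore the usual sign. In an equation driven by
   a fractional Brownian motion B the two conventions are exchanged by passing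
   from B to - B, which is again a fractional Brownian motion. *)
Definition gls_integral (R : realType) (alpha a0 b0 : R) (f g : R -> R) : R[i] :=
  expi (pi * alpha) *
  Cintegral `[a0, b0]
    (fun x => (frac_left alpha a0 f x)%:C%C *
              frac_right alpha b0 (fun y => g y - g b0) x).

Definition locally_hoelder (R : realType) (lambda : R) (f : R -> R) : Prop :=
  forall T : R, 0 < T -> exists C : R,
    forall s t : R, 0 <= s <= T -> 0 <= t <= T ->
      `|f t - f s| <= C * `|t - s| `^ lambda.

(* normal_prob m 0 is not the degenerate law (it is uniform on [0, 1]), hence
   the separate Dirac case. *)
Definition gaussian_rv d (T : measurableType d) (R : realType)
    (P : probability T R) (Y : T -> R) : Prop :=
  exists m sigma : R, forall A : set R, measurable A ->
    P (Y @^-1` A) =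
      (if sigma == 0 then \d_m A else normal_prob m sigma A) :> \bar R.

Definition gaussian_process d (T : measurableType d) (R : realType)
    (P : probability T R) (B : R -> T -> R) : Prop :=
  forall (n : nat) (c t : 'I_n -> R), (forall i, 0 <= t i) ->
    gaussian_rv P (fun w => \sum_(i < n) c i * B (t i) w).

(* Processes on [0, oo) are indexed by R; only times t >= 0 are constrained. *)
Record is_fbm d (T : measurableType d) (R : realType) (P : probability T R)
    (H : R) (B : R -> T -> R) : Prop := IsFbm {
  fbm_measurable : forall t, 0 <= t -> measurable_fun setT (B t) ;
  fbm_gaussian : gaussian_process P B ;
  fbm_centered : forall t, 0 <= t -> ('E_P[B t] = 0)%E ;
  fbm_covariance : forall s t, 0 <= s -> 0 <= t ->
    ('E_P[(fun w => B t w * B s w)%R] =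
      (2^-1 * (s `^ (2 * H) + t `^ (2 * H) - `|t - s| `^ (2 * H)))%R%:E)%E ;
  fbm_continuous : forall w, {within `[0, +oo[, continuous (fun t => B t w)} ;
  fbm_hoelder : {ae P, forall w, forall lambda, 0 < lambda < H ->
    locally_hoelder lambda (fun t => B t w)} }.

Definition coef_bounded (R : realType) (a b : R -> R) (K : R) : Prop :=
  forall x, `|a x| + `|b x| <= K.

Definition coef_lipschitz (R : realType) (a b : R -> R) (L : R) : Prop :=
  forall x y, `|a x - a y| + `|b x - b y| <= L * `|x - y|.

Definition coef_deriv_hoelder (R : realType) (b : R -> R) (delta : R)
    (RN : nat -> R) : Prop :=
  (forall x, derivable b x 1) /\
  forall N : nat, (1 <= N)%N -> forall x y : R,
    - N%:R <= x <= N%:R -> - N%:R <= y <= N%:R ->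
    `|derive1 b x - derive1 b y| <= RN N * `|x - y| `^ delta.

Definition coef_nondegenerate (R : realType) (a b : R -> R) (M : R) : Prop :=
  forall x, M <= `|a x| /\ M <= `|b x|.

Definition coef_assumptions (R : realType) (H : R) (a b : R -> R) : Prop :=
  exists (delta K L M : R) (RN : nat -> R),
    (H^-1 - 1 < delta <= 1 /\ [/\ 0 < K, 0 < L, 0 < M &
       forall N : nat, (1 <= N)%N -> 0 < RN N]) /\
    [/\ coef_bounded a b K, coef_lipschitz a b L,
        coef_deriv_hoelder b delta RN & coef_nondegenerate a b M].

(* Existence and uniqueness for this equation hold in a class of Hoelder paths;
   sde_hoelder singles out that solution. The equation is an equality in R[i]
   because gls_integral is complex valued. *)
Record is_sde_solution d (T : measurableType d) (R : realType)
    (P : probability T R) (H alpha theta : R) (a b : R -> R) (x0 : R)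
    (B X : R -> T -> R) : Prop := IsSdeSolution {
  sde_measurable : forall t, 0 <= t -> measurable_fun setT (X t) ;
  sde_continuous : forall w, {within `[0, +oo[, continuous (fun t => X t w)} ;
  sde_hoelder : {ae P, forall w, forall lambda, 0 < lambda < H ->
    locally_hoelder lambda (fun t => X t w)} ;
  sde_initial : forall w, X 0 w = x0 ;
  sde_equation : {ae P, forall w, forall t, 0 < t ->
    gls_integrable alpha 0 t (fun s => b (X s w)) (fun s => B s w) /\
    (X t w)%:C%C =
      (X 0 w + theta * (\int[lebesgue_measure]_(s in `[0%R, t]) a (X s w))%R)%:C%C
      + gls_integral alpha 0 t (fun s => b (X s w)) (fun s => B s w)} }.

Definition dyadic (R : realType) (n k : nat) : R := k%:R / 2 ^+ n.

Definition theta_hat2 d (T : measurableType d) (R : realType) (a b : R -> R)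
    (X : R -> T -> R) (n : nat) (w : T) : R :=
  (\sum_(1 <= k < 2 ^ (2 * n))
     (b (X (dyadic R n k.-1) w))^-1 *
     (X (dyadic R n k) w - X (dyadic R n k.-1) w)) /
  ((2 ^+ n)^-1 * \sum_(1 <= k < 2 ^ (2 * n))
     (b (X (dyadic R n k.-1) w))^-1 * a (X (dyadic R n k.-1) w)).

(* Main.v *)
From HB Require Import structures.
Require Import Defs.
From mathcomp Require Import all_boot all_order all_algebra.
From mathcomp Require Import all_classical all_reals all_analysis.
From mathcomp Require Import measurable_realfun complex ring lra.

(** The numerator of the estimator compares X with its Euler expansion. Over a
    short interval [[s, t]] the equation suggests
      X_t - X_s = theta a(X_s) (t - s) - kap b(X_s) (B_t - B_s) + error,
    where kap is the constant [gls_constant] and the sign is the one that the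
    phases in the definition of the integral produce. Dividing by b(X_s) and
    summing over the grid of mesh 2^-n on [[0, 2^n]], the first terms add up to
    theta times the denominator and the noise telescopes. Therefore
      |theta_hat - theta| <= (|kap| |B_T - B_0| + sum of the errors) / |den|.
    By the non-degeneracy of the coefficients a/b is continuous without zeros,
    so the denominator has no cancellations and is at least of order 2^n
    ([estimator_denominator]). The end value B_T is of order 2^(H n) up to
    logarithmic factors, which gives the rate 1 - H. If each local error is of
    order 2^(- 2 beta n), their sum over 4^n cells gives the rate 2 beta - 1.
    It remains to bound the local errors with a constant that has moments.

    The integral. For Hoelder functions the generalized Lebesgue-Stieltjes
    integral is a limit of Riemann sums ([gls_integral_riemann]). The integrand
    is replaced by a step function and the integrator by a piecewise linear
    one, whose fractional derivatives are truncated powers; their pairing is a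
    scaled beta integral, and summation by parts turns it into the Riemann sum
    ([step_chord_pairing]). The left derivative of the step interpolant
    converges in L1, the right derivative of the chord interpolant converges
    uniformly ([step_L1_error], [right_chord_error]). As a consequence the
    increments of a solution path are limits of Euler sums over finer and
    finer dyadic partitions ([sde_path_euler], [block_cvg]).

    The local error. Refining an Euler sum once changes it by products of an
    increment of X and an increment of the noise. With Hoelder order
    beta > 1/2 these changes are summable, and bound the local error by the
    Hoelder constants of X and of B ([dyadic_local_error]). The constant of X
    has no moment bound a priori, but at fine scales the same estimate is a
    contraction and replaces it by one that is linear in the constant Lam of
    the noise ([dyadic_contraction]); returning to coarse scales costs a power,
    and the local error is at most of order Lam^(1 + 1/beta) 2^(- 2 beta n)
    ([dyadic_increment_error]).

    The noise. Increments of fractional Brownian motion are Gaussian, so a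
    small multiple of their normalized squares has a bounded exponential
    moment ([gaussian_exp_square_moment]). Summing these exponentials over all
    pairs of points of all dyadic grids, with geometric weights, and taking a
    logarithm produces a single random variable V with all moments such that
    the increments on the grid of level l are at most of order sqrt (l + 1) V
    times the H-th power of the distance ([fbm_dyadic_growth]). This provides
    Lam of order sqrt n V on [[0, 2^n]] ([driving_bound]), and the random
    constant of the theorem is a multiple of V^3 ([estimator_rate]). *)

Set Implicit Arguments.
Unset Strict Implicit.
Unset Printing Implicit Defensive.

Import Order.TTheory GRing.Theory Num.Theory.
Import numFieldNormedType.Exports.
Local Open Scope classical_set_scope.
Local Open Scope ring_scope.

(** * Lebesgue integrals: affine substitution and powers *)

Section affine.
Context {R : realType}.
Local Notation mu := (@lebesgue_measure R).

Lemma ge0_integral_affine (c b : R) (D : set R) (f : R -> \bar R) :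
  0 < c -> measurable D -> measurable_fun D f -> (forall x, D x -> 0 <= f x)%E ->
  (\int[mu]_(x in D) f x =
   c%:E * \int[mu]_(y in (fun y => c * y + b)%R @^-1` D) f (c * y + b)%R)%E.
Proof.
move=> c0 mD mf f0.
pose phi : measurableTypeR R -> measurableTypeR R := fun y => c * y + b.
have mphi : measurable_fun setT phi.
  by apply: measurable_funD => //; exact: mulrl_measurable.
pose m1 : measure (measurableTypeR R) R :=
  measure_function_pushforward__canonical__measure_function_Measure mu mphi.
pose nn : {nonneg R} := NngNum (ltW c0).
transitivity (\int[mscale nn m1]_(x in D) f x)%E.
  apply: eq_measure_integral => A mA _; apply: lebesgue_measure_unique => //.
  move=> _ [[x y]] _ <-.
  change (lebesgue_measure `]x, y] = c%:E * mu (phi @^-1` `]x, y]))%E.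
  have -> : phi @^-1` `]x, y] = `](x - b) / c, (y - b) / c]%classic.
    apply/seteqP; split => z /=; rewrite !in_itv/= ltr_pdivrMr// ler_pdivlMr//;
      rewrite /phi ltrBlDr lerBrDr [z * c]mulrC; exact.
  rewrite !lebesgue_measure_itv/= !lte_fin ltr_pM2r ?invr_gt0// ltrD2r.
  case: ifPn => xy; last by rewrite mule0.
  rewrite -!EFinD -EFinM; congr EFin; field.
  by rewrite gt_eqF.
rewrite ge0_integral_mscale//; congr (_ * _)%E.
by apply: ge0_integral_pushforward => // x; rewrite inE; exact: f0.
Qed.

Lemma ge0_integral_reflect (b : R) (D : set R) (f : R -> \bar R) :
  measurable D -> measurable_fun D f -> (forall x, D x -> 0 <= f x)%E ->
  (\int[mu]_(x in D) f x =
   \int[mu]_(y in (fun y => b - y)%R @^-1` D) f (b - y)%R)%E.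
Proof.
move=> mD mf f0.
pose phi : measurableTypeR R -> measurableTypeR R := fun y => b - y.
have mphi : measurable_fun setT phi by apply: measurable_funB => //.
pose m1 : measure (measurableTypeR R) R :=
  measure_function_pushforward__canonical__measure_function_Measure mu mphi.
transitivity (\int[m1]_(x in D) f x)%E.
  apply: eq_measure_integral => A mA _; apply: lebesgue_measure_unique => //.
  move=> _ [[x y]] _ <-.
  change (lebesgue_measure `]x, y] = mu (phi @^-1` `]x, y])).
  have -> : phi @^-1` `]x, y] = `[b - y, b - x[%classic.
    by apply/seteqP; split => z /=; rewrite !in_itv/= /phi lerBlDr ltrBrDr
      -lerBlDl ltrBrDl => /andP[h1 h2]; apply/andP; split; lra.
  rewrite !lebesgue_measure_itv/= !lte_fin.
  rewrite [b - y < b - x](_ : _ = (x < y)); last by apply/idP/idP; lra.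
  case: ifPn => xy //.
  by rewrite -!EFinD; congr EFin; ring.
by apply: ge0_integral_pushforward => // x; rewrite inE; exact: f0.
Qed.

End affine.

Section powers.
Context {R : realType}.
Local Notation mu := (@lebesgue_measure R).
Implicit Types a b p q x y : R.

Lemma measurable_powR_aff D (c b p : R) :
  measurable_fun D (fun x => (c * x + b) `^ p).
Proof.
apply: (@measurableT_comp _ _ _ _ _ _ (fun x : R => x `^ p)).
  exact: measurable_powR.
by apply: measurable_funD => //; exact: mulrl_measurable.
Qed.

Lemma integral_powR_pos a b p : 0 < a -> a <= b -> p + 1 != 0 ->
  (\int[mu]_(x in `[a, b]) (x `^ p)%:E =
   ((b `^ (p + 1) - a `^ (p + 1)) / (p + 1))%:E)%E.
Proof.
move=> a0; rewrite le_eqVlt => /predU1P[<-|ab] p1.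
  by rewrite set_itv1 integral_set1 subrr mul0r.
have dx x q : 0 < x -> is_derive x 1 (fun y => y `^ q) (q * x `^ (q - 1)).
  exact: is_derive1_powR.
have cx x q : 0 < x -> {for x, continuous (fun y : R => y `^ q)}.
  move=> x0; apply: differentiable_continuous; apply/derivable1_diffP.
  by have [] := dx x q x0.
have dF x : 0 < x -> is_derive x 1 (fun y => y `^ (p + 1) / (p + 1)) (x `^ p).
  move=> x0; rewrite (_ : (fun _ => _) = (p + 1)^-1 *: (fun y => y `^ (p + 1))).
    rewrite (_ : x `^ p = (p + 1)^-1 *: ((p + 1) * x `^ ((p + 1) - 1))).
      by have h := dx x (p + 1) x0; apply: is_deriveZ.
    by rewrite -[LHS]mulr1 addrK; rewrite /GRing.scale/= mulrA mulVf// mul1r mulr1.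
  by apply/funext => y; rewrite mulrC.
rewrite (@continuous_FTC2 _ _ (fun y => y `^ (p + 1) / (p + 1)) _ _ ab).
- by rewrite -EFinB; congr EFin; rewrite mulrBl.
- apply: continuous_in_subspaceT => x; rewrite inE/= in_itv/= => /andP[ax _].
  by apply: cx; exact: lt_le_trans ax.
- split.
  + move=> x; rewrite in_itv/= => /andP[ax _].
    by have [] := dF x (lt_trans a0 ax).
  + apply: cvg_at_right_filter; apply: cvgMr_tmp; exact: cx.
  + by apply: cvg_at_left_filter; apply: cvgMr_tmp; apply: cx; exact: lt_trans ab.
- move=> x; rewrite in_itv/= => /andP[ax _].
  have := dF x (lt_trans a0 ax) => -[? h].
  by rewrite derive1E h.
Qed.

(** The singular case of negative [p] comes from [integral_powR_pos] on
    [[b / n, b]], by monotone convergence. *)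
Lemma integral_powR0 b p : 0 <= b -> -1 < p ->
  (\int[mu]_(x in `[0%R, b]) (x `^ p)%:E = (b `^ (p + 1) / (p + 1))%:E)%E.
Proof.
move=> b0 p1; have pp : 0 < p + 1 by lra.
move: b0; rewrite le_eqVlt => /predU1P[<-|b0].
  by rewrite set_itv1 integral_set1 powR0 ?mul0r// gt_eqF.
rewrite -integral_itv_obnd_cbnd; last first.
  by apply/measurable_EFinP/measurable_funTS; exact: measurable_powR.
pose F n := `[b / n.+1%:R, b]%classic : set R.
have FU : `]0%R, b]%classic = \bigcup_n F n.
  apply/seteqP; split => x /=; rewrite in_itv/=.
    move=> /andP[x0 xb]; exists (Num.truncn (b / x)) => //.
    rewrite /F/= in_itv/= xb andbT ler_pdivrMr ?ltr0n//.
    rewrite mulrC -ler_pdivrMr//; apply: ltW.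
    exact: truncnS_gt.
  move=> [n _]; rewrite /F/= in_itv/= => /andP[bx ->]; rewrite andbT.
  by apply: lt_le_trans bx; rewrite divr_gt0.
suff H : (\int[mu]_(x in F i) (x `^ p)%:E)%E @[i --> \oo] -->
    (b `^ (p + 1) / (p + 1))%:E.
  rewrite FU; apply: cvg_unique H => //.
  apply: ge0_nondecreasing_set_cvg_integral => //.
  - move=> n m nm; apply/subsetPset => x; rewrite /F/= !in_itv/=.
    move=> /andP[h ->]; rewrite andbT (le_trans _ h)//.
    by rewrite ler_pM2l// lef_pV2 ?posrE ?ltr0n// ler_nat.
  - by move=> i; exact: measurable_itv.
  - by move=> i; apply/measurable_EFinP/measurable_funTS; exact: measurable_powR.
  - by move=> i x _; rewrite lee_fin powR_ge0.
rewrite (_ : (fun _ => _) = (fun n =>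
    ((b `^ (p + 1) - (b / n.+1%:R) `^ (p + 1)) / (p + 1))%:E)); last first.
  apply/funext => n; rewrite /F integral_powR_pos ?gt_eqF ?divr_gt0//.
  by rewrite ler_pdivrMr ?ltr0n// ler_peMr ?ler1n// ltW.
apply/cvg_EFin; first by near=> n.
rewrite /comp/=; apply: cvgMr_tmp.
rewrite -[X in _ --> X]subr0; apply: cvgB; first exact: cvg_cst.
have /cvg_at_rightP H := powR_cvg0 pp.
apply: (H (fun n => b / n.+1%:R)).
split=> [n|]; first by rewrite divr_gt0.
rewrite -[X in _ --> X](mulr0 b); apply: cvgMl_tmp.
exact: cvg_harmonic.
Unshelve. all: by end_near. Qed.

Lemma powR_lt_exponent (a x y : R) : 1 < a -> x < y -> a `^ x < a `^ y.
Proof.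
move=> a1 xy; rewrite -(subrK x y) powRD; last first.
  by apply/implyP => _; rewrite gt_eqF// (lt_trans _ a1).
rewrite ltr_pMl ?powR_gt0 ?(lt_trans _ a1)//.
have -> : 1 = 1 `^ (y - x) :> R by rewrite powR1.
by apply: gt0_ltr_powR; rewrite ?subr_gt0 ?nnegrE ?ler01// ltW// (lt_trans _ a1).
Qed.

Lemma exprn_powR (a g : R) n : 0 <= a -> (a ^+ n) `^ g = (a `^ g) ^+ n.
Proof.
move=> a0; elim: n => [|n IH]; first by rewrite !expr0 powR1.
by rewrite !exprS powRM ?exprn_ge0// IH.
Qed.

End powers.

(** * Integrals controlled by powers *)

Section real_integrals.
Context {R : realType}.
Local Notation mu := (@lebesgue_measure R).
Implicit Types a b c p q x y : R.

Lemma measurable_itvR (i : interval R) :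
  measurable ([set` i] : set (measurableTypeR R)).
Proof. exact: measurable_itv. Qed.

Lemma integrable_le_bound d (T : measurableType d) (m : measure T R)
    (D : set T) (f g : T -> R) :
  measurable D -> measurable_fun D f -> m.-integrable D (EFin \o g) ->
  (forall z, D z -> `|f z| <= g z) -> m.-integrable D (EFin \o f).
Proof.
move=> mD mf ig fg; apply: (le_integrable mD _ _ ig); first exact/measurable_EFinP.
by move=> z Dz; rewrite /= lee_fin (le_trans (fg z Dz))// ler_norm.
Qed.

Lemma integrable_scale d (T : measurableType d) (m : measure T R)
    (D : set T) (k : R) (f : T -> R) : measurable D ->
  m.-integrable D (EFin \o f) -> m.-integrable D (EFin \o (fun z => k * f z)).
Proof. by move=> mD jf; exact: (integrableZl mD k jf). Qed.

Lemma integrable_add d (T : measurableType d) (m : measure T R)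
    (D : set T) (f g : T -> R) : measurable D ->
  m.-integrable D (EFin \o f) -> m.-integrable D (EFin \o g) ->
  m.-integrable D (EFin \o (fun z => f z + g z)).
Proof. by move=> mD jf jg; exact: (integrableD mD jf jg). Qed.

Lemma integrable_sub d (T : measurableType d) (m : measure T R)
    (D : set T) (f g : T -> R) : measurable D ->
  m.-integrable D (EFin \o f) -> m.-integrable D (EFin \o g) ->
  m.-integrable D (EFin \o (fun z => f z - g z)).
Proof. by move=> mD jf jg; exact: (integrableB mD jf jg). Qed.

Lemma integrable_bigsum d (T : measurableType d) (m : measure T R)
    (D : set T) (I : Type) (s : seq I) (f : I -> T -> R) : measurable D ->
  (forall i, m.-integrable D (EFin \o f i)) ->
  m.-integrable D (EFin \o (fun z => \sum_(i <- s) f i z)) /\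
  \int[m]_(z in D) (\sum_(i <- s) f i z) = \sum_(i <- s) \int[m]_(z in D) f i z.
Proof.
move=> mD jf; elim: s => [|i s [IHi IHe]].
  rewrite big_nil; split.
    rewrite (_ : EFin \o _ = cst 0%E); first exact: integrable0.
    by apply/funext => z; rewrite /= big_nil.
  rewrite (_ : (fun _ => _) = cst 0); first by rewrite Rintegral_cst// mul0r.
  by apply/funext => z; rewrite big_nil.
rewrite big_cons -IHe -(RintegralD mD (jf i) IHi).
have E z : \sum_(j <- i :: s) f j z = f i z + \sum_(j <- s) f j z.
  by rewrite big_cons.
split; last by congr Rintegral; apply/funext.
rewrite (_ : EFin \o _ = EFin \o (fun z => f i z + \sum_(j <- s) f j z)).
  exact: integrable_add.
by apply/funext => z; rewrite /= E.
Qed.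

Lemma Rintegral_le_bound d (T : measurableType d) (m : measure T R)
    (D : set T) (f g : T -> R) :
  measurable D -> measurable_fun D f -> m.-integrable D (EFin \o g) ->
  (forall z, D z -> `|f z| <= g z) ->
  `| \int[m]_(z in D) f z | <= \int[m]_(z in D) g z.
Proof.
move=> mD mf ig fg; have jf := integrable_le_bound mD mf ig fg.
apply: le_trans (le_normr_Rintegral mD jf) _.
by apply: le_Rintegral => //; exact: integrable_norm.
Qed.

(** For a nonnegative function a finite value of the extended integral gives
    integrability and the real integral together; all the power integrals
    below are computed once, as extended integrals, and transferred here. *)
Lemma ge0_integral_EFin_val d (T : measurableType d) (m : measure T R)
    (D : set T) (f : T -> R) (r : R) :
  measurable D -> measurable_fun D f -> (forall z, D z -> 0 <= f z) ->
  (\int[m]_(z in D) (f z)%:E = r%:E)%E ->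
  m.-integrable D (EFin \o f) /\ \int[m]_(z in D) f z = r.
Proof.
move=> mD mf f0 E; split; last by rewrite /Rintegral E.
apply/integrableP; split; first exact/measurable_EFinP.
rewrite (eq_integral (fun z => (f z)%:E)) ?E ?ltry// => x.
by rewrite inE => Dx /=; rewrite ger0_norm// f0.
Qed.

Lemma Rintegral_itv_split a b c (f : R -> R) : a <= c -> c <= b ->
  mu.-integrable `[a, b] (EFin \o f) ->
  \int[mu]_(x in `[a, b]) f x =
  \int[mu]_(x in `[a, c]) f x + \int[mu]_(x in `[c, b]) f x.
Proof.
move=> ac cb jf.
have jcb : mu.-integrable `]c, b] (EFin \o f).
  by apply: integrableS jf => //; apply: subset_itvr; rewrite bnd_simp.
rewrite -[X in _ + X]Rintegral_itv_obnd_cbnd//.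
by rewrite -(@Rintegral_itvB _ f (BLeft a) (BRight b) c)// ?bnd_simp// addrC subrK.
Qed.

Lemma measurable_powR_sub D b p : measurable_fun D (fun u : R => (b - u) `^ p).
Proof.
have := measurable_powR_aff (D := D) (-1) b p.
by under eq_fun do rewrite mulN1r addrC.
Qed.

Lemma measurable_powR_subr D b p : measurable_fun D (fun u : R => (u - b) `^ p).
Proof.
have := measurable_powR_aff (D := D) 1 (- b) p.
by under eq_fun do rewrite mul1r.
Qed.

Lemma powR_integral_left a b p : a <= b -> -1 < p ->
  mu.-integrable `[a, b] (EFin \o (fun u => (u - a) `^ p)) /\
  \int[mu]_(u in `[a, b]) ((u - a) `^ p) = (b - a) `^ (p + 1) / (p + 1).
Proof.
move=> ab p1; apply: ge0_integral_EFin_val => //.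
- exact: measurable_powR_subr.
- by move=> x _; exact: powR_ge0.
rewrite (@ge0_integral_affine _ 1 a)//.
- rewrite mul1e (_ : _ @^-1` _ = `[0, b - a]%classic); last first.
    by apply/seteqP; split => z /=; rewrite !in_itv/=; lra.
  under eq_integral do rewrite mul1r addrK.
  by rewrite integral_powR0// subr_ge0.
- by apply/measurable_EFinP; exact: measurable_powR_subr.
- by move=> x _; rewrite lee_fin powR_ge0.
Qed.

Lemma powR_integral_right a b p : a <= b -> -1 < p ->
  mu.-integrable `[a, b] (EFin \o (fun u => (b - u) `^ p)) /\
  \int[mu]_(u in `[a, b]) ((b - u) `^ p) = (b - a) `^ (p + 1) / (p + 1).
Proof.
move=> ab p1; apply: ge0_integral_EFin_val => //.
- exact: measurable_powR_sub.
- by move=> x _; exact: powR_ge0.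
rewrite (@ge0_integral_reflect _ b)//.
- rewrite (_ : _ @^-1` _ = `[0, b - a]%classic); last first.
    by apply/seteqP; split => z /=; rewrite !in_itv/=; lra.
  under eq_integral do rewrite opprB addrC subrK.
  by rewrite integral_powR0// subr_ge0.
- by apply/measurable_EFinP; exact: measurable_powR_sub.
- by move=> x _; rewrite lee_fin powR_ge0.
Qed.

Lemma powR_integral_far_left a c x p : a <= c -> c < x -> p + 1 != 0 ->
  mu.-integrable `[a, c] (EFin \o (fun u => (x - u) `^ p)) /\
  \int[mu]_(u in `[a, c]) ((x - u) `^ p) =
    ((x - a) `^ (p + 1) - (x - c) `^ (p + 1)) / (p + 1).
Proof.
move=> ac cx p1; apply: ge0_integral_EFin_val => //.
- exact: measurable_powR_sub.
- by move=> u _; exact: powR_ge0.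
rewrite (@ge0_integral_reflect _ x)//.
- rewrite (_ : _ @^-1` _ = `[x - c, x - a]%classic); last first.
    by apply/seteqP; split => z /=; rewrite !in_itv/=; lra.
  under eq_integral do rewrite opprB addrC subrK.
  by rewrite integral_powR_pos// ?subr_gt0//; lra.
- by apply/measurable_EFinP; exact: measurable_powR_sub.
- by move=> u _; rewrite lee_fin powR_ge0.
Qed.

Lemma powR_integral_far_right c b x p : c <= b -> x < c -> p + 1 != 0 ->
  mu.-integrable `[c, b] (EFin \o (fun u => (u - x) `^ p)) /\
  \int[mu]_(u in `[c, b]) ((u - x) `^ p) =
    ((b - x) `^ (p + 1) - (c - x) `^ (p + 1)) / (p + 1).
Proof.
move=> cb xc p1; apply: ge0_integral_EFin_val => //.
- exact: measurable_powR_subr.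
- by move=> u _; exact: powR_ge0.
rewrite (@ge0_integral_affine _ 1 x)//.
- rewrite mul1e (_ : _ @^-1` _ = `[c - x, b - x]%classic); last first.
    by apply/seteqP; split => z /=; rewrite !in_itv/=; lra.
  under eq_integral do rewrite mul1r addrK.
  by rewrite integral_powR_pos// ?subr_gt0//; lra.
- by apply/measurable_EFinP; exact: measurable_powR_subr.
- by move=> u _; rewrite lee_fin powR_ge0.
Qed.

(** Euler's beta integral B(1 - al, 1 + al). *)
Definition beta_pairing (al : R) : R :=
  \int[mu]_(y in `[0, 1]) (y `^ (- al) * (1 - y) `^ al).

(** The two exponents cancel under the substitution x = (b - a) y + a, so only
    the Jacobian b - a remains. This linearity in b - a is what turns the
    pairing of a step with a kink into a Riemann sum. *)
Lemma beta_pairing_scaling (al a b : R) : 0 < al < 1 -> a <= b ->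
  mu.-integrable `[a, b] (EFin \o (fun x => (x - a) `^ (- al) * (b - x) `^ al)) /\
  \int[mu]_(x in `[a, b]) ((x - a) `^ (- al) * (b - x) `^ al) =
    (b - a) * beta_pairing al.
Proof.
move=> /andP[al0 al1] ab.
have mf c d : measurable_fun `[c, d] (fun x => (x - c) `^ (- al) * (d - x) `^ al).
  apply: measurable_funM; first exact: measurable_powR_subr.
  exact: measurable_powR_sub.
have i01 c d : c <= d ->
    mu.-integrable `[c, d] (EFin \o (fun x => (x - c) `^ (- al) * (d - x) `^ al)).
  move=> cd; have [iL _] := @powR_integral_left c d (- al) cd ltac:(lra).
  have iS := integrable_scale ((d - c) `^ al) (@measurable_itvR _) iL.
  apply: (integrable_le_bound (@measurable_itvR _) (mf c d) iS).
  move=> x /=; rewrite in_itv/= => /andP[cx xd].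
  rewrite ger0_norm ?mulr_ge0 ?powR_ge0// mulrC ler_wpM2r ?powR_ge0//.
  by apply: ge0_ler_powR; rewrite ?nnegrE; lra.
split; first exact: i01.
move: ab; rewrite le_eqVlt => /predU1P[<-|ab].
  by rewrite set_itv1 Rintegral_set1 subrr mul0r.
have ba : 0 < b - a by lra.
rewrite /Rintegral (@ge0_integral_affine _ (b - a) a)//.
- rewrite (_ : _ @^-1` _ = `[0, 1]%classic); last first.
    apply/seteqP; split => z /=; rewrite !in_itv/= -lerBlDr subrr -lerBrDr.
      by rewrite pmulr_rge0// ger_pMr.
    by rewrite pmulr_rge0// ger_pMr.
  rewrite [X in (_ * X)%E](_ : _ =
      \int[mu]_(y in `[0%R, 1%R]) (y `^ (- al) * (1 - y) `^ al)%:E)%E; last first.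
    apply: eq_integral => y; rewrite inE/= in_itv/= => /andP[y0 y1]; congr EFin.
    rewrite addrK (_ : b - ((b - a) * y + a) = (b - a) * (1 - y)); last by ring.
    rewrite !powRM ?subr_ge0// ?ltW// powRN.
    rewrite mulrACA mulVf ?mul1r//.
    by rewrite gt_eqF// powR_gt0.
  rewrite fineM//; apply: integrable_fin_num => //.
  have := i01 0 1 ler01.
  rewrite (_ : EFin \o _ = fun y => (y `^ (- al) * (1 - y) `^ al)%:E)//.
  by apply/funext => y; rewrite /= subr0.
- by apply/measurable_EFinP; exact: mf.
- by move=> x _; rewrite lee_fin mulr_ge0// powR_ge0.
Qed.

End real_integrals.

(** * Fractional derivatives without their Gamma factors *)

Section marchaud.
Context {R : realType}.
Local Notation mu := (@lebesgue_measure R).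
Implicit Types (al a b c p q x y l C t : R) (f g : R -> R).

(** Derivatives of steps and kinks vanish on part of the interval; this
    transfers an integral from the support to the whole interval. *)
Lemma zero_extension (D E : set R) f g :
  measurable (D : set (measurableTypeR R)) ->
  measurable (E : set (measurableTypeR R)) -> f \_ D = g \_ E ->
  mu.-integrable D (EFin \o f) ->
  mu.-integrable E (EFin \o g) /\ \int[mu]_(x in D) f x = \int[mu]_(x in E) g x.
Proof.
move=> mD mE fg; rewrite (integrable_mkcond _ mD) => iD; split; last first.
  by rewrite Rintegral_mkcond fg -Rintegral_mkcond.
rewrite (integrable_mkcond _ mE).
rewrite (_ : (EFin \o g) \_ E = (EFin \o f) \_ D)//.
apply/funext => z; have /(congr1 (fun h => h z)) := fg.
by rewrite !patchE; do 2 case: ifP => _ /=; first [by move=> -> | by move=> <- | by []].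
Qed.

Definition pos_part (x : R) := Num.max x 0.

Lemma pos_part_id x : 0 <= x -> pos_part x = x.
Proof. by move=> x0; rewrite /pos_part max_l. Qed.

Lemma pos_part_0 x : x <= 0 -> pos_part x = 0.
Proof. by move=> x0; rewrite /pos_part max_r. Qed.

Definition marchaud_left al f x :=
  f x / x `^ al + al * \int[mu]_(u in `[0, x]) frac_left_integrand al f x u.

Definition marchaud_right al t g x :=
  g x / (t - x) `^ (1 - al) +
  (1 - al) * \int[mu]_(u in `[x, t]) frac_right_integrand al g x u.

Lemma measurable_left_integrand al f x D :
  measurable_fun D f -> measurable_fun D (frac_left_integrand al f x).
Proof.
move=> mf; rewrite (_ : frac_left_integrand al f x =
  (fun u => (f x - f u) * (x - u) `^ (- (1 + al)))); last first.
  by apply/funext => u; rewrite powRN.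
by apply: measurable_funM; [exact: measurable_funB|exact: measurable_powR_sub].
Qed.

Lemma measurable_right_integrand al g x D :
  measurable_fun D g -> measurable_fun D (frac_right_integrand al g x).
Proof.
move=> mg; rewrite (_ : frac_right_integrand al g x =
  (fun u => (g x - g u) * (u - x) `^ (- (2 - al)))); last first.
  by apply/funext => u; rewrite powRN.
by apply: measurable_funM; [exact: measurable_funB|exact: measurable_powR_subr].
Qed.

(** Hoelder continuity of order [l] weakens the singularity of order [1 + al]
    to the integrable order [1 + al - l]. *)
Lemma left_integrand_near al f a x C l : a <= x -> 0 <= C -> al < l ->
  measurable_fun `[a, x] f ->
  (forall u, a <= u <= x -> `|f x - f u| <= C * (x - u) `^ l) ->
  mu.-integrable `[a, x] (EFin \o frac_left_integrand al f x) /\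
  `| \int[mu]_(u in `[a, x]) frac_left_integrand al f x u | <=
    C * (x - a) `^ (l - al) / (l - al).
Proof.
move=> ax C0 l0 mf hf.
have [iR eR] := @powR_integral_right _ a x (l - al - 1) ax ltac:(lra).
have iS := integrable_scale C (@measurable_itvR _ _) iR.
have ms := @measurable_left_integrand al f x _ mf.
have hb z : `[a, x]%classic z ->
    `|frac_left_integrand al f x z| <= C * (x - z) `^ (l - al - 1).
  rewrite /= in_itv/= => /andP[az]; rewrite le_eqVlt => /predU1P[->|zx].
    by rewrite /frac_left_integrand subrr mul0r normr0 mulr_ge0// powR_ge0.
  rewrite /frac_left_integrand normrM normfV [`|_ `^ (1 + al)|]ger0_norm ?powR_ge0//.
  rewrite ler_pdivrMr ?powR_gt0 ?subr_gt0// -mulrA -powRD; last first.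
    by apply/implyP => _; rewrite gt_eqF// subr_gt0.
  rewrite (_ : l - al - 1 + (1 + al) = l); last by ring.
  by apply: hf; rewrite az ltW.
split; first exact: (integrable_le_bound (@measurable_itvR _ _) ms iS hb).
have := Rintegral_le_bound (@measurable_itvR _ _) ms iS hb.
rewrite (RintegralZl C (@measurable_itvR _ _) iR) eR.
by rewrite subrK mulrA.
Qed.

Let subset_itvco a c : `[a, c[%classic `<=` `[a, c]%classic.
Proof. by move=> z; exact: subset_itv_co_cc. Qed.

(** Away from the diagonal only the oscillation of [f] counts; the endpoint
    [c] is excluded from the hypothesis because step interpolants jump
    there. *)
Lemma left_integrand_far al f a c x C : a <= c -> c < x -> 0 <= C -> 0 < al ->
  measurable_fun `[a, c] f ->
  (forall u, a <= u < c -> `|f x - f u| <= C) ->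
  `| \int[mu]_(u in `[a, c]) frac_left_integrand al f x u | <=
    C * (x - c) `^ (- al) / al.
Proof.
move=> ac cx C0 l0 mf hf.
have [iR eR] := @powR_integral_far_left _ a c x (- al - 1) ac cx ltac:(lra).
have iS := integrable_scale C (@measurable_itvR _ `[a, c[)
  (integrableS (@measurable_itvR _ _) (@measurable_itvR _ _)
    (@subset_itvco a c) iR).
have ms : measurable_fun `[a, c[ (frac_left_integrand al f x).
  apply: measurable_left_integrand.
  by apply: (measurable_funS _ (@subset_itvco a c) mf).
have hb z : `[a, c[%classic z ->
    `|frac_left_integrand al f x z| <= C * (x - z) `^ (- al - 1).
  rewrite /= in_itv/= => /andP[az zc].
  rewrite /frac_left_integrand normrM normfV [`|_ `^ (1 + al)|]ger0_norm ?powR_ge0//.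
  rewrite -opprD [al + 1]addrC powRN ler_wpM2r ?invr_ge0 ?powR_ge0//.
  by apply: hf; rewrite az.
rewrite -Rintegral_itv_bndo_bndc; last first.
  exact: (integrable_le_bound (@measurable_itvR _ _) ms iS hb).
apply: le_trans (Rintegral_le_bound (@measurable_itvR _ _) ms iS hb) _.
have iRo := integrableS (@measurable_itvR _ _) (@measurable_itvR _ _)
  (@subset_itvco a c) iR.
rewrite (RintegralZl C (@measurable_itvR _ _) iRo) Rintegral_itv_bndo_bndc//.
rewrite eR subrK -mulrA ler_wpM2l// invrN mulrN -mulNr opprB.
by rewrite ler_pM2r ?invr_gt0// gerDl oppr_le0 powR_ge0.
Qed.

Lemma right_integrand_near al g x b C l : x <= b -> 0 <= C -> 1 - al < l ->
  measurable_fun `[x, b] g ->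
  (forall u, x <= u <= b -> `|g x - g u| <= C * (u - x) `^ l) ->
  mu.-integrable `[x, b] (EFin \o frac_right_integrand al g x) /\
  `| \int[mu]_(u in `[x, b]) frac_right_integrand al g x u | <=
    C * (b - x) `^ (l + al - 1) / (l + al - 1).
Proof.
move=> xb C0 l0 mg hg.
have [iR eR] := @powR_integral_left _ x b (l + al - 2) xb ltac:(lra).
have iS := integrable_scale C (@measurable_itvR _ _) iR.
have ms := @measurable_right_integrand al g x _ mg.
have hb z : `[x, b]%classic z ->
    `|frac_right_integrand al g x z| <= C * (z - x) `^ (l + al - 2).
  rewrite /= in_itv/= => /andP[+ zb]; rewrite le_eqVlt => /predU1P[<-|xz].
    by rewrite /frac_right_integrand subrr mul0r normr0 mulr_ge0// powR_ge0.
  rewrite /frac_right_integrand normrM normfV [`|_ `^ (2 - al)|]ger0_norm ?powR_ge0//.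
  rewrite ler_pdivrMr ?powR_gt0 ?subr_gt0// -mulrA -powRD; last first.
    by apply/implyP => _; rewrite gt_eqF// subr_gt0.
  rewrite (_ : l + al - 2 + (2 - al) = l); last by ring.
  by apply: hg; rewrite zb ltW.
split; first exact: (integrable_le_bound (@measurable_itvR _ _) ms iS hb).
have := Rintegral_le_bound (@measurable_itvR _ _) ms iS hb.
rewrite (RintegralZl C (@measurable_itvR _ _) iR) eR.
by rewrite (_ : l + al - 2 + 1 = l + al - 1) ?mulrA//; ring.
Qed.

End marchaud.

(** * Explicit derivatives of steps and kinks *)

Section explicit_marchaud.
Context {R : realType}.
Local Notation mu := (@lebesgue_measure R).
Implicit Types (al a b c p q x y l C t : R) (f g : R -> R).

(** The derivative of a function of the form step (resp. kink) is a truncated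
    power. Any step function is a combination of the former, any piecewise
    linear function of the latter. *)
Definition step c (u : R) : R := (c <= u)%R%:R.
Definition kink p (u : R) : R := pos_part (p - u).

Lemma marchaud_left_step al c x : 0 < al -> 0 <= c -> 0 < x -> x != c ->
  mu.-integrable `[0, x] (EFin \o frac_left_integrand al (step c) x) /\
  marchaud_left al (step c) x = pos_part (x - c) `^ (- al).
Proof.
move=> al0 c0 x0 xc.
have [xltc|cx] := ltP x c.
  have z0 u : `[0, x]%classic u -> frac_left_integrand al (step c) x u = 0.
    rewrite /= in_itv/= => /andP[_ ux]; rewrite /frac_left_integrand /step.
    by rewrite !leNgt xltc (le_lt_trans ux xltc) subrr mul0r.
  split.
    apply: (@eq_integrable _ _ _ _ _ (@measurable_itvR _ _) (cst 0%E)).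
      by move=> u; rewrite inE => /z0 uE; rewrite /= uE.
    exact: integrable0.
  rewrite /marchaud_left (@eq_Rintegral _ _ _ _ _ (cst 0)); last first.
    by move=> u; rewrite inE => /z0.
  rewrite Rintegral_cst ?mul0r ?mulr0 ?addr0; last exact: measurable_itvR.
  rewrite /step leNgt xltc mul0r pos_part_0 ?powR0 ?oppr_eq0 ?gt_eqF//.
  by rewrite subr_le0 ltW.
have {}xc : c < x by rewrite lt_neqAle eq_sym xc.
have [iR eR] := @powR_integral_far_left _ 0 c x (- al - 1) c0 xc ltac:(lra).
have iRo : mu.-integrable `[0, c[ (EFin \o (fun u => (x - u) `^ (- al - 1))).
  apply: (integrableS (@measurable_itvR _ _) (@measurable_itvR _ _) _ iR).
  by move=> z; exact: subset_itv_co_cc.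
have [||||iS eS] := zero_extension (D := `[0, c[) (E := `[0, x])
  (f := fun u => (x - u) `^ (- al - 1)) (g := frac_left_integrand al (step c) x).
- exact: measurable_itvR.
- exact: measurable_itvR.
- apply/funext => u; rewrite !patchE !mem_setE !in_itv/= /frac_left_integrand /step.
  rewrite cx; case: (leP 0 u) => //= u0; case: (ltP u c) => uc.
    by rewrite (ltW (lt_trans uc xc)) subr0 mul1r -powRN opprD [- 1 - al]addrC.
  by case: ifP => // _; rewrite subrr mul0r.
- by [].
split => //.
rewrite /marchaud_left -eS Rintegral_itv_bndo_bndc// eR subrK subr0 /step cx.
rewrite pos_part_id ?subr_ge0// !powRN mul1r; field.
by rewrite !gt_eqF ?powR_gt0 ?subr_gt0.
Qed.

Lemma kink_lipschitz p x y : `|kink p x - kink p y| <= `|x - y|.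
Proof.
have h1 := ler_norm (x - y); have h2 : y - x <= `|x - y| by rewrite distrC ler_norm.
move: h1 h2; set d := `|x - y| => h1 h2; rewrite ler_norml /kink /pos_part.
by case: (leP (p - x) 0) => ?; case: (leP (p - y) 0) => ?; apply/andP; split; lra.
Qed.

Lemma measurable_kink D p : measurable_fun D (kink p).
Proof.
apply: measurable_maxr => //; apply: measurable_funB => //.
Qed.

Lemma marchaud_right_kink al p x t : 0 < al < 1 -> p <= t -> x <= t ->
  mu.-integrable `[x, t] (EFin \o frac_right_integrand al (kink p) x) /\
  marchaud_right al t (kink p) x = pos_part (p - x) `^ al / al.
Proof.
move=> /andP[al0 al1] pt xt.
have [iI _] : mu.-integrable `[x, t] (EFin \o frac_right_integrand al (kink p) x) /\
   `| \int[mu]_(u in `[x, t]) frac_right_integrand al (kink p) x u | <=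
    1 * (t - x) `^ (1 + al - 1) / (1 + al - 1).
  apply: right_integrand_near => //; first lra.
    exact: measurable_kink.
  move=> u /andP[xu ut]; rewrite powRr1 ?subr_ge0// mul1r.
  by rewrite -[u - x]ger0_norm ?subr_ge0// distrC; exact: kink_lipschitz.
split => //.
rewrite /marchaud_right.
have [px|xp] := leP p x.
  rewrite (@eq_Rintegral _ _ _ _ _ (cst 0)); last first.
    move=> u; rewrite inE/= in_itv/= => /andP[xu ut].
    rewrite /frac_right_integrand /kink !pos_part_0 ?subrr ?mul0r//; lra.
  rewrite Rintegral_cst ?mul0r ?mulr0 ?addr0; last exact: measurable_itvR.
  by rewrite /kink pos_part_0 ?mul0r ?powR0 ?mul0r// ?gt_eqF//; lra.
rewrite (@Rintegral_itv_split _ x t p)//; last exact: ltW.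
have [_ e1] := @powR_integral_left _ x p (al - 1) (ltW xp) ltac:(lra).
have -> : \int[mu]_(u in `[x, p]) frac_right_integrand al (kink p) x u =
    \int[mu]_(u in `[x, p]) ((u - x) `^ (al - 1)).
  apply: eq_Rintegral => u; rewrite inE/= in_itv/= => /andP[xu up].
  rewrite /frac_right_integrand /kink !pos_part_id; [|lra|lra].
  rewrite (_ : p - x - (p - u) = u - x); last by ring.
  move: xu; rewrite le_eqVlt => /predU1P[<-|xu].
    by rewrite subrr mul0r powR0//; lra.
  rewrite -powRN -[X in X * _]powRr1; last lra.
  rewrite -powRD; last by apply/implyP => _; rewrite gt_eqF// subr_gt0.
  by congr (_ `^ _); ring.
have [i2 e2] := @powR_integral_far_right _ p t x (al - 2) pt xp ltac:(lra).
have -> : \int[mu]_(u in `[p, t]) frac_right_integrand al (kink p) x u =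
    \int[mu]_(u in `[p, t]) ((p - x) * (u - x) `^ (al - 2)).
  apply: eq_Rintegral => u; rewrite inE/= in_itv/= => /andP[pu ut].
  rewrite /frac_right_integrand /kink pos_part_id; last lra.
  rewrite pos_part_0; last lra.
  by rewrite subr0 -powRN opprB.
rewrite (RintegralZl (p - x) (@measurable_itvR _ _) i2) e1 e2.
rewrite /kink pos_part_id; last lra.
rewrite subrK (_ : al - 2 + 1 = al - 1); last by ring.
rewrite -powRN opprB.
have -> : (p - x) `^ al = (p - x) * (p - x) `^ (al - 1).
  by rewrite mulr_powRB1// subr_ge0 ltW.
field; apply/andP; split; lra.
Qed.

Lemma marchaud_left_lincomb al x (I : Type) (s : seq I) (cc : I -> R)
    (F : I -> R -> R) f :
  mu.-integrable `[0, x] (EFin \o frac_left_integrand al f x) ->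
  (forall i, mu.-integrable `[0, x] (EFin \o frac_left_integrand al (F i) x)) ->
  let h := fun u => f u - \sum_(i <- s) cc i * F i u in
  mu.-integrable `[0, x] (EFin \o frac_left_integrand al h x) /\
  marchaud_left al h x =
    marchaud_left al f x - \sum_(i <- s) cc i * marchaud_left al (F i) x.
Proof.
move=> jf jF h.
have jcF i : mu.-integrable `[0, x]
    (EFin \o (fun u => cc i * frac_left_integrand al (F i) x u)).
  exact: (integrable_scale (cc i) (@measurable_itvR _ _) (jF i)).
have [jS eS] := integrable_bigsum s (@measurable_itvR _ _) jcF.
have E : frac_left_integrand al h x = fun u => frac_left_integrand al f x u -
    \sum_(i <- s) cc i * frac_left_integrand al (F i) x u.
  apply/funext => u; rewrite /frac_left_integrand /h.
  have -> : \sum_(i <- s) cc i * F i x =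
      \sum_(i <- s) cc i * F i u + \sum_(i <- s) cc i * (F i x - F i u).
    by rewrite -big_split/=; apply: eq_bigr => i _; ring.
  rewrite (_ : f x - _ - _ = (f x - f u) - \sum_(i <- s) cc i * (F i x - F i u));
    last by ring.
  rewrite mulrBl mulr_suml; congr (_ - _).
  by apply: eq_bigr => i _; rewrite mulrA.
rewrite /marchaud_left E; split; first exact: (integrable_sub (@measurable_itvR _ _) jf jS).
rewrite (RintegralB (@measurable_itvR _ _) jf jS) eS /h mulrBl mulrBr.
rewrite addrACA -opprD; congr (_ - _).
rewrite mulr_suml mulr_sumr -big_split/=; apply: eq_bigr => i _.
rewrite (RintegralZl (cc i) (@measurable_itvR _ _) (jF i)); ring.
Qed.

Lemma marchaud_right_lincomb al t x (I : Type) (s : seq I) (cc : I -> R)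
    (F : I -> R -> R) f :
  mu.-integrable `[x, t] (EFin \o frac_right_integrand al f x) ->
  (forall i, mu.-integrable `[x, t] (EFin \o frac_right_integrand al (F i) x)) ->
  let h := fun u => f u - \sum_(i <- s) cc i * F i u in
  mu.-integrable `[x, t] (EFin \o frac_right_integrand al h x) /\
  marchaud_right al t h x =
    marchaud_right al t f x - \sum_(i <- s) cc i * marchaud_right al t (F i) x.
Proof.
move=> jf jF h.
have jcF i : mu.-integrable `[x, t]
    (EFin \o (fun u => cc i * frac_right_integrand al (F i) x u)).
  exact: (integrable_scale (cc i) (@measurable_itvR _ _) (jF i)).
have [jS eS] := integrable_bigsum s (@measurable_itvR _ _) jcF.
have E : frac_right_integrand al h x = fun u => frac_right_integrand al f x u -
    \sum_(i <- s) cc i * frac_right_integrand al (F i) x u.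
  apply/funext => u; rewrite /frac_right_integrand /h.
  have -> : \sum_(i <- s) cc i * F i x =
      \sum_(i <- s) cc i * F i u + \sum_(i <- s) cc i * (F i x - F i u).
    by rewrite -big_split/=; apply: eq_bigr => i _; ring.
  rewrite (_ : f x - _ - _ = (f x - f u) - \sum_(i <- s) cc i * (F i x - F i u));
    last by ring.
  rewrite mulrBl mulr_suml; congr (_ - _).
  by apply: eq_bigr => i _; rewrite mulrA.
rewrite /marchaud_right E; split; first exact: (integrable_sub (@measurable_itvR _ _) jf jS).
rewrite (RintegralB (@measurable_itvR _ _) jf jS) eS /h mulrBl mulrBr.
rewrite addrACA -opprD; congr (_ - _).
rewrite mulr_suml mulr_sumr -big_split/=; apply: eq_bigr => i _.
rewrite (RintegralZl (cc i) (@measurable_itvR _ _) (jF i)); ring.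
Qed.

Lemma pos_powR_integral al c t : al < 1 -> al != 0 -> 0 <= c <= t ->
  mu.-integrable `[0, t] (EFin \o (fun x => pos_part (x - c) `^ (- al))) /\
  \int[mu]_(x in `[0, t]) (pos_part (x - c) `^ (- al)) =
    (t - c) `^ (1 - al) / (1 - al).
Proof.
move=> al1 al0 /andP[c0 ct].
have [iR eR] := @powR_integral_left _ c t (- al) ct ltac:(lra).
have [||||iS eS] := zero_extension (D := `[c, t]) (E := `[0, t])
  (f := fun u => (u - c) `^ (- al)) (g := fun x => pos_part (x - c) `^ (- al)).
- exact: measurable_itvR.
- exact: measurable_itvR.
- apply/funext => u; rewrite !patchE !mem_setE !in_itv/=.
  case: (leP u t) => ut; last by rewrite !andbF.
  rewrite !andbT; case: (leP c u) => cu.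
    by rewrite (le_trans c0 cu) pos_part_id// subr_ge0.
  case: ifP => // _; rewrite pos_part_0 ?powR0 ?oppr_eq0//.
  by rewrite subr_le0 ltW.
- by [].
by rewrite -eS eR [- al + 1]addrC.
Qed.

(** The truncated powers overlap on [[c, p]] only, where the integral is the
    scaled beta integral. *)
Lemma step_kink_pairing al c p t : 0 < al < 1 -> 0 <= c -> c <= t -> p <= t ->
  mu.-integrable `[0, t]
    (EFin \o (fun x => pos_part (x - c) `^ (- al) * pos_part (p - x) `^ al)) /\
  \int[mu]_(x in `[0, t]) (pos_part (x - c) `^ (- al) * pos_part (p - x) `^ al) =
    pos_part (p - c) * beta_pairing al.
Proof.
move=> /andP[al0 al1] c0 ct pt.
have [pc|cp] := leP p c.
  have E u : pos_part (u - c) `^ (- al) * pos_part (p - u) `^ al = 0.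
    have [uc|cu] := leP u c.
      by rewrite [X in X `^ (- al)]pos_part_0 ?powR0 ?mul0r// ?oppr_eq0 ?gt_eqF//; lra.
    by rewrite [X in X `^ al]pos_part_0 ?powR0 ?mulr0// ?gt_eqF//; lra.
  rewrite (_ : (fun _ => _) = cst 0); last by apply/funext => u; rewrite E.
  split; first exact: integrable0.
  rewrite Rintegral_cst; last exact: measurable_itvR.
  by rewrite pos_part_0 ?mul0r//; lra.
have [iR eR] := @beta_pairing_scaling _ al c p ltac:(by rewrite al0) (ltW cp).
have [||||iS eS] := zero_extension (D := `[c, p]) (E := `[0, t])
  (f := fun x => (x - c) `^ (- al) * (p - x) `^ al)
  (g := fun x => pos_part (x - c) `^ (- al) * pos_part (p - x) `^ al).
- exact: measurable_itvR.
- exact: measurable_itvR.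
- apply/funext => u; rewrite !patchE !mem_setE !in_itv/=.
  case: (leP c u) => cu /=; last first.
    case: ifP => // _.
    rewrite [X in X `^ (- al)]pos_part_0 ?powR0 ?mul0r// ?oppr_eq0 ?gt_eqF//; lra.
  rewrite (le_trans c0 cu)/=; case: (leP u p) => up.
    by rewrite (le_trans up pt) !pos_part_id// subr_ge0.
  by case: ifP => // _; rewrite [X in X `^ al]pos_part_0 ?powR0 ?mulr0// ?gt_eqF//; lra.
- by [].
by split => //; rewrite -eS eR pos_part_id// subr_ge0 ltW.
Qed.

End explicit_marchaud.

(** * Interpolation on a regular grid *)

Section grid.
Context {R : realType}.
Implicit Types (al x y u l C t dl : R) (f g : R -> R) (N : nat).

Lemma grid_cell dl N u : 0 < dl -> 0 <= u < N%:R * dl ->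
  exists2 j, (j < N)%N & j%:R * dl <= u < j.+1%:R * dl.
Proof.
move=> dl0 /andP[u0 uN]; exists (Num.truncn (u / dl)).
  rewrite truncn_lt_nat ?divr_ge0//; last exact: ltW.
  by rewrite ltr_pdivrMr.
rewrite -ler_pdivlMr// -ltr_pdivrMr//.
by apply: truncn_itv; rewrite divr_ge0// ltW.
Qed.

(** The jump at 0 is the full value [f 0], so that the steps sum up to the
    left-point interpolant itself. *)
Definition jump f dl (i : nat) : R :=
  f (i%:R * dl) - (if i is j.+1 then f (j%:R * dl) else 0).

Lemma sum_jump f dl j : \sum_(i < j.+1) jump f dl i = f (j%:R * dl).
Proof.
elim: j => [|j IH]; first by rewrite big_ord1 /jump subr0.
by rewrite big_ord_recr/= IH /jump addrC subrK.
Qed.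

Lemma sum_jump_step f dl N j u : 0 < dl -> (j < N)%N ->
  j%:R * dl <= u < j.+1%:R * dl ->
  \sum_(i < N) jump f dl i * step (i%:R * dl) u = f (j%:R * dl).
Proof.
move=> dl0 jN /andP[ju uj]; rewrite -(sum_jump f dl j).
rewrite -(big_mkord xpredT (fun i => jump f dl i * step (i%:R * dl) u)).
rewrite (big_cat_nat (n := j.+1))//= big_mkord.
rewrite [X in _ + X]big_nat_cond [X in _ + X]big1 ?addr0; last first.
  move=> i /andP[/andP[ji _] _]; rewrite /step leNgt (lt_le_trans uj) ?mulr0//.
  by rewrite ler_pM2r// ler_nat.
apply: eq_bigr => i _; rewrite /step (le_trans _ ju) ?mulr1//.
by rewrite ler_pM2r// ler_nat -ltnS.
Qed.

Definition slope g dl (i : nat) : R := (g (i.+1%:R * dl) - g (i%:R * dl)) / dl.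
(** Difference of consecutive kinks: equal to [dl] left of the cell [i], to 0
    right of it, affine inside. *)
Definition hat dl (i : nat) (u : R) : R := kink (i.+1%:R * dl) u - kink (i%:R * dl) u.

Lemma hat_noninc dl i x u : 0 <= dl -> x <= u -> hat dl i u <= hat dl i x.
Proof.
move=> dl0 xu; rewrite /hat /kink /pos_part.
have : i%:R * dl <= i.+1%:R * dl by rewrite ler_wpM2r// ler_nat.
by move: (_ * dl) (_ * dl) => p p' pp';
  case: (leP (p' - u) 0); case: (leP (p - u) 0);
  case: (leP (p' - x) 0); case: (leP (p - x) 0); lra.
Qed.

Lemma sum_hat dl N x : 0 <= x <= N%:R * dl ->
  \sum_(i < N) hat dl i x = N%:R * dl - x.
Proof.
move=> /andP[x0 xN].
rewrite -(big_mkord xpredT (fun i => kink (i.+1%:R * dl) x - kink (i%:R * dl) x)).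
rewrite (telescope_sumr (fun i => kink (i%:R * dl) x))//.
by rewrite /kink mul0r [X in _ - X]pos_part_0 ?subr0 ?pos_part_id ?subr_ge0//; lra.
Qed.

Lemma hat_grid dl i j : 0 <= dl -> hat dl i (j%:R * dl) = (j <= i)%N%:R * dl.
Proof.
move=> dl0; rewrite /hat /kink -!mulrBl.
have [ji|ij] := leqP j i; rewrite /= ?mul1r ?mul0r.
  rewrite -!natrB ?(leqW ji)// !pos_part_id ?mulr_ge0// subSn//.
  by rewrite -natr1 mulrDl mul1r addrAC subrr add0r.
rewrite !pos_part_0 ?subrr// mulr_le0_ge0// subr_le0 ler_nat//.
exact: ltnW.
Qed.

(** Piecewise linear interpolant of [g - g (N dl)], which vanishes at the right
    endpoint as the right derivative requires. *)
Definition chord g dl N (u : R) : R := - \sum_(i < N) slope g dl i * hat dl i u.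

Lemma chord_grid g dl N j : 0 < dl -> (j <= N)%N ->
  chord g dl N (j%:R * dl) = g (j%:R * dl) - g (N%:R * dl).
Proof.
move=> dl0 jN; rewrite /chord.
rewrite -(big_mkord xpredT (fun i => slope g dl i * hat dl i (j%:R * dl))).
rewrite (big_cat_nat (n := j))//= [X in X + _]big_nat_cond [X in X + _]big1 ?add0r.
  rewrite (@eq_big_nat _ _ _ _ _ _
    (fun i => g (i.+1%:R * dl) - g (i%:R * dl))); last first.
    move=> i /andP[ji _]; rewrite hat_grid ?ltW// ji mul1r /slope divfK//.
    by rewrite gt_eqF.
  by rewrite (telescope_sumr (fun i => g (i%:R * dl)))// opprB.
move=> i /andP[/andP[_ ij] _]; rewrite hat_grid ?ltW//.
by rewrite leqNgt ij mul0r mulr0.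
Qed.

Section hoelder.
Variables (f : R -> R) (C l dl t : R) (N : nat).
Hypotheses (C0 : 0 <= C) (l0 : 0 < l) (l1 : l <= 1) (dl0 : 0 < dl) (tE : t = N%:R * dl).
Hypothesis hf : forall x u, 0 <= x <= t -> 0 <= u <= t ->
  `|f x - f u| <= C * `|x - u| `^ l.

Local Ltac slra :=
  pose proof C0; pose proof l0; pose proof l1; pose proof dl0; lra.

Let grid_in j : (j <= N)%N -> 0 <= j%:R * dl <= t.
Proof.
move=> jN; rewrite mulr_ge0//=; last exact: ltW.
by rewrite tE ler_pM2r// ler_nat.
Qed.

Let pow_le_dl r : 0 <= r <= dl -> r `^ l <= dl `^ l.
Proof.
by move=> /andP[r0 rd]; apply: ge0_ler_powR; rewrite ?nnegrE; slra.
Qed.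

Lemma slope_bound i : (i < N)%N -> `|slope f dl i| <= C * dl `^ l / dl.
Proof.
move=> iN; rewrite /slope normrM normfV (gtr0_norm dl0).
rewrite ler_pM2r ?invr_gt0//; apply: le_trans (hf _ _) _.
- exact: grid_in.
- by apply: grid_in; exact: ltnW.
- by rewrite -mulrBl -natrB// subSnn mul1r gtr0_norm.
Qed.

(** The increments of the hats all have the same sign and add up to [u - x], so
    the bound on the slopes passes to the chord. *)
Lemma chord_lipschitz x u : 0 <= x -> x <= u -> u <= t ->
  `|chord f dl N x - chord f dl N u| <= C * dl `^ l / dl * (u - x).
Proof.
move=> x0 xu ut; rewrite /chord opprK addrC -sumrB.
apply: le_trans (ler_norm_sum _ _ _) _.
have E : u - x = \sum_(i < N) (hat dl i x - hat dl i u).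
  rewrite sumrB !sum_hat; first by rewrite -tE; ring.
    by rewrite -tE; apply/andP; split; slra.
  by rewrite -tE; apply/andP; split; slra.
rewrite E mulr_sumr; apply: ler_sum => i _.
rewrite -mulrBr normrM ler_pM// ?slope_bound// distrC ger0_norm// subr_ge0.
by apply: hat_noninc => //; exact: ltW.
Qed.

Let err u := f u - f t - chord f dl N u.

Let err_local x u : 0 <= x -> x <= u -> u <= t -> u - x <= dl ->
  `|err x - err u| <= 2 * C * (u - x) `^ l.
Proof.
move=> x0 xu ut ud.
have -> : err x - err u = (f x - f u) - (chord f dl N x - chord f dl N u).
  by rewrite /err; ring.
apply: le_trans (ler_normB _ _) _; rewrite mulrDl mul1r mulrDl lerD//.
  rewrite -[u - x]ger0_norm ?subr_ge0// distrC; apply: hf; slra.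
apply: le_trans (chord_lipschitz x0 xu ut) _.
rewrite -!mulrA ler_wpM2l//.
move: xu; rewrite le_eqVlt => /predU1P[->|xu].
  by rewrite subrr !mulr0 powR_ge0.
have r0 : 0 < u - x by rewrite subr_gt0.
have dE : dl `^ l * (dl^-1 * (u - x)) = (u - x) `^ l * ((u - x) / dl) `^ (1 - l).
  have e1 : (u - x) `^ l * (u - x) `^ (1 - l) = u - x.
    rewrite -powRD; last by apply/implyP => _; rewrite gt_eqF.
    by rewrite [l + _]addrC subrK powRr1// ltW.
  have e2 : dl `^ l * dl^-1 = dl^-1 `^ (1 - l).
    rewrite -powR_inv1 ?ltW// -powRrM mulN1r opprB -powRD//.
    by apply/implyP => _; rewrite gt_eqF.
  by rewrite powRM ?invr_ge0 ?(ltW dl0) ?(ltW r0)// !mulrA e1 e2 mulrC.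
rewrite dE ler_piMr ?powR_ge0// -[leRHS](powRr0 ((u - x) / dl)).
apply: ger_powR; last slra.
by rewrite divr_gt0//= ler_pdivrMr// mul1r.
Qed.

Let err_small u : 0 <= u <= t -> `|err u| <= 2 * C * dl `^ l.
Proof.
move=> /andP[u0 ut].
have eg j : (j <= N)%N -> err (j%:R * dl) = 0.
  by move=> jN; rewrite /err chord_grid// -tE; ring.
move: ut; rewrite le_eqVlt => /predU1P[->|ut].
  by rewrite [X in err X]tE eg// normr0 !mulr_ge0 ?powR_ge0.
have [|j jN /andP[ju uj]] := @grid_cell dl N u dl0; first by rewrite u0 -tE.
rewrite -[err u]subr0 -(eg j (ltnW jN)) distrC.
move: uj; rewrite -natr1 mulrDl mul1r => uj.
have /andP[j0 _] := grid_in (ltnW jN).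
apply: le_trans (@err_local _ _ _ _ _ _) _ => //; [slra|slra|].
apply: ler_wpM2l; first by rewrite mulr_ge0.
by apply: pow_le_dl; slra.
Qed.

(** Interpolation between two bounds: the error has Hoelder order [l] inside a
    cell and is uniformly of size [dl `^ l]; giving up [e] of the regularity
    leaves the factor [dl `^ e]. *)
Lemma chord_error_hoelder e x u : 0 < e < l -> 0 <= x -> x <= u -> u <= t ->
  `|err x - err u| <= 4 * C * dl `^ e * (u - x) `^ (l - e).
Proof.
move=> /andP[e0 el] x0 xu ut.
move: (xu); rewrite le_eqVlt => /predU1P[->|xltu].
  by rewrite subrr normr0 !mulr_ge0// powR_ge0.
have r0 : 0 < u - x by rewrite subr_gt0.
have sp r : 0 < r -> r `^ l = r `^ e * r `^ (l - e).
  move=> ?; rewrite -powRD; last by apply/implyP => _; rewrite gt_eqF.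
  by rewrite [e + _]addrC subrK.
have [ud|du] := leP (u - x) dl.
  apply: le_trans (err_local x0 xu ut ud) _.
  rewrite sp// mulrA ler_wpM2r ?powR_ge0//.
  apply: ler_pM; rewrite ?mulr_ge0 ?powR_ge0//; first by slra.
  by apply: ge0_ler_powR; rewrite ?nnegrE; slra.
apply: le_trans (ler_normB _ _) _.
apply: (@le_trans _ _ (4 * C * dl `^ l)).
  have h1 : `|err x| <= 2 * C * dl `^ l by apply: err_small; slra.
  have h2 : `|err u| <= 2 * C * dl `^ l by apply: err_small; slra.
  slra.
rewrite sp// mulrA ler_wpM2l ?mulr_ge0 ?powR_ge0//.
by apply: ge0_ler_powR; rewrite ?nnegrE; slra.
Qed.

End hoelder.

End grid.

(** * Left derivative of the step interpolant *)

Section approximation.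
Context {R : realType}.
Local Notation mu := (@lebesgue_measure R).
Implicit Types (al x y u l C t dl : R) (f g : R -> R) (N : nat).

Lemma measurable_step D (c : R) : measurable_fun D (step c).
Proof.
rewrite (_ : step c = \1_(`[c, +oo[%classic)); first exact: measurable_indic.
by apply/funext => u; rewrite indicE mem_setE in_itv/= andbT.
Qed.

(** On the cell [k] the interpolation error of [f] is small everywhere and
    Hoelder continuous on the cell, since the interpolant is constant there.
    The integral is split at the left end of the cell: the far part produces
    the singularity [(x - k dl) `^ (- al)], which is integrable over the cell,
    and the near part is a power of [dl]. *)
Lemma left_step_error al l C dl t N k x f :
  0 < al -> al < l -> 0 <= C -> 0 < dl -> t = N%:R * dl ->
  measurable_fun `[0, t] f ->
  (forall x u, 0 <= x <= t -> 0 <= u <= t -> `|f x - f u| <= C * `|x - u| `^ l) ->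
  (k < N)%N -> k%:R * dl < x < k.+1%:R * dl ->
  `|marchaud_left al f x -
      \sum_(i < N) jump f dl i * pos_part (x - i%:R * dl) `^ (- al)| <=
    3 * C * dl `^ l * (x - k%:R * dl) `^ (- al) +
      al * (C * dl `^ (l - al) / (l - al)).
Proof.
move=> al0 all C0 dl0 tE mf hf kN /andP[kx xk].
have k0 : 0 <= k%:R * dl by rewrite mulr_ge0// ltW.
have x0 : 0 < x by lra.
have xt : x <= t.
  by apply: (le_trans (ltW xk)); rewrite tE ler_pM2r// ler_nat.
have mfx : measurable_fun `[0, x] f.
  apply: (measurable_funS _ _ mf) => //.
  by move=> z /=; rewrite !in_itv/= => /andP[-> zx]/=; exact: le_trans xt.
have [jf _] : mu.-integrable `[0, x] (EFin \o frac_left_integrand al f x) /\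
   `| \int[mu]_(u in `[0, x]) frac_left_integrand al f x u | <=
    C * (x - 0) `^ (l - al) / (l - al).
  apply: left_integrand_near => //; first exact: ltW.
  move=> u /andP[u0 ux]; rewrite -[x - u]ger0_norm ?subr_ge0//.
  by apply: hf; apply/andP; split; lra.
have ne (i : 'I_N) : x != i%:R * dl.
  have [ik|ki] := leqP i k.
    by rewrite gt_eqF// (le_lt_trans _ kx)// ler_pM2r// ler_nat.
  by rewrite lt_eqF// (lt_le_trans xk)// ler_pM2r// ler_nat.
have st (i : 'I_N) := marchaud_left_step al0 (mulr_ge0 (ler0n R i) (ltW dl0)) x0 (ne i).
have [jh eh] := marchaud_left_lincomb (index_enum 'I_N)
  (fun i : 'I_N => jump f dl i) jf (fun i => (st i).1).
rewrite [X in _ - X](_ : _ =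
    \sum_(i < N) jump f dl i * marchaud_left al (step (i%:R * dl)) x); last first.
  by apply: eq_bigr => i _; rewrite (st i).2.
rewrite -eh; move: jh; clear eh.
set h := fun u : R => _ => jh.
have hE j u : (j < N)%N -> j%:R * dl <= u < j.+1%:R * dl -> h u = f u - f (j%:R * dl).
  by move=> jN ju; rewrite /h (sum_jump_step _ dl0 jN ju).
have hb u : 0 <= u < t -> `|h u| <= C * dl `^ l.
  move=> ut; have [|j jN ju] := @grid_cell _ dl N u dl0; first by rewrite -tE.
  rewrite (hE j)//; have /andP[j1 j2] := ju.
  have j0 : 0 <= j%:R * dl by rewrite mulr_ge0// ltW.
  apply: le_trans (hf _ _ _ _) _; [by lra|by lra|].
  apply: ler_wpM2l => //; apply: ge0_ler_powR; rewrite ?nnegrE//; [lra|exact: ltW|].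
  by rewrite ger0_norm ?subr_ge0//; move: j2; rewrite -natr1 mulrDl mul1r; lra.
have mh : measurable_fun `[0, x] h.
  apply: measurable_funB => //; apply: measurable_sum => i.
  by apply: measurable_funM => //; exact: measurable_step.
rewrite /marchaud_left (@Rintegral_itv_split _ 0 x (k%:R * dl))//; last exact: ltW.
have far : `| \int[mu]_(u in `[0, k%:R * dl]) frac_left_integrand al h x u | <=
    (2 * (C * dl `^ l)) * (x - k%:R * dl) `^ (- al) / al.
  apply: left_integrand_far => //.
  - by rewrite !mulr_ge0 ?powR_ge0.
  - apply: (measurable_funS _ _ mh) => //.
    by move=> z /=; rewrite !in_itv/= => /andP[-> zx]/=; lra.
  - move=> u /andP[u0 uk]; apply: le_trans (ler_normB _ _) _.
    have h1 : `|h x| <= C * dl `^ l.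
      apply: hb; rewrite ltW//=; apply: (lt_le_trans xk).
      by rewrite tE ler_pM2r// ler_nat.
    have h2 : `|h u| <= C * dl `^ l by apply: hb; lra.
    lra.
have [_ near] : mu.-integrable `[k%:R * dl, x] (EFin \o frac_left_integrand al h x) /\
   `| \int[mu]_(u in `[k%:R * dl, x]) frac_left_integrand al h x u | <=
    C * (x - k%:R * dl) `^ (l - al) / (l - al).
  apply: left_integrand_near => //; first exact: ltW.
    apply: (measurable_funS _ _ mh) => //.
    by move=> z /=; rewrite !in_itv/= => /andP[kz ->]; rewrite andbT; lra.
  move=> u /andP[ku ux]; rewrite !(hE k)//; [|by lra|by lra].
  rewrite opprB addrA subrK -[x - u]ger0_norm ?subr_ge0//.
  by apply: hf; apply/andP; split; lra.
have near' : C * (x - k%:R * dl) `^ (l - al) / (l - al) <=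
    C * dl `^ (l - al) / (l - al).
  rewrite ler_pM2r ?invr_gt0 ?subr_gt0//; apply: ler_wpM2l => //.
  apply: ge0_ler_powR; rewrite ?nnegrE; [lra|lra|exact: ltW|].
  by move: xk; rewrite -natr1 mulrDl mul1r; lra.
have hx : `|h x / x `^ al| <= C * dl `^ l * (x - k%:R * dl) `^ (- al).
  rewrite normrM; apply: ler_pM => //.
    by apply: hb; rewrite ltW//=; apply: (lt_le_trans xk); rewrite tE ler_pM2r// ler_nat.
  rewrite -powRN ger0_norm ?powR_ge0// !powRN lef_pV2 ?posrE ?powR_gt0//; last lra.
  by apply: ge0_ler_powR; rewrite ?nnegrE; lra.
apply: le_trans (ler_normD _ _) _.
apply: (le_trans (lerD hx (lexx _))).
rewrite normrM (gtr0_norm al0).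
apply: (@le_trans _ _ (C * dl `^ l * (x - k%:R * dl) `^ (- al) +
   al * ((2 * (C * dl `^ l)) * (x - k%:R * dl) `^ (- al) / al +
     C * dl `^ (l - al) / (l - al)))).
  rewrite lerD2l ler_pM2l//; apply: le_trans (ler_normD _ _) _.
  by rewrite lerD// (le_trans near).
rewrite le_eqVlt; apply/orP; left; apply/eqP; field.
by apply/andP; split; rewrite ?gt_eqF ?subr_gt0.
Qed.

End approximation.

(** * Right derivative of the chord interpolant *)

Section pairing.
Context {R : realType}.
Local Notation mu := (@lebesgue_measure R).
Implicit Types (al x y u l C t dl e : R) (f g : R -> R) (N : nat).

Lemma marchaud_right_bound al l C t x g :
  0 < al < 1 -> 1 - al < l -> 0 <= C -> 0 <= x <= t ->
  measurable_fun `[0, t] g -> g t = 0 ->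
  (forall u, x <= u <= t -> `|g x - g u| <= C * (u - x) `^ l) ->
  mu.-integrable `[x, t] (EFin \o frac_right_integrand al g x) /\
  `|marchaud_right al t g x| <= C * (1 + (l + al - 1)^-1) * t `^ (l + al - 1).
Proof.
move=> /andP[al0 al1] all C0 /andP[x0 xt] mg gt0 hg.
have mgx : measurable_fun `[x, t] g.
  apply: (measurable_funS _ _ mg) => //.
  by move=> z /=; rewrite !in_itv/= => /andP[xz ->]; rewrite andbT; lra.
have [jg bg] := @right_integrand_near _ al g x t C l xt C0 all mgx hg.
split=> //.
have m0 : 0 < l + al - 1 by lra.
have tm : (t - x) `^ (l + al - 1) <= t `^ (l + al - 1).
  by apply: ge0_ler_powR; rewrite ?nnegrE; lra.
have h1 : `|g x / (t - x) `^ (1 - al)| <= C * (t - x) `^ (l + al - 1).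
  move: xt; rewrite le_eqVlt => /predU1P[xt|xt].
    by rewrite xt gt0 mul0r normr0 mulr_ge0 ?powR_ge0.
  rewrite normrM normfV [`|_ `^ _|]ger0_norm ?powR_ge0//.
  rewrite ler_pdivrMr ?powR_gt0 ?subr_gt0// -mulrA -powRD; last first.
    by apply/implyP => _; rewrite gt_eqF// subr_gt0.
  rewrite (_ : l + al - 1 + (1 - al) = l); last by ring.
  by rewrite -[g x]subr0 -gt0; apply: hg; lra.
rewrite /marchaud_right; apply: le_trans (ler_normD _ _) _.
rewrite mulrDr mulr1 mulrDl lerD//.
  by apply: (le_trans h1); rewrite ler_wpM2l.
rewrite normrM ger0_norm; last lra.
apply: (@le_trans _ _ (1 * (C * t `^ (l + al - 1) / (l + al - 1)))).
  apply: ler_pM => //; [lra|lra|].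
  by apply: (le_trans bg); rewrite ler_pM2r ?invr_gt0// ler_wpM2l.
by rewrite mul1r mulrAC.
Qed.

(** Right derivative of [chord], a combination of the explicit derivatives of
    kinks. *)
Definition chord_marchaud al g dl N (x : R) : R :=
  - \sum_(i < N) slope g dl i *
      ((pos_part (i.+1%:R * dl - x) `^ al - pos_part (i%:R * dl - x) `^ al) / al).

(** Linearity reduces the difference to the right derivative of the
    interpolation error, whose Hoelder constant of order [l - e] carries the
    factor [dl `^ e]. *)
Lemma right_chord_error al l e C dl t N x g :
  0 < al < 1 -> 0 < e < l -> 1 - al < l - e -> l <= 1 -> 0 <= C -> 0 < dl ->
  t = N%:R * dl -> measurable_fun `[0, t] g ->
  (forall x u, 0 <= x <= t -> 0 <= u <= t -> `|g x - g u| <= C * `|x - u| `^ l) ->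
  0 <= x <= t ->
  `|marchaud_right al t (fun u => g u - g t) x - chord_marchaud al g dl N x| <=
    4 * C * dl `^ e * (1 + (l - e + al - 1)^-1) * t `^ (l - e + al - 1).
Proof.
move=> alP eP le l1 C0 dl0 tE mg hg xP.
have /andP[x0 xt] := xP; have /andP[e0 el] := eP; have /andP[al0 al1] := alP.
have l0 : 0 < l by lra.
pose gt u := g u - g t.
have mgt : measurable_fun `[0, t] gt by apply: measurable_funB.
have [jg _] : mu.-integrable `[x, t] (EFin \o frac_right_integrand al gt x) /\
    `|marchaud_right al t gt x| <= C * (1 + (l + al - 1)^-1) * t `^ (l + al - 1).
  apply: marchaud_right_bound => //; [lra| |].
    by rewrite /gt subrr.
  move=> u /andP[xu ut]; rewrite /gt opprB addrA subrK.
  by rewrite -[u - x]ger0_norm ?subr_ge0// distrC; apply: hg; lra.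
have kk p : p <= t -> mu.-integrable `[x, t] (EFin \o frac_right_integrand al (kink p) x) /\
  marchaud_right al t (kink p) x = pos_part (p - x) `^ al / al.
  by move=> pt; apply: marchaud_right_kink.
have gr j : (j <= N)%N -> j%:R * dl <= t.
  by move=> jN; rewrite tE ler_pM2r// ler_nat.
have [j1 e1] := marchaud_right_lincomb (index_enum 'I_N)
  (fun i : 'I_N => - slope g dl i) jg (fun i : 'I_N => (kk _ (gr i.+1 (ltn_ord i))).1).
have [j2 e2] := marchaud_right_lincomb (index_enum 'I_N)
  (fun i : 'I_N => slope g dl i) j1 (fun i : 'I_N => (kk _ (gr i (ltnW (ltn_ord i)))).1).
pose h u := g u - g t - chord g dl N u.
have hE : (fun u => gt u - \sum_(i < N) - slope g dl i * kink (i.+1%:R * dl) u -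
    \sum_(i < N) slope g dl i * kink (i%:R * dl) u) = h.
  apply/funext => u; rewrite /h /chord opprK -/(gt u) -addrA; congr (_ + _).
  by rewrite -opprD -big_split/= -sumrN; apply: eq_bigr => i _; rewrite /hat; ring.
rewrite hE e1 in e2.
rewrite [X in _ - X](_ : _ =
    \sum_(i < N) - slope g dl i * marchaud_right al t (kink (i.+1%:R * dl)) x +
    \sum_(i < N) slope g dl i * marchaud_right al t (kink (i%:R * dl)) x); last first.
  rewrite /chord_marchaud -sumrN -big_split/=; apply: eq_bigr => i _.
  rewrite (kk _ (gr i.+1 (ltn_ord i))).2 (kk _ (gr i (ltnW (ltn_ord i)))).2; ring.
rewrite opprD addrA -e2.
have C4 : 0 <= 4 * C * dl `^ e by rewrite !mulr_ge0 ?powR_ge0.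
have mh : measurable_fun `[0, t] h.
  apply: measurable_funB => //; apply: measurable_funN => //.
  apply: measurable_sum => i; apply: measurable_funM => //.
  by apply: measurable_funB; exact: measurable_kink.
have ht : h t = 0.
  by rewrite /h [X in chord _ _ _ X]tE chord_grid// -tE; ring.
have hh u : x <= u <= t -> `|h x - h u| <= 4 * C * dl `^ e * (u - x) `^ (l - e).
  move=> /andP[xu ut].
  exact: (chord_error_hoelder C0 l0 l1 dl0 tE hg eP x0 xu ut).
by have [] := @marchaud_right_bound al (l - e) _ t x h alP le C4 xP mh ht hh.
Qed.

Lemma measurable_pos_part D (h : R -> R) : measurable_fun D h ->
  measurable_fun D (fun x => pos_part (h x)).
Proof. by move=> mh; apply: measurable_maxr. Qed.

Lemma measurable_chord_marchaud al g dl N D :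
  measurable_fun D (chord_marchaud al g dl N).
Proof.
apply: measurable_funN; apply: measurable_sum => i; apply: measurable_funM => //.
apply: measurable_funM => //; apply: measurable_funB.
- apply: (@measurableT_comp _ _ _ _ _ _ (fun x : R => x `^ al)).
    exact: measurable_powR.
  by apply: measurable_pos_part; apply: measurable_funB.
- apply: (@measurableT_comp _ _ _ _ _ _ (fun x : R => x `^ al)).
    exact: measurable_powR.
  by apply: measurable_pos_part; apply: measurable_funB.
Qed.

Lemma abel_summation f (G : nat -> R) dl N :
  \sum_(i < N) jump f dl i * (G i - G N) =
  - \sum_(i < N) f (i%:R * dl) * (G i.+1 - G i).
Proof.
elim: N => [|N IH]; first by rewrite !big_ord0 oppr0.
rewrite !big_ord_recr/= opprD -IH.
rewrite (_ : \sum_(i < N) _ =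
  \sum_(i < N) jump f dl i * (G i - G N) - \sum_(i < N) jump f dl i * (G N.+1 - G N)).
  rewrite -mulr_suml -addrA; congr (_ + _).
  have := sum_jump f dl N; rewrite big_ord_recr/= => <-; ring.
by rewrite -sumrB; apply: eq_bigr => i _; ring.
Qed.

(** Each step is paired with each kink; the resulting double sum evaluates the
    chord at the grid points, where it interpolates, and summation by parts
    gives the left-point Riemann sum of [f] against [g]. *)
Lemma step_chord_pairing al f g dl t N :
  0 < al < 1 -> 0 < dl -> t = N%:R * dl ->
  let D := fun x => \sum_(i < N) jump f dl i * pos_part (x - i%:R * dl) `^ (- al) in
  mu.-integrable `[0, t] (EFin \o (fun x => D x * chord_marchaud al g dl N x)) /\
  \int[mu]_(x in `[0, t]) (D x * chord_marchaud al g dl N x) =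
    - (beta_pairing al / al *
       \sum_(i < N) f (i%:R * dl) * (g (i.+1%:R * dl) - g (i%:R * dl))).
Proof.
move=> alP dl0 tE D; have /andP[al0 al1] := alP.
have gr j : (j <= N)%N -> 0 <= j%:R * dl <= t.
  move=> jN; rewrite mulr_ge0//=; last exact: ltW.
  by rewrite tE ler_pM2r// ler_nat.
pose A (k : 'I_N) j x := pos_part (x - k%:R * dl) `^ (- al) * pos_part (j%:R * dl - x) `^ al.
have AP (k : 'I_N) j : (j <= N)%N -> mu.-integrable `[0, t] (EFin \o A k j) /\
    \int[mu]_(x in `[0, t]) A k j x = pos_part (j%:R * dl - k%:R * dl) * beta_pairing al.
  move=> jN; have /andP[k0 kt] := gr k (ltnW (ltn_ord k)).
  by apply: step_kink_pairing => //; have /andP[] := gr j jN.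
pose cf (k i : 'I_N) := - (jump f dl k * slope g dl i / al).
pose B (k i : 'I_N) x := cf k i * (A k i.+1 x - A k i x).
have BP k i : mu.-integrable `[0, t] (EFin \o B k i) /\
    \int[mu]_(x in `[0, t]) B k i x =
    cf k i * (hat dl i (k%:R * dl) * beta_pairing al).
  have [i1 v1] := AP k i.+1 (ltn_ord i); have [i2 v2] := AP k i (ltnW (ltn_ord i)).
  have iB := integrable_sub (@measurable_itvR _ _) i1 i2.
  split; first exact: (integrable_scale _ (@measurable_itvR _ _) iB).
  rewrite /B (RintegralZl (cf k i) (@measurable_itvR _ _) iB).
  by rewrite (RintegralB (@measurable_itvR _ _) i1 i2) v1 v2 /hat /kink mulrBl.
have BkP k : mu.-integrable `[0, t] (EFin \o (fun x => \sum_(i < N) B k i x)) /\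
    \int[mu]_(x in `[0, t]) (\sum_(i < N) B k i x) =
    \sum_(i < N) cf k i * (hat dl i (k%:R * dl) * beta_pairing al).
  have [i1 v1] := integrable_bigsum (index_enum 'I_N) (@measurable_itvR _ _)
    (fun i => (BP k i).1).
  by split => //; rewrite v1; apply: eq_bigr => i _; rewrite (BP k i).2.
have [i1 v1] := integrable_bigsum (index_enum 'I_N) (@measurable_itvR _ _)
    (fun k => (BkP k).1).
have E x : D x * chord_marchaud al g dl N x = \sum_(k < N) \sum_(i < N) B k i x.
  rewrite /D /chord_marchaud mulr_suml; apply: eq_bigr => k _.
  rewrite mulrN mulr_sumr -sumrN; apply: eq_bigr => i _; rewrite /B /cf /A; ring.
rewrite (_ : (fun x => D x * _) = (fun x => \sum_(k < N) \sum_(i < N) B k i x)); last first.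
  by apply/funext => x; rewrite E.
split => //; rewrite v1.
transitivity (beta_pairing al / al * \sum_(k < N) jump f dl k *
    (g (k%:R * dl) - g (N%:R * dl))).
  rewrite mulr_sumr; apply: eq_bigr => k _; rewrite (BkP k).2.
  rewrite -(chord_grid g dl0 (ltnW (ltn_ord k))) /chord mulrN mulrN mulr_sumr mulr_sumr.
  by rewrite -sumrN; apply: eq_bigr => i _; rewrite /cf; ring.
by rewrite (abel_summation f (fun i => g (i%:R * dl))) mulrN.
Qed.

End pairing.

(** * Pairings of fractional derivatives and Riemann sums *)

Section riemann_sums.
Context {R : realType}.
Local Notation mu := (@lebesgue_measure R).
Implicit Types (al x y u l C t dl e : R) (f g : R -> R) (N : nat).

Lemma Rintegral_cells dl N (F : R -> R) : 0 < dl ->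
  mu.-integrable `[0, N%:R * dl] (EFin \o F) ->
  \int[mu]_(x in `[0, N%:R * dl]) F x =
  \sum_(k < N) \int[mu]_(x in `[k%:R * dl, k.+1%:R * dl]) F x.
Proof.
move=> dl0; elim: N => [|N IH] jF.
  by rewrite mul0r set_itv1 Rintegral_set1 big_ord0.
have NS : N%:R * dl <= N.+1%:R * dl by rewrite ler_pM2r// ler_nat.
rewrite (Rintegral_itv_split _ NS jF)//; last by rewrite mulr_ge0// ltW.
rewrite IH ?big_ord_recr//; apply: (integrableS _ _ _ jF); try exact: measurable_itvR.
by move=> z /=; rewrite !in_itv/= => /andP[-> zN]; exact: le_trans NS.
Qed.

Lemma le_Rintegral_interior x y (F G : R -> R) :
  mu.-integrable `[x, y] (EFin \o F) -> mu.-integrable `[x, y] (EFin \o G) ->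
  (forall u, x < u < y -> F u <= G u) ->
  \int[mu]_(u in `[x, y]) F u <= \int[mu]_(u in `[x, y]) G u.
Proof.
move=> jF jG FG.
have io (H : R -> R) : mu.-integrable `[x, y] (EFin \o H) ->
    mu.-integrable `]x, y] (EFin \o H).
  move=> jH; apply: (integrableS _ _ _ jH); try exact: measurable_itvR.
  by move=> z; exact: subset_itv_oc_cc.
have ioo (H : R -> R) : mu.-integrable `[x, y] (EFin \o H) ->
    mu.-integrable `]x, y[ (EFin \o H).
  move=> jH; apply: (integrableS _ _ _ jH); try exact: measurable_itvR.
  by move=> z; exact: subset_itv_oo_cc.
rewrite -!Rintegral_itv_obnd_cbnd; [|exact: io|exact: io].
rewrite -!Rintegral_itv_bndo_bndc; [|exact: ioo|exact: ioo].
apply: le_Rintegral; [exact: measurable_itvR|exact: ioo|exact: ioo|].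
by move=> u /=; rewrite in_itv/= => /FG.
Qed.

Lemma Rintegral_cst_itv x y C : x <= y ->
  mu.-integrable `[x, y] (EFin \o (fun=> C)) /\
  \int[mu]_(u in `[x, y]) C = C * (y - x).
Proof.
move=> xy; have [i0 e0] := @powR_integral_left _ x y 0 xy ltac:(lra).
have E : (fun=> C) = (fun u => C * (u - x) `^ 0) :> (R -> R).
  by apply/funext => u; rewrite powRr0 mulr1.
rewrite E; split; first exact: (integrable_scale C (@measurable_itvR _ _) i0).
rewrite (RintegralZl C (@measurable_itvR _ _) i0) e0 add0r powRr1 ?subr_ge0//.
by rewrite invr1 mulr1.
Qed.

(** The singularities [(x - k dl) `^ (- al)] of [left_step_error] are integrated
    cell by cell; each contributes a multiple of [dl `^ (1 - al)]. *)
Lemma step_L1_error al l C dl t N f :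
  0 < al < 1 -> al < l -> 0 <= C -> 0 < dl -> t = N%:R * dl ->
  measurable_fun `[0, t] f ->
  (forall x u, 0 <= x <= t -> 0 <= u <= t -> `|f x - f u| <= C * `|x - u| `^ l) ->
  let D := fun x => \sum_(i < N) jump f dl i * pos_part (x - i%:R * dl) `^ (- al) in
  mu.-integrable `[0, t] (EFin \o marchaud_left al f) ->
  mu.-integrable `[0, t] (EFin \o D) /\
  \int[mu]_(x in `[0, t]) `|marchaud_left al f x - D x| <=
    t * (C * (3 / (1 - al) + al / (l - al))) * dl `^ (l - al).
Proof.
move=> /andP[al0 al1] all C0 dl0 tE mf hf D jF.
have jD : mu.-integrable `[0, t] (EFin \o D).
  have jA (k : 'I_N) : mu.-integrable `[0, t]
      (EFin \o (fun x => jump f dl k * pos_part (x - k%:R * dl) `^ (- al))).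
    apply: integrable_scale; first exact: measurable_itvR.
    apply: (pos_powR_integral al1 _ _).1; first by rewrite gt_eqF.
    rewrite mulr_ge0//=; last exact: ltW.
    by rewrite tE ler_pM2r// ler_nat; exact: ltnW.
  exact: (integrable_bigsum (index_enum 'I_N) (@measurable_itvR _ _) jA).1.
split=> //.
have jn := integrable_norm (integrable_sub (@measurable_itvR _ _) jF jD).
pose E x := `|marchaud_left al f x - D x|.
have jE : mu.-integrable `[0, N%:R * dl] (EFin \o E) by rewrite -tE.
rewrite -/E [X in `[0, X]]tE Rintegral_cells//.
set K := C * _.
apply: (@le_trans _ _ (\sum_(k < N) (K * dl `^ (l - al) * dl))); last first.
  by rewrite sumr_const card_ord -mulr_natl tE le_eqVlt; apply/orP; left; apply/eqP; ring.
apply: ler_sum => k _.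
have kk : k%:R * dl <= k.+1%:R * dl by rewrite ler_pM2r// ler_nat.
have [iR vR] := @powR_integral_left _ (k%:R * dl) (k.+1%:R * dl) (- al) kk ltac:(lra).
have [jc vc] := Rintegral_cst_itv (al * (C * dl `^ (l - al) / (l - al))) kk.
have js := integrable_scale (3 * C * dl `^ l) (@measurable_itvR _ _) iR.
apply: (@le_trans _ _ (\int[mu]_(x in `[k%:R * dl, k.+1%:R * dl])
   (3 * C * dl `^ l * (x - k%:R * dl) `^ (- al) + al * (C * dl `^ (l - al) / (l - al))))).
  apply: le_Rintegral_interior.
  - apply: (integrableS _ _ _ jE); try exact: measurable_itvR.
    move=> z /=; rewrite !in_itv/= => /andP[kz zk]; apply/andP; split.
      by apply: le_trans kz; rewrite mulr_ge0// ltW.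
    by apply: (le_trans zk); rewrite ler_pM2r// ler_nat.
  - exact: (integrable_add (@measurable_itvR _ _) js jc).
  - by move=> x kx; rewrite /E; apply: (left_step_error al0 all C0 dl0 tE mf hf) => //.
rewrite (RintegralD (@measurable_itvR _ _) js jc).
rewrite (RintegralZl _ (@measurable_itvR _ _) iR) vR.
rewrite vc -mulrBl -natrB// subSnn mul1r [- al + 1]addrC.
have -> : dl `^ (1 - al) = dl * dl `^ (- al).
  by rewrite powRD ?powRr1 ?ltW//; apply/implyP => _; rewrite gt_eqF.
have -> : dl `^ (l - al) = dl `^ l * dl `^ (- al).
  by rewrite powRD//; apply/implyP => _; rewrite gt_eqF.
rewrite /K le_eqVlt; apply/orP; left; apply/eqP; field.
by apply/andP; split; rewrite ?gt_eqF ?subr_gt0.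
Qed.

(** Write F, G for the derivatives of f, g and D, E for those of the
    interpolants. Then F G - D E = (F - D) G + D (G - E): the first term is
    small in L1 times bounded, the second is bounded in L1 times uniformly
    small, and the integral of D E is the Riemann sum. *)
Theorem marchaud_pairing_riemann al l C t f g :
  0 < al < 2^-1 -> 1 - al < l -> l <= 1 -> 0 <= C -> 0 < t ->
  measurable_fun `[0, t] f -> measurable_fun `[0, t] g ->
  (forall x u, 0 <= x <= t -> 0 <= u <= t -> `|f x - f u| <= C * `|x - u| `^ l) ->
  (forall x u, 0 <= x <= t -> 0 <= u <= t -> `|g x - g u| <= C * `|x - u| `^ l) ->
  mu.-integrable `[0, t] (EFin \o marchaud_left al f) ->
  measurable_fun `[0, t] (marchaud_right al t (fun u => g u - g t)) ->
  exists A e : R, 0 < e /\ forall N dl, 0 < dl -> t = N%:R * dl ->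
   `|\int[mu]_(x in `[0, t])
       (marchaud_left al f x * marchaud_right al t (fun u => g u - g t) x) +
     beta_pairing al / al *
       \sum_(i < N) f (i%:R * dl) * (g (i.+1%:R * dl) - g (i%:R * dl))|
   <= A * dl `^ e.
Proof.
move=> /andP[al0 al12] all l1 C0 t0 mf mg hf hg jF mG.
have alP : 0 < al < 1 by rewrite al0/=; lra.
set Fr := marchaud_left al f; set Gr := marchaud_right al t _.
(* half of the excess regularity of [g] pays for the rate, the other half
   keeps the right derivative of the interpolation error bounded *)
pose e := (l - (1 - al)) / 2.
have e0 : 0 < e by rewrite /e; lra.
have el : 1 - al < l - e by rewrite /e; lra.
have eP : 0 < e < l by rewrite e0/=; lra.
have lal : al < l by lra.
have ela : 0 <= l - al - e by rewrite /e; lra.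
pose BG := C * (1 + (l + al - 1)^-1) * t `^ (l + al - 1).
pose BE := 4 * C * (1 + (l - e + al - 1)^-1) * t `^ (l - e + al - 1).
pose K := t * (C * (3 / (1 - al) + al / (l - al))).
have BG0 : 0 <= BG.
  by rewrite /BG !mulr_ge0 ?powR_ge0// addr_ge0// invr_ge0; lra.
have BE0 : 0 <= BE.
  by rewrite /BE !mulr_ge0 ?powR_ge0// addr_ge0// invr_ge0; lra.
have K0 : 0 <= K.
  by rewrite /K !mulr_ge0 ?(ltW t0)// addr_ge0// divr_ge0; lra.
pose IF := \int[mu]_(x in `[0, t]) `|Fr x|.
exists (BG * K * t `^ (l - al - e) + BE * (IF + K * t `^ (l - al))), e; split => //.
move=> N dl dl0 tE.
pose D x := \sum_(i < N) jump f dl i * pos_part (x - i%:R * dl) `^ (- al).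
pose E := chord_marchaud al g dl N.
have [jD eD] := step_L1_error alP lal C0 dl0 tE mf hf jF.
have [jDE eDE] := step_chord_pairing f g alP dl0 tE.
rewrite -/D -/Fr -/K in jD eD; rewrite -/D -/E in jDE eDE.
set S := beta_pairing al / al * _ in eDE *.
have dlt : dl <= t.
  case: N tE {D E jD eD jDE eDE S} => [|N] tE.
    by move: t0; rewrite tE mul0r ltxx.
  by rewrite tE -natr1 mulrDl mul1r lerDr mulr_ge0// ltW.
have bG x : `[0, t]%classic x -> `|Gr x| <= BG.
  rewrite /= in_itv/= => xP.
  have [] // := @marchaud_right_bound _ al l C t x (fun u => g u - g t) alP all C0 xP.
  - by apply: measurable_funB.
  - by rewrite subrr.
  - move=> u /andP[xu ut]; rewrite opprB addrA subrK.
    by rewrite -[u - x]ger0_norm ?subr_ge0// distrC; apply: hg; lra.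
have bE x : `[0, t]%classic x -> `|Gr x - E x| <= BE * dl `^ e.
  rewrite /= in_itv/= => xP.
  have := @right_chord_error _ al l e C dl t N x g alP eP el l1 C0 dl0 tE mg hg xP.
  rewrite -/E -/Gr => h; apply: (le_trans h); rewrite /BE.
  by rewrite le_eqVlt; apply/orP; left; apply/eqP; ring.
have jFD := integrable_sub (@measurable_itvR _ _) jF jD.
have jn := integrable_norm jFD.
have jDn := integrable_norm jD.
have jFn := integrable_norm jF.
have mE : measurable_fun `[0, t] E by exact: measurable_chord_marchaud.
have mFD : measurable_fun `[0, t] (fun x => Fr x - D x).
  by apply/measurable_EFinP; exact: (measurable_int _ jFD).
have mD : measurable_fun `[0, t] D.
  by apply/measurable_EFinP; exact: (measurable_int _ jD).
have jBG := integrable_scale BG (@measurable_itvR _ _) jn.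
have jBE := integrable_scale (BE * dl `^ e) (@measurable_itvR _ _) jDn.
have m1 : measurable_fun `[0, t] (fun x => (Fr x - D x) * Gr x) by apply: measurable_funM.
have m2 : measurable_fun `[0, t] (fun x => D x * (Gr x - E x)).
  by apply: measurable_funM => //; apply: measurable_funB.
have h1 z : `[0, t]%classic z -> `|(Fr z - D z) * Gr z| <= BG * `|Fr z - D z|.
  by move=> zt; rewrite normrM mulrC ler_wpM2r// bG.
have h2 z : `[0, t]%classic z -> `|D z * (Gr z - E z)| <= BE * dl `^ e * `|D z|.
  by move=> zt; rewrite normrM mulrC ler_wpM2r// bE.
have j1 := integrable_le_bound (@measurable_itvR _ _) m1 jBG h1.
have j2 := integrable_le_bound (@measurable_itvR _ _) m2 jBE h2.
have b1 := Rintegral_le_bound (@measurable_itvR _ _) m1 jBG h1.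
have b2 := Rintegral_le_bound (@measurable_itvR _ _) m2 jBE h2.
rewrite (RintegralZl _ (@measurable_itvR _ _) jn) in b1.
rewrite (RintegralZl _ (@measurable_itvR _ _) jDn) in b2.
have bD : \int[mu]_(x in `[0, t]) `|D x| <= IF + K * dl `^ (l - al).
  apply: (@le_trans _ _ (IF + \int[mu]_(x in `[0, t]) `|Fr x - D x|)); last first.
    by rewrite lerD2l.
  rewrite -(RintegralD (@measurable_itvR _ _) jFn jn).
  apply: (le_Rintegral (@measurable_itvR _ _) jDn
    (integrable_add (@measurable_itvR _ _) jFn jn)).
  move=> x _; rewrite /comp.
  by have := ler_normB (Fr x) (Fr x - D x); rewrite subKr.
have -> : \int[mu]_(x in `[0, t]) (Fr x * Gr x) =
    \int[mu]_(x in `[0, t]) ((Fr x - D x) * Gr x) +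
    (\int[mu]_(x in `[0, t]) (D x * (Gr x - E x)) +
     \int[mu]_(x in `[0, t]) (D x * E x)).
  rewrite -(RintegralD (@measurable_itvR _ _) j2 jDE).
  rewrite -(RintegralD (@measurable_itvR _ _) j1); last first.
    exact: (integrable_add (@measurable_itvR _ _) j2 jDE).
  by congr Rintegral; apply/funext => x; rewrite mulrBl mulrBr !subrK.
rewrite eDE !addrA subrK.
apply: le_trans (ler_normD _ _) _.
have pe : dl `^ (l - al) = dl `^ e * dl `^ (l - al - e).
  rewrite -powRD; last by apply/implyP => _; rewrite gt_eqF.
  by rewrite [e + _]addrC subrK.
have p1 : dl `^ (l - al - e) <= t `^ (l - al - e).
  by apply: ge0_ler_powR; rewrite ?nnegrE//; exact: ltW.
have p2 : dl `^ (l - al) <= t `^ (l - al).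
  by apply: ge0_ler_powR; rewrite ?nnegrE//; [lra|exact: ltW|exact: ltW].
rewrite mulrDl; apply: lerD.
  apply: (le_trans b1); apply: (le_trans (ler_wpM2l BG0 eD)).
  have aux (p q r w : R) : p * (q * (r * w)) = p * q * w * r by ring.
  rewrite pe aux; apply: ler_wpM2r; first exact: powR_ge0.
  by apply: ler_wpM2l => //; exact: mulr_ge0.
apply: (le_trans b2); rewrite [leRHS]mulrAC.
apply: ler_wpM2l; first by rewrite mulr_ge0// powR_ge0.
apply: (le_trans bD); rewrite lerD2l.
exact: ler_wpM2l.
Qed.

End riemann_sums.

(** * Euler expansion of a solution path *)

Section sde_paths.
Context {R : realType}.
Local Notation mu := (@lebesgue_measure R).
Implicit Types (al x y u s l C L t dl e : R) (f g : R -> R) (N : nat).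

Lemma marchaud_pairing_integrable al l C t f g :
  0 < al < 1 -> 1 - al < l -> 0 <= C -> measurable_fun `[0, t] g ->
  (forall x u, 0 <= x <= t -> 0 <= u <= t -> `|g x - g u| <= C * `|x - u| `^ l) ->
  mu.-integrable `[0, t] (EFin \o marchaud_left al f) ->
  measurable_fun `[0, t] (marchaud_right al t (fun u => g u - g t)) ->
  mu.-integrable `[0, t] (EFin \o (fun x =>
    marchaud_left al f x * marchaud_right al t (fun u => g u - g t) x)).
Proof.
move=> alP all C0 mg hg jF mG.
have jS := integrable_scale (C * (1 + (l + al - 1)^-1) * t `^ (l + al - 1))
  (@measurable_itvR _ _) (integrable_norm jF).
apply: (integrable_le_bound (@measurable_itvR _ _) _ jS).
  apply: (measurable_funM _ mG).
  by apply/measurable_EFinP; exact: (measurable_int _ jF).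
move=> x; rewrite /= in_itv/= => xP; rewrite normrM mulrC ler_wpM2r//.
have /andP[x0 xt] := xP.
have [] // := @marchaud_right_bound _ al l C t x (fun u => g u - g t) alP all C0 xP.
- by apply: measurable_funB.
- by rewrite subrr.
- move=> u /andP[xu ut]; rewrite opprB addrA subrK.
  by rewrite -[u - x]ger0_norm ?subr_ge0// distrC; apply: hg; lra.
Qed.

(** For [0 < al < 1] its value is 1, by Euler's formula for the beta
    integral. *)
Definition gls_constant al : R :=
  (Gamma (1 - al))^-1 * (Gamma al)^-1 * (beta_pairing al / al).

(** The two phases multiply to 1, so the real part is the pairing of
    [marchaud_pairing_riemann] up to the Gamma factors. The minus sign in
    front of the Riemann sum comes from the phase convention of the right
    derivative. If a Gamma factor is 0 both sides vanish; otherwise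
    integrability of the unnormalized derivatives can be recovered by
    division. *)
Lemma gls_integral_riemann al l C t f g :
  0 < al < 2^-1 -> 1 - al < l -> l <= 1 -> 0 <= C -> 0 < t ->
  measurable_fun `[0, t] f -> measurable_fun `[0, t] g ->
  (forall x u, 0 <= x <= t -> 0 <= u <= t -> `|f x - f u| <= C * `|x - u| `^ l) ->
  (forall x u, 0 <= x <= t -> 0 <= u <= t -> `|g x - g u| <= C * `|x - u| `^ l) ->
  gls_integrable al 0 t f g ->
  exists A e : R, 0 < e /\ forall N dl, 0 < dl -> t = N%:R * dl ->
   `|complex.Re (gls_integral al 0 t f g) +
     gls_constant al *
       \sum_(i < N) f (i%:R * dl) * (g (i.+1%:R * dl) - g (i%:R * dl))|
   <= A * dl `^ e.
Proof.
move=> alP all l1 C0 t0 mf mg hf hg [[_ jfl] [_ mRe mIm _]].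
have /andP[al0 al2] := alP; have alP1 : 0 < al < 1 by rewrite al0/=; lra.
set c1 := (Gamma (1 - al))^-1; set c2 := (Gamma al)^-1.
pose gt u := g u - g t.
have flE x : frac_left al 0 f x = c1 * marchaud_left al f x.
  by rewrite /frac_left /marchaud_left subr0.
have frE x : frac_right al t gt x =
    expi (- (pi * al)) * (c2 * marchaud_right al t gt x)%:C%C.
  by rewrite /frac_right -/c2 -mulrA -rmorphM.
have reE x : complex.Re (frac_right al t gt x) =
    cos (- (pi * al)) * (c2 * marchaud_right al t gt x).
  by rewrite frE /= mulr0 subr0.
have imE x : complex.Im (frac_right al t gt x) =
    sin (- (pi * al)) * (c2 * marchaud_right al t gt x).
  by rewrite frE /= mulr0 add0r.
pose I := fun x => marchaud_left al f x * marchaud_right al t gt x.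
have prE x : (frac_left al 0 f x)%:C%C * frac_right al t gt x =
  Complex (cos (pi * al) * (c1 * c2 * I x)) (- sin (pi * al) * (c1 * c2 * I x)).
  rewrite flE frE /expi cosN sinN /I.
  by apply/eqP; rewrite eq_complex/= !mul0r !mulr0 !subr0 !addr0 !add0r;
    apply/andP; split; apply/eqP; ring.
have reG : (c1 * c2 = 0 \/ mu.-integrable `[0, t] (EFin \o I)) ->
    complex.Re (gls_integral al 0 t f g) = c1 * c2 * \int[mu]_(x in `[0, t]) I x.
  move=> cI; rewrite /gls_integral /Cintegral /=.
  have Z k : \int[mu]_(x in `[0, t]) (k * (c1 * c2 * I x)) =
      k * (c1 * c2 * \int[mu]_(x in `[0, t]) I x).
    case: cI => [->|jI].
      rewrite !mul0r mulr0 -[RHS](mul0r (fine (mu `[0, t]))).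
      rewrite -Rintegral_cst; last exact: measurable_itvR.
      by apply: eq_Rintegral => x _; rewrite mul0r mulr0.
    rewrite (RintegralZl _ (@measurable_itvR _ _)); last first.
      exact: (integrable_scale _ (@measurable_itvR _ _) jI).
    by rewrite (RintegralZl _ (@measurable_itvR _ _) jI).
  have -> : \int[mu]_(x in `[0, t]) complex.Re ((frac_left al 0 f x)%:C%C * frac_right al t gt x) =
     cos (pi * al) * (c1 * c2 * \int[mu]_(x in `[0, t]) I x).
    by rewrite -Z; apply: eq_Rintegral => x _; rewrite prE.
  have -> : \int[mu]_(x in `[0, t]) complex.Im ((frac_left al 0 f x)%:C%C * frac_right al t gt x) =
     - sin (pi * al) * (c1 * c2 * \int[mu]_(x in `[0, t]) I x).
    by rewrite -Z; apply: eq_Rintegral => x _; rewrite prE.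
  have rot (p q v : R) : p * (p * v) - q * (- q * v) = (p ^+ 2 + q ^+ 2) * v by ring.
  by rewrite rot cos2Dsin2 mul1r.
rewrite /gls_constant -/c1 -/c2.
have [c0|c0] := eqVneq (c1 * c2) 0.
  exists 0, 1; split => // N dl dl0 _.
  by rewrite reG; [rewrite c0 !mul0r addr0 normr0|left].
have c10 : c1 != 0 by apply: contraNneq c0 => ->; rewrite mul0r.
have c20 : c2 != 0 by apply: contraNneq c0 => ->; rewrite mulr0.
have jF : mu.-integrable `[0, t] (EFin \o marchaud_left al f).
  have := integrable_scale c1^-1 (@measurable_itvR _ _) jfl.
  congr (_.-integrable _ _); apply/funext => x.
  by rewrite /= flE mulrA mulVf// mul1r.
have mG : measurable_fun `[0, t] (marchaud_right al t gt).
  rewrite (_ : marchaud_right al t gt = fun x => c2^-1 *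
     (cos (- (pi * al)) * complex.Re (frac_right al t gt x) +
      sin (- (pi * al)) * complex.Im (frac_right al t gt x))); last first.
    have rot (p q v : R) : p * (p * v) + q * (q * v) = (p ^+ 2 + q ^+ 2) * v by ring.
    by apply/funext => x; rewrite reE imE rot cos2Dsin2 mul1r mulrA mulVf// mul1r.
  apply: measurable_funM; first exact: measurable_cst.
  apply: measurable_funD; apply: measurable_funM.
  - exact: measurable_cst.
  - exact: mRe.
  - exact: measurable_cst.
  - exact: mIm.
have jI := marchaud_pairing_integrable alP1 all C0 mg hg jF mG.
have [A [e [e0 hA]]] := marchaud_pairing_riemann alP all l1 C0 t0 mf mg hf hg jF mG.
exists (`|c1 * c2| * A), e; split => // N dl dl0 tE.
rewrite reG; [|by right].
rewrite -[c1 * c2 * (beta_pairing al / al) * _]mulrA -mulrDr normrM -(mulrA _ A).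
by apply: ler_wpM2l => //; exact: hA.
Qed.

Lemma Rintegral_riemann l C t f :
  0 <= l -> 0 <= C -> 0 <= t -> measurable_fun `[0, t] f ->
  (forall x u, 0 <= x <= t -> 0 <= u <= t -> `|f x - f u| <= C * `|x - u| `^ l) ->
  forall N dl, 0 < dl -> t = N%:R * dl ->
  `|\int[mu]_(x in `[0, t]) f x - \sum_(i < N) f (i%:R * dl) * dl| <= t * C * dl `^ l.
Proof.
move=> l0 C0 t0 mf hf N dl dl0 tE.
have [jK _] := Rintegral_cst_itv (`|f 0| + C * t `^ l) t0.
have jf : mu.-integrable `[0, t] (EFin \o f).
  apply: (integrable_le_bound (@measurable_itvR _ _) mf jK).
  move=> x; rewrite /= in_itv/= => /andP[x0 xt].
  rewrite -[f x](subrK (f 0)); apply: le_trans (ler_normD _ _) _.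
  rewrite addrC lerD2l; apply: le_trans (hf _ _ _ _) _; [lra|lra|].
  rewrite subr0 ger0_norm// ler_wpM2l//.
  by apply: ge0_ler_powR; rewrite ?nnegrE.
rewrite {1}tE Rintegral_cells -?tE// -sumrB.
apply: le_trans (ler_norm_sum _ _ _) _.
apply: (@le_trans _ _ (\sum_(i < N) (C * dl `^ l * dl))); last first.
  by rewrite sumr_const card_ord -mulr_natl tE le_eqVlt; apply/orP; left; apply/eqP; ring.
apply: ler_sum => k _.
have kk : k%:R * dl <= k.+1%:R * dl by rewrite ler_pM2r// ler_nat.
have k0 : 0 <= k%:R * dl by rewrite mulr_ge0// ltW.
have kt : k.+1%:R * dl <= t by rewrite tE ler_pM2r// ler_nat.
have kd : k.+1%:R * dl - k%:R * dl = dl by rewrite -mulrBl -natrB// subSnn mul1r.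
have [jc vc] := Rintegral_cst_itv (f (k%:R * dl)) kk.
have [jd vd] := Rintegral_cst_itv (C * dl `^ l) kk.
rewrite kd in vc vd.
have sub : `[k%:R * dl, k.+1%:R * dl]%classic `<=` `[0, t]%classic.
  by move=> z /=; rewrite !in_itv/= => /andP[kz zk]; apply/andP; split; lra.
have jfk : mu.-integrable `[k%:R * dl, k.+1%:R * dl] (EFin \o f).
  by apply: (integrableS _ _ _ jf); try exact: measurable_itvR.
rewrite -vc -(RintegralB (@measurable_itvR _ _) jfk jc) -vd.
have jfc := integrable_sub (@measurable_itvR _ _) jfk jc.
apply: (Rintegral_le_bound (@measurable_itvR _ _) _ jd).
  by apply/measurable_EFinP; exact: (measurable_int _ jfc).
move=> x; rewrite /= in_itv/= => /andP[kx xk].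
apply: le_trans (hf _ _ _ _) _; [lra|lra|].
apply: ler_wpM2l => //; apply: ge0_ler_powR; rewrite ?nnegrE//; first lra.
by rewrite ger0_norm ?subr_ge0//; lra.
Qed.

(** First order expansion over [[s, t]] of a path solving the equation with
    drift [theta a] and noise [- kap B]. *)
Definition euler_term (theta kap : R) (a b x B : R -> R) (s t : R) : R :=
  theta * a (x s) * (t - s) - kap * b (x s) * (B t - B s).

Lemma lipschitz_bound_continuous (h : R -> R) L :
  0 <= L -> (forall y z, `|h y - h z| <= L * `|y - z|) -> continuous h.
Proof.
move=> L0 hl y; apply/cvgrPdist_le => /= eps eps0.
have L1 : 0 < L + 1 by lra.
have e'0 : 0 < eps / (L + 1) by rewrite divr_gt0.
have ny : \forall z \near nbhs y, `|y - z| <= eps / (L + 1).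
  have /cvgrPdist_le := @cvg_id _ (nbhs y).
  by apply.
near=> z; apply: le_trans (hl _ _) _.
apply: (@le_trans _ _ ((L + 1) * `|y - z|)).
  by rewrite ler_wpM2r// lerDl.
by rewrite mulrC -ler_pdivlMr//; near: z.
Unshelve. all: by end_near. Qed.

(** Both integrands [a o x] and [b o x] inherit the Hoelder order of [x], so
    the two integrals of the equation are limits of Riemann sums with a
    polynomial rate. Only the existence of some rate is asserted: the sharp
    local rate is obtained below by sewing. *)
Lemma sde_path_euler al l t theta (a b x B : R -> R) (C L : R) :
  0 < al < 2^-1 -> 1 - al < l -> l <= 1 -> 0 < t -> 0 <= C -> 0 <= L ->
  coef_lipschitz a b L ->
  measurable_fun `[0, t] x -> measurable_fun `[0, t] B ->
  (forall s u, 0 <= s <= t -> 0 <= u <= t -> `|x s - x u| <= C * `|s - u| `^ l) ->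
  (forall s u, 0 <= s <= t -> 0 <= u <= t -> `|B s - B u| <= C * `|s - u| `^ l) ->
  gls_integrable al 0 t (b \o x) B ->
  (x t)%:C%C = (x 0 + theta * \int[mu]_(s in `[0, t]) a (x s))%:C%C +
    gls_integral al 0 t (b \o x) B ->
  exists A e : R, 0 < e /\ forall N dl, 0 < dl -> t = N%:R * dl ->
   `|x t - x 0 - \sum_(i < N) euler_term theta (gls_constant al) a b x B
       (i%:R * dl) (i.+1%:R * dl)| <= A * dl `^ e.
Proof.
move=> alP all l1 t0 C0 L0 lip mx mB hx hB gi eq.
have /andP[al0 al2] := alP.
have la y z : `|a y - a z| <= L * `|y - z|.
  by apply: le_trans (lip y z); rewrite lerDl.
have lb y z : `|b y - b z| <= L * `|y - z|.
  by apply: le_trans (lip y z); rewrite lerDr.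
have ma : measurable_fun `[0, t] (a \o x).
  apply: measurableT_comp => //; apply: continuous_measurable_fun.
  exact: (lipschitz_bound_continuous L0).
have mb : measurable_fun `[0, t] (b \o x).
  apply: measurableT_comp => //; apply: continuous_measurable_fun.
  exact: (lipschitz_bound_continuous L0).
pose C' := C + L * C.
have C'0 : 0 <= C' by rewrite addr_ge0// mulr_ge0.
have hCB s u : 0 <= s <= t -> 0 <= u <= t -> `|B s - B u| <= C' * `|s - u| `^ l.
  move=> st ut; apply: (le_trans (hB _ _ st ut)).
  by rewrite ler_wpM2r ?powR_ge0// lerDl mulr_ge0.
have hla (h : R -> R) : (forall y z, `|h y - h z| <= L * `|y - z|) ->
    forall s u, 0 <= s <= t -> 0 <= u <= t -> `|(h \o x) s - (h \o x) u| <= C' * `|s - u| `^ l.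
  move=> hl s u st ut; apply: (le_trans (hl _ _)).
  apply: (le_trans (ler_wpM2l L0 (hx _ _ st ut))).
  by rewrite mulrA ler_wpM2r ?powR_ge0// lerDr.
have [A [e [e0 hA]]] := gls_integral_riemann alP all l1 C'0 t0 mb mB (hla b lb) hCB gi.
have hI := @Rintegral_riemann l C' t (a \o x) ltac:(lra) C'0 (ltW t0) ma (hla a la).
have eqR : x t = x 0 + theta * \int[mu]_(s in `[0, t]) a (x s) +
    complex.Re (gls_integral al 0 t (b \o x) B).
  by have /(congr1 (@complex.Re R)) := eq; rewrite raddfD.
pose m := Num.min e l.
have m0 : 0 < m by rewrite lt_min e0; lra.
pose K1 := `|A| * t `^ (e - m); pose K2 := `|theta| * (t * C') * t `^ (l - m).
exists (K1 + K2), m; split => // N dl dl0 tE.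
have dlt : dl <= t.
  case: N tE => [|N] tE; first by move: t0; rewrite tE mul0r ltxx.
  by rewrite tE -natr1 mulrDl mul1r lerDr mulr_ge0// ltW.
have pw p : m <= p -> dl `^ p <= t `^ (p - m) * dl `^ m.
  move=> mp; have -> : dl `^ p = dl `^ (p - m) * dl `^ m.
    by rewrite -powRD ?subrK//; apply/implyP => _; rewrite gt_eqF.
  rewrite ler_wpM2r ?powR_ge0//; apply: ge0_ler_powR; rewrite ?nnegrE ?subr_ge0//; exact: ltW.
set Sb := \sum_(i < N) (b \o x) (i%:R * dl) * (B (i.+1%:R * dl) - B (i%:R * dl)).
set Sa := \sum_(i < N) (a \o x) (i%:R * dl) * dl.
have -> : \sum_(i < N) euler_term theta (gls_constant al) a b x B (i%:R * dl) (i.+1%:R * dl)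
    = theta * Sa - gls_constant al * Sb.
  rewrite /Sa /Sb !mulr_sumr -sumrB; apply: eq_bigr => i _; rewrite /euler_term /=.
  rewrite -[i.+1%:R * dl - i%:R * dl]mulrBl -natrB// subSnn mul1r; ring.
have -> : x t - x 0 - (theta * Sa - gls_constant al * Sb) =
    theta * (\int[mu]_(s in `[0, t]) (a \o x) s - Sa) +
    (complex.Re (gls_integral al 0 t (b \o x) B) + gls_constant al * Sb).
  by rewrite eqR /comp; ring.
apply: le_trans (ler_normD _ _) _; rewrite addrC mulrDl; apply: lerD.
  apply: le_trans (hA N dl dl0 tE) _; rewrite /K1 -mulrA.
  apply: (@le_trans _ _ (`|A| * dl `^ e)).
    by rewrite ler_wpM2r ?powR_ge0// ler_norm.
  by rewrite ler_wpM2l// pw// ge_min lexx.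
rewrite normrM /K2 -!mulrA ler_wpM2l//; apply: le_trans (hI N dl dl0 tE) _.
rewrite mulrA ler_wpM2l ?mulr_ge0// ?(ltW t0)//.
by rewrite pw// ge_min lexx orbT.
Qed.

End sde_paths.

(** * Sewing along dyadic partitions *)

Section dyadic_sewing.
Context {R : realType}.
Implicit Types (F : nat -> nat -> R) (h K L N Lam theta kap : R).

(** Sum of [F] over the [2 ^ p] cells of level [m + p] that make up the cell
    [k] of level [m]. *)
Definition block F (m k p : nat) : R := \sum_(i < 2 ^ p) F (m + p)%N (k * 2 ^ p + i)%N.

Lemma sum_even_odd (G : nat -> R) n :
  \sum_(i < n.*2) G i = \sum_(i < n) (G i.*2 + G i.*2.+1).
Proof.
elim: n => [|n IH]; first by rewrite !big_ord0.
by rewrite doubleS !big_ord_recr/= IH addrA.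
Qed.

Lemma block_refine F m k p :
  block F m k p.+1 = \sum_(i < 2 ^ p)
    (F (m + p).+1 (k * 2 ^ p + i)%N.*2 + F (m + p).+1 (k * 2 ^ p + i)%N.*2.+1).
Proof.
rewrite /block expnS mul2n (sum_even_odd (fun i => F (m + p.+1)%N (k * (2 ^ p).*2 + i)%N)).
by apply: eq_bigr => i _; rewrite !addnS doubleD doubleMr.
Qed.

(** Passing from level [q] to [q + 1] replaces each term by two; the weights
    [w q] bound the defect of one replacement. *)
Lemma block_error F (w : nat -> R) m k p :
  (forall q i, (q < p)%N -> (i < 2 ^ q)%N ->
    `|F (m + q)%N (k * 2 ^ q + i)%N - F (m + q).+1 (k * 2 ^ q + i).*2 -
      F (m + q).+1 (k * 2 ^ q + i).*2.+1| <= w q) ->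
  `|block F m k p - F m k| <= \sum_(q < p) 2 ^+ q * w q.
Proof.
elim: p => [|p IH] hw.
  by rewrite /block expn0 big_ord1 big_ord0 addn0 muln1 addn0 subrr normr0.
rewrite big_ord_recr/=.
have -> : block F m k p.+1 - F m k =
    (block F m k p - F m k) + (block F m k p.+1 - block F m k p) by ring.
apply: le_trans (ler_normD _ _) _; apply: lerD.
  by apply: IH => q i qp; apply: hw; exact: ltnW.
rewrite block_refine /block -sumrB; apply: le_trans (ler_norm_sum _ _ _) _.
apply: (@le_trans _ _ (\sum_(i < 2 ^ p) w p)).
  apply: ler_sum => i _; apply: le_trans (hw p i (ltnSn p) (ltn_ord i)).
  rewrite -[leLHS]normrN le_eqVlt; apply/orP; left; apply/eqP.
  by congr (`|_|); ring.
by rewrite sumr_const card_ord -[leLHS]mulr_natl natrX.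
Qed.

Lemma geometric_partial_sum (r : R) p : 0 <= r < 1 ->
  \sum_(q < p) r ^+ q <= (1 - r)^-1.
Proof.
move=> /andP[r0 r1]; rewrite -[leRHS]mul1r ler_pdivlMr ?subr_gt0//.
have -> : (\sum_(q < p) r ^+ q) * (1 - r) = 1 - r ^+ p.
  elim: p => [|p IH]; first by rewrite big_ord0 mul0r expr0 subrr.
  by rewrite big_ord_recr/= mulrDl IH exprS; ring.
by rewrite gerBl exprn_ge0.
Qed.

Definition dincr (x : R -> R) (m k : nat) : R := x (dyadic R m k.+1) - x (dyadic R m k).

Lemma dyadic_double m k : dyadic R m.+1 k.*2 = dyadic R m k.
Proof.
rewrite /dyadic exprS -muln2 natrM; field.
by rewrite expf_neq0// pnatr_eq0.
Qed.

Lemma dyadic_step m k : dyadic R m k.+1 - dyadic R m k = (2 ^+ m)^-1.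
Proof. by rewrite /dyadic -mulrBl -natrB// subSnn mul1r. Qed.

Definition dterm theta kap (a b x B : R -> R) (m k : nat) : R :=
  euler_term theta kap a b x B (dyadic R m k) (dyadic R m k.+1).

(** Size of the forcing on one cell: it dominates the Euler term up to the
    bound on the coefficients, and its defect up to their Lipschitz constant
    and an increment of [x]. *)
Definition driving theta kap (B : R -> R) (m k : nat) : R :=
  `|theta| * (2 ^+ m)^-1 + `|kap| * `|dincr B m k|.

Lemma dterm_bound theta kap (a b x B : R -> R) K m k :
  coef_bounded a b K -> `|dterm theta kap a b x B m k| <= K * driving theta kap B m k.
Proof.
move=> hK; rewrite /dterm /euler_term dyadic_step -/(dincr B m k) /driving.
have ha y : `|a y| <= K by apply: le_trans (hK y); rewrite lerDl.
have hb y : `|b y| <= K by apply: le_trans (hK y); rewrite lerDr.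
have swap (p q r : R) : p * q * r = q * (p * r) by ring.
apply: le_trans (ler_normB _ _) _; rewrite [leRHS]mulrDr !normrM !swap lerD//.
  rewrite [`|_^-1|]ger0_norm ?invr_ge0 ?exprn_ge0//.
  by apply: ler_wpM2r => //; rewrite mulr_ge0// invr_ge0 exprn_ge0.
by apply: ler_wpM2r => //; rewrite mulr_ge0.
Qed.

Lemma dterm_defect theta kap (a b x B : R -> R) L m k :
  coef_lipschitz a b L -> 0 <= L ->
  `|dterm theta kap a b x B m k - dterm theta kap a b x B m.+1 k.*2 -
    dterm theta kap a b x B m.+1 k.*2.+1| <=
  L * `|dincr x m.+1 k.*2| * driving theta kap B m.+1 k.*2.+1.
Proof.
move=> hL L0; rewrite /dterm -doubleS !dyadic_double.
set s := dyadic R m k; set t := dyadic R m k.+1; set u := dyadic R m.+1 k.*2.+1.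
have -> : euler_term theta kap a b x B s t - euler_term theta kap a b x B s u -
    euler_term theta kap a b x B u t =
    (a (x s) - a (x u)) * (theta * (t - u)) - (b (x s) - b (x u)) * (kap * (B t - B u)).
  by rewrite /euler_term; ring.
have la y z : `|a y - a z| <= L * `|y - z|.
  by apply: le_trans (hL y z); rewrite lerDl.
have lb y z : `|b y - b z| <= L * `|y - z|.
  by apply: le_trans (hL y z); rewrite lerDr.
have -> : dincr x m.+1 k.*2 = x u - x s by rewrite /dincr dyadic_double.
have tu : t - u = (2 ^+ m.+1)^-1.
  by rewrite -(dyadic_step m.+1 k.*2.+1) -doubleS dyadic_double.
have tB : dincr B m.+1 k.*2.+1 = B t - B u by rewrite /dincr -doubleS dyadic_double.
rewrite /driving tB [leRHS]mulrDr.
apply: le_trans (ler_normB _ _) _; rewrite !normrM lerD//.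
  rewrite tu [`|_^-1|]ger0_norm ?invr_ge0 ?exprn_ge0//.
  by apply: ler_pM; rewrite ?mulr_ge0// distrC.
by apply: ler_pM; rewrite ?mulr_ge0// distrC.
Qed.

(** Each refinement of the Euler sum costs the product of an increment of [x]
    and an increment of the noise, of order [h ^ (2 l)] at level [l], while
    the number of cells doubles; the series converges since [2 h ^ 2 < 1]. *)
Lemma dyadic_local_error theta kap (a b x B : R -> R) L N Lam h m k :
  coef_lipschitz a b L -> 0 <= L -> 0 <= N -> 0 < h -> 2 * h ^+ 2 < 1 ->
  (forall l i, (m < l)%N -> (k * 2 ^ (l - m) <= i < k.+1 * 2 ^ (l - m))%N ->
    `|dincr x l i| <= N * h ^+ l /\ driving theta kap B l i <= Lam * h ^+ l) ->
  (block (dterm theta kap a b x B) m k p @[p --> \oo] --> dincr x m k) ->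
  `|dincr x m k - dterm theta kap a b x B m k| <=
    L * N * Lam * (h ^+ 2 / (1 - 2 * h ^+ 2)) * h ^+ (2 * m).
Proof.
move=> hL L0 N0 h0 h2 hyp lim.
set F := dterm theta kap a b x B.
have dr0 l i : 0 <= driving theta kap B l i.
  by rewrite addr_ge0// mulr_ge0// invr_ge0 exprn_ge0.
have Lam0 : 0 <= Lam.
  have [|_] := hyp m.+1 (k * 2)%N (ltnSn m).
    by rewrite subSnn expn1 leqnn/= ltn_pmul2r.
  by move=> /(le_trans (dr0 _ _)); rewrite pmulr_lge0// exprn_gt0.
pose w q := L * (N * h ^+ (m + q).+1) * (Lam * h ^+ (m + q).+1).
have bnd p : `|block F m k p - F m k| <=
    L * N * Lam * (h ^+ 2 / (1 - 2 * h ^+ 2)) * h ^+ (2 * m).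
  apply: (@le_trans _ _ (\sum_(q < p) 2 ^+ q * w q)).
    apply: block_error => q i qp i2; set j := (k * 2 ^ q + i)%N.
    apply: le_trans (dterm_defect _ _ _ _ _ _ hL L0) _.
    have inb j' : (j.*2 <= j' <= j.*2.+1)%N ->
      (k * 2 ^ ((m + q).+1 - m) <= j' < k.+1 * 2 ^ ((m + q).+1 - m))%N.
      rewrite -addnS addKn expnS ![(_ * (2 * _))%N]mulnCA !mul2n => /andP[j1 j2].
      rewrite (leq_trans _ j1) ?leq_double ?leq_addr//=.
      apply: (leq_trans (n := j.+1.*2)); first by rewrite doubleS !ltnS.
      by rewrite leq_double /j mulSn [leqRHS]addnC -addnS leq_add2l.
    have ml : (m < (m + q).+1)%N by rewrite ltnS leq_addr.
    have [|x1 _] := hyp (m + q).+1 j.*2 ml; first by apply: inb; rewrite leqnn leqnSn.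
    have [|_ d2] := hyp (m + q).+1 j.*2.+1 ml; first by apply: inb; rewrite leqnSn leqnn.
    by rewrite /w; apply: ler_pM; rewrite ?mulr_ge0// ler_wpM2l.
  rewrite (eq_bigr (fun q : 'I_p => L * N * Lam * h ^+ (2 * m) * h ^+ 2 * (2 * h ^+ 2) ^+ q)).
    rewrite -mulr_sumr.
    have E : L * N * Lam * (h ^+ 2 / (1 - 2 * h ^+ 2)) * h ^+ (2 * m) =
      L * N * Lam * h ^+ (2 * m) * h ^+ 2 * (1 - 2 * h ^+ 2)^-1 by ring.
    rewrite E; apply: ler_wpM2l.
      by rewrite !mulr_ge0 ?exprn_ge0 ?(ltW h0).
    by apply: geometric_partial_sum; rewrite h2 andbT mulr_ge0// exprn_ge0// ltW.
  by move=> q _; rewrite /w exprMn exprAC mul2n -addnn !exprS !exprD expr0; ring.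
have cv : `|block F m k p - F m k| @[p --> \oo] --> `|dincr x m k - F m k|.
  by apply: cvg_norm; apply: cvgB => //; exact: cvg_cst.
by apply: (cvgr_to_le cv); exact: nearW.
Qed.

Lemma cvg_half_pow_powR (e : R) m : 0 < e ->
  ((2 ^+ (m + p))^-1) `^ e @[p --> \oo] --> (0 : R).
Proof.
move=> e0; pose r : R := 2^-1 `^ e.
have r0 : 0 < r by rewrite powR_gt0// invr_gt0.
have r1 : r < 1.
  have -> : 1 = 1 `^ e :> R by rewrite powR1.
  by apply: gt0_ltr_powR; rewrite ?nnegrE ?invr_ge0 ?invf_lt1 ?ltr1n.
have E n : ((2 ^+ n)^-1) `^ e = r ^+ n by rewrite -exprVn exprn_powR// invr_ge0.
under eq_fun do rewrite E exprD.
rewrite -(mulr0 (r ^+ m)); apply: cvgMl_tmp; apply: cvg_expr.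
by rewrite ger0_norm// ltW.
Qed.

(** A dyadic cell is the difference of two intervals starting at 0, on which
    the Euler sums converge by hypothesis. *)
Lemma block_cvg theta kap (a b x B : R -> R) m k :
  (forall t : R, 0 < t -> exists A e : R, 0 < e /\
   forall (N : nat) (dl : R), 0 < dl -> t = N%:R * dl ->
   `|x t - x 0 - \sum_(i < N) euler_term theta kap a b x B
       (i%:R * dl) (i.+1%:R * dl)| <= A * dl `^ e) ->
  block (dterm theta kap a b x B) m k p @[p --> \oo] --> dincr x m k.
Proof.
move=> hyp.
pose S j p : R := \sum_(i < j * 2 ^ p) dterm theta kap a b x B (m + p) i.
have SP j : S j p @[p --> \oo] --> x (dyadic R m j) - x 0.
  case: j => [|j].
    rewrite /dyadic mul0r subrr; rewrite (_ : S 0 = cst 0); first exact: cvg_cst.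
    by apply/funext => p; rewrite /S mul0n big_ord0.
  have t0 : 0 < dyadic R m j.+1 by rewrite divr_gt0// exprn_gt0.
  have [A [e [e0 hA]]] := hyp _ t0.
  have lim0 : A * ((2 ^+ (m + p))^-1) `^ e @[p --> \oo] --> A * 0.
    by apply: cvgMl_tmp; exact: cvg_half_pow_powR.
  rewrite mulr0 in lim0.
  apply/cvgrPdist_le => eps eps0; move/cvgrPdist_le : lim0 => /(_ _ eps0).
  apply: filterS => p; rewrite sub0r normrN => /(le_trans (ler_norm _)).
  apply: le_trans.
  have := hA (j.+1 * 2 ^ p)%N (2 ^+ (m + p))^-1; apply.
    by rewrite invr_gt0 exprn_gt0.
  rewrite /dyadic natrM natrX exprD; field.
  by rewrite !expf_neq0.
have E p : block (dterm theta kap a b x B) m k p = S k.+1 p - S k p.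
  by rewrite /S /block mulSn [(_ + k * _)%N]addnC big_split_ord/= addrAC subrr add0r.
under eq_fun do rewrite E.
rewrite /dincr (_ : _ - _ = (x (dyadic R m k.+1) - x 0) - (x (dyadic R m k) - x 0)); last by ring.
by apply: cvgB; exact: SP.
Qed.

(** From an a priori bound [N h ^ l] on the increments,
    [dyadic_local_error] yields [(K Lam + N / 2) h ^ l] at the levels where
    the noise is small. The iterates started at an arbitrary [D] converge to
    the fixed point [2 K Lam], so the path-dependent constant [D] disappears
    from the bound. *)
Lemma dyadic_contraction theta kap (a b x B : R -> R) K L Lam D h (M m0 : nat) :
  coef_lipschitz a b L -> 0 <= L -> coef_bounded a b K -> 0 <= K -> 0 <= D ->
  0 < h <= 1 -> 2 * h ^+ 2 < 1 ->
  (forall m k, block (dterm theta kap a b x B) m k p @[p --> \oo] --> dincr x m k) ->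
  (forall l i, (i < M * 2 ^ l)%N -> driving theta kap B l i <= Lam * h ^+ l) ->
  (forall l i, (i < M * 2 ^ l)%N -> `|dincr x l i| <= D * h ^+ l) ->
  2 * L * Lam * (h ^+ 2 / (1 - 2 * h ^+ 2)) * h ^+ m0 <= 1 ->
  forall l i, (m0 <= l)%N -> (i < M * 2 ^ l)%N ->
    `|dincr x l i| <= 2 * K * Lam * h ^+ l.
Proof.
move=> hL L0 hK K0 D0 /andP[h0 h1] h2 lim hB hx hm0 l i ml iM.
have Lam0 : 0 <= Lam.
  have := hB l i iM; have d0 : 0 <= driving theta kap B l i.
    by rewrite addr_ge0// mulr_ge0// invr_ge0 exprn_ge0.
  by move=> /(le_trans d0); rewrite pmulr_lge0// exprn_gt0.
set c := h ^+ 2 / (1 - 2 * h ^+ 2) in hm0.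
have c0 : 0 <= c by rewrite divr_ge0 ?exprn_ge0 ?subr_ge0 ?(ltW h0) ?(ltW h2).
have rng l' i' j : (i' < M * 2 ^ l')%N -> (l' < j)%N ->
    forall j', (j' < i'.+1 * 2 ^ (j - l'))%N -> (j' < M * 2 ^ j)%N.
  move=> i1 lj j' hj; apply: (leq_trans hj).
  by rewrite -{2}(subnKC (ltnW lj)) expnD mulnA leq_mul2r i1 orbT.
have it j : forall l i, (m0 <= l)%N -> (i < M * 2 ^ l)%N ->
    `|dincr x l i| <= (2 * K * Lam + D / 2 ^+ j) * h ^+ l.
  elim: j => [|j IH] l' i' ml' iM'.
    apply: le_trans (hx _ _ iM') _; rewrite expr0 divr1.
    by rewrite ler_wpM2r ?exprn_ge0 ?(ltW h0)// lerDr !mulr_ge0.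
  set N := 2 * K * Lam + D / 2 ^+ j.
  have N0 : 0 <= N by rewrite addr_ge0 ?mulr_ge0// invr_ge0 exprn_ge0.
  have le1 : `|dincr x l' i' - dterm theta kap a b x B l' i'| <=
      L * N * Lam * c * h ^+ (2 * l').
    apply: dyadic_local_error => // q iq lq /andP[iq1 iq2].
    have iq3 := rng l' i' q iM' lq iq iq2.
    by split; [apply: IH => //; apply: (leq_trans ml'); exact: ltnW|exact: hB].
  have le2 : `|dterm theta kap a b x B l' i'| <= K * Lam * h ^+ l'.
    apply: (le_trans (@dterm_bound theta kap a b x B K l' i' hK)).
    by rewrite -mulrA ler_wpM2l// hB.
  have hl : h ^+ l' <= h ^+ m0 by rewrite ler_wiXn2l// ltW.
  have le3 : L * N * Lam * c * h ^+ (2 * l') <= N / 2 * h ^+ l'.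
    rewrite mul2n -addnn exprD mulrA ler_wpM2r ?exprn_ge0 ?(ltW h0)//.
    apply: (@le_trans _ _ (N / 2 * (2 * L * Lam * c * h ^+ m0))); last first.
      by rewrite ler_piMr// divr_ge0.
    apply: (@le_trans _ _ (L * N * Lam * c * h ^+ m0)).
      by apply: ler_wpM2l => //; exact: mulr_ge0 (mulr_ge0 (mulr_ge0 L0 N0) Lam0) c0.
    by rewrite le_eqVlt; apply/orP; left; apply/eqP; field.
  rewrite -[dincr x l' i'](subrK (dterm theta kap a b x B l' i')).
  apply: le_trans (ler_normD _ _) _.
  apply: (le_trans (lerD (le_trans le1 le3) le2)).
  rewrite -mulrDl ler_wpM2r ?exprn_ge0 ?(ltW h0)// /N exprS le_eqVlt.
  apply/orP; left; apply/eqP; field.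
  by rewrite expf_neq0.
have cv : (2 * K * Lam + D / 2 ^+ j) * h ^+ l @[j --> \oo] --> (2 * K * Lam + 0) * h ^+ l.
  apply: cvgMr_tmp; apply: cvgD; first exact: cvg_cst.
  rewrite -(mulr0 D); apply: cvgMl_tmp.
  under eq_fun do rewrite -exprVn.
  by apply: cvg_expr; rewrite ger0_norm// invf_lt1// ltr1n.
rewrite addr0 in cv; apply: (cvgr_to_ge cv); apply: nearW => j; exact: it.
Qed.

End dyadic_sewing.

(** * Local error with an explicit power of the noise *)

Section all_scales.
Context {R : realType}.
Implicit Types (h K L Lam theta kap be : R).

Lemma power_bracket (r y : R) : 1 < r -> 1 <= y ->
  exists m : nat, y <= r ^+ m <= r * y.
Proof.
move=> r1 y1.
have exm : exists m, y <= r ^+ m.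
  have r0 : 0 < r by lra.
  have ri : `|r^-1| < 1 by rewrite gtr0_norm ?invr_gt0// invf_lt1.
  have yi : 0 < y^-1 by rewrite invr_gt0; lra.
  have /cvgrPdist_lt/(_ _ yi) [m _ /(_ m (leqnn m))] := cvg_expr ri.
  rewrite /= sub0r normrN exprVn gtr0_norm ?invr_gt0 ?exprn_gt0//.
  rewrite ltf_pV2 ?posrE ?exprn_gt0//; last lra.
  by move=> /ltW ?; exists m.
have [m ym min] := ex_minnP exm; exists m; rewrite ym/=.
case: m ym min => [|m] ym min.
  by rewrite expr0 (le_trans y1)// ler_peMl// ?(le_trans _ y1)// ltW.
rewrite exprS ler_pM2l; last lra.
by rewrite leNgt; apply/negP => /ltW /min; rewrite ltnn.
Qed.

Lemma dincr_coarse (x : R -> R) l p i (E : R) :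
  (forall j, (i * 2 ^ p <= j < i.+1 * 2 ^ p)%N -> `|dincr x (l + p) j| <= E) ->
  `|dincr x l i| <= 2 ^+ p * E.
Proof.
move=> hE; have e2 j : dyadic R (l + p) (j * 2 ^ p)%N = dyadic R l j.
  by rewrite /dyadic natrM natrX exprD; field; rewrite !expf_neq0.
have -> : dincr x l i = \sum_(j < 2 ^ p) dincr x (l + p) (i * 2 ^ p + j)%N.
  rewrite -(big_mkord xpredT (fun j => dincr x (l + p) (i * 2 ^ p + j)%N)).
  rewrite (eq_bigr (fun j => x (dyadic R (l + p) (i * 2 ^ p + j.+1)%N) -
      x (dyadic R (l + p) (i * 2 ^ p + j)%N))); last first.
    by move=> j _; rewrite /dincr addnS.
  rewrite (telescope_sumr (fun j => x (dyadic R (l + p) (i * 2 ^ p + j)%N)))//.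
  by rewrite addn0 [(_ + 2 ^ p)%N]addnC -mulSn !e2.
apply: le_trans (ler_norm_sum _ _ _) _.
apply: (@le_trans _ _ (\sum_(j < 2 ^ p) E)).
  apply: ler_sum => j _; apply: hE; rewrite leq_addr/=.
  by rewrite mulSn addnC ltn_add2r.
by rewrite sumr_const card_ord -[leLHS]mulr_natl natrX.
Qed.

(** The contraction holds from a level [m0] with [h ^ (- m0)] comparable to
    [Lam]. Coarser increments are sums of at most [2 ^ m0] increments of level
    [m0], hence the loss of a factor [(2 h) ^ m0], comparable to
    [Lam `^ (be^-1 - 1)]. Two further factors [Lam], one from the increments
    of [x] and one from the noise, give the exponent [1 + be^-1]. The constant
    [C] depends neither on the path nor on the horizon [M]. *)
Lemma dyadic_increment_error be K L : 2^-1 < be < 1 -> 0 <= K -> 0 <= L ->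
  exists C : R, 0 <= C /\
  forall theta kap (a b x B : R -> R) Lam D (M n : nat),
  coef_lipschitz a b L -> coef_bounded a b K -> 1 <= Lam -> 0 <= D ->
  (forall m k, block (dterm theta kap a b x B) m k p @[p --> \oo] --> dincr x m k) ->
  (forall l i, (i < M * 2 ^ l)%N -> driving theta kap B l i <= Lam * (2 `^ (- be)) ^+ l) ->
  (forall l i, (i < M * 2 ^ l)%N -> `|dincr x l i| <= D * (2 `^ (- be)) ^+ l) ->
  forall k, (k < M * 2 ^ n)%N ->
  `|dincr x n k - dterm theta kap a b x B n k| <=
    C * Lam `^ (1 + be^-1) * (2 `^ (- be)) ^+ (2 * n).
Proof.
move=> /andP[be2 be1] K0 L0.
have be0 : 0 < be by lra.
set h : R := 2 `^ (- be).
have h0 : 0 < h by rewrite powR_gt0.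
have hge : 2^-1 <= h.
  rewrite /h -powR_inv1//; apply: ler_powR; first lra.
  by rewrite lerN2 ltW.
have h1 : h <= 1.
  rewrite -[leRHS](powRr0 2) /h; apply: ler_powR; lra.
have h2 : 2 * h ^+ 2 < 1.
  rewrite /h -powR_mulrn ?powR_ge0// -powRrM -{1}(powRr1 (ler0n R 2)) -powRD; last first.
    by apply/implyP.
  rewrite -[ltRHS](powRr0 2); apply: powR_lt_exponent; lra.
have hh1 : 1 <= 2 * h by lra.
set c := h ^+ 2 / (1 - 2 * h ^+ 2).
have c0 : 0 <= c by rewrite divr_ge0 ?exprn_ge0 ?subr_ge0 ?(ltW h0) ?(ltW h2).
pose r := h^-1; have r1 : 1 < r.
  rewrite /r -powRN opprK -[ltLHS](powRr0 2); apply: powR_lt_exponent; lra.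
(* [q Lam <= r ^ m0] is the smallness that the contraction needs *)
pose q := Num.max 1 (2 * L * c).
have q1 : 1 <= q by rewrite le_max lexx.
pose g := be^-1 - 1.
have g0 : 0 < g by rewrite subr_gt0 invf_gt1.
have LKc0 : 0 <= L * (2 * K) * c.
  by apply: mulr_ge0 c0; rewrite !mulr_ge0.
exists (L * (2 * K) * c * (r * q) `^ g); split.
  exact: mulr_ge0 LKc0 (powR_ge0 _ _).
move=> theta kap a b x B Lam D M n hL hK Lam1 D0 lim hB hx k kM.
have Lam0 : 0 < Lam by lra.
have y1 : 1 <= q * Lam by apply: mulr_ege1.
have [m0 /andP[ym my]] := power_bracket r1 y1.
have hm0 : 2 * L * Lam * c * h ^+ m0 <= 1.
  have : 2 * L * c * Lam <= r ^+ m0.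
    by apply: le_trans ym; rewrite ler_pM2r// le_max lexx orbT.
  by rewrite /r exprVn -div1r ler_pdivlMr ?exprn_gt0// [_ * c * Lam]mulrAC.
have h01 : 0 < h <= 1 by rewrite h0.
have fine_sc := dyadic_contraction hL L0 hK K0 D0 h01 h2 lim hB hx hm0.
pose N := 2 * K * Lam * (2 * h) ^+ m0.
have N0 : 0 <= N by rewrite !mulr_ge0 ?exprn_ge0 ?mulr_ge0 ?(ltW h0) ?(ltW Lam0).
have KL0 : 0 <= 2 * K * Lam by rewrite !mulr_ge0 ?(ltW Lam0).
have all_sc l i : (i < M * 2 ^ l)%N -> `|dincr x l i| <= N * h ^+ l.
  move=> iM; have [ml|lm] := leqP m0 l.
    apply: le_trans (fine_sc l i ml iM) _.
    rewrite ler_wpM2r ?exprn_ge0 ?(ltW h0)// ler_peMr//.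
    exact: exprn_ege1.
  have [p mE] : exists p, m0 = (l + p)%N by exists (m0 - l)%N; rewrite subnKC// ltnW.
  apply: le_trans (dincr_coarse (p := p) (E := 2 * K * Lam * h ^+ m0) _) _.
    move=> j /andP[_ j2]; rewrite -mE; apply: fine_sc => //.
    by apply: (leq_trans j2); rewrite mE expnD mulnA leq_mul2r iM orbT.
  rewrite /N mulrCA -!mulrA ler_wpM2l// ler_wpM2l// ler_wpM2l ?(ltW Lam0)//.
  rewrite exprMn -mulrA mulrC [leRHS]mulrCA ler_wpM2l ?exprn_ge0 ?(ltW h0)//.
  rewrite mE exprD mulrAC ler_peMl ?exprn_ge0//.
  rewrite -exprMn; apply: exprn_ege1; exact: hh1.
have err : `|dincr x n k - dterm theta kap a b x B n k| <= L * N * Lam * c * h ^+ (2 * n).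
  apply: dyadic_local_error => // l i nl /andP[i1 i2].
  have iM : (i < M * 2 ^ l)%N.
    apply: (leq_trans i2).
    by rewrite -{2}(subnKC (ltnW nl)) expnD mulnA leq_mul2r kM orbT.
  by split; [exact: all_sc|exact: hB].
apply: (le_trans err); rewrite ler_wpM2r ?exprn_ge0 ?(ltW h0)//.
have pw : (2 * h) ^+ m0 <= (r * q) `^ g * Lam `^ g.
  have -> : (2 * h) ^+ m0 = (r ^+ m0) `^ g.
    have -> : 2 * h = r `^ g.
      rewrite /r -powRN opprK -powRrM /g mulrBr mulfV ?gt_eqF// mulr1.
      by rewrite powRD ?powRr1//; apply/implyP.
    by rewrite exprn_powR// ltW// (lt_trans _ r1).
  rewrite -powRM ?mulr_ge0 ?(ltW Lam0)//; last 2 first.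
  - by rewrite ltW// (lt_trans _ r1).
  - by rewrite (le_trans _ q1).
  apply: ge0_ler_powR; rewrite ?nnegrE -?mulrA//; [exact: ltW| |].
    by rewrite exprn_ge0// ltW// (lt_trans _ r1).
  by rewrite mulr_ge0// ?(le_trans _ y1)// ltW// (lt_trans _ r1).
have LE : Lam `^ (1 + be^-1) = Lam * Lam * Lam `^ g.
  have -> : 1 + be^-1 = 1 + (1 + g) by rewrite /g; ring.
  have spl u v : Lam `^ (u + v) = Lam `^ u * Lam `^ v.
    by rewrite powRD//; apply/implyP => _; rewrite gt_eqF.
  by rewrite !spl powRr1 ?mulrA// ltW.
rewrite LE /N.
have -> : L * (2 * K * Lam * (2 * h) ^+ m0) * Lam * c =
  L * (2 * K) * c * (Lam * Lam) * (2 * h) ^+ m0 by ring.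
have -> : L * (2 * K) * c * (r * q) `^ g * (Lam * Lam * Lam `^ g) =
  L * (2 * K) * c * (Lam * Lam) * ((r * q) `^ g * Lam `^ g) by ring.
by apply: ler_wpM2l => //; apply: mulr_ge0 => //; rewrite mulr_ge0 ?(ltW Lam0).
Qed.

End all_scales.

(** * Exponential square moments of Gaussian variables *)

Section gaussian.
Context {R : realType}.

Import HBNNSimple.

(** Monotone approximation by simple functions reduces the claim to indicator
    functions, where it is the hypothesis. *)
Lemma ge0_integral_density d (T : measurableType d) (m nu : measure T R)
    (p : T -> R) (f : T -> \bar R) :
  measurable_fun setT p -> (forall x, 0 <= p x) ->
  (forall A, measurable A -> nu A = \int[m]_(x in A) (p x)%:E)%E ->
  measurable_fun setT f -> (forall x, 0 <= f x)%E ->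
  (\int[nu]_x f x = \int[m]_x (f x * (p x)%:E))%E.
Proof.
move=> mp p0 hnu mf f0.
pose f_ := nnsfun_approx (@measurableT _ T) mf.
have cvf x : (EFin \o f_ ^~ x) n @[n --> \oo] --> f x.
  by apply: cvg_nnsfun_approx => // y _; exact: f0.
have nd x : {homo (fun n => f_ n x) : a b / (a <= b)%N >-> a <= b}.
  by move=> a b ab; exact/lefP/nd_nnsfun_approx.
have mf_ n : measurable_fun setT (fun x => (f_ n x)%:E).
  by apply/measurable_EFinP.
have mp' : measurable_fun setT (fun x => (p x)%:E) by apply/measurable_EFinP.
transitivity (limn (fun n => \int[nu]_x (f_ n x)%:E))%E.
  rewrite -monotone_convergence//=.
  - by apply: eq_integral => x _; apply/esym/cvg_lim => //; exact: cvf.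
  - by move=> n x _; rewrite lee_fin.
  - by move=> x _ a b ab; rewrite lee_fin; exact: nd.
transitivity (limn (fun n => \int[m]_x ((f_ n x)%:E * (p x)%:E)))%E; last first.
  rewrite -monotone_convergence//=.
  - apply: eq_integral => x _; apply/cvg_lim => //.
    apply: cvgeZr => //; exact: cvf.
  - by move=> n; apply: emeasurable_funM.
  - by move=> n x _; rewrite mule_ge0// lee_fin.
  - by move=> x _ a b ab; rewrite lee_wpmul2r// lee_fin//; exact: nd.
congr (limn _); apply/funext => n.
under eq_integral do rewrite fimfunE -fsumEFin//.
rewrite ge0_integral_fsum//; last 2 first.
- by move=> r; apply/measurable_EFinP; do 2 apply/measurableT_comp => //.
- by move=> r x _; rewrite EFinM nnfun_muleindic_ge0.
under [RHS]eq_integral => x _.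
  rewrite fimfunE -fsumEFin// ge0_mule_fsuml; last first.
    by move=> r; rewrite EFinM nnfun_muleindic_ge0.
  over.
rewrite [RHS]ge0_integral_fsum//; last 2 first.
- move=> r; apply: emeasurable_funM => //; apply/measurable_EFinP.
  by do 2 apply/measurableT_comp => //.
- by move=> r x _; rewrite mule_ge0// ?lee_fin// -lee_fin EFinM nnfun_muleindic_ge0.
apply: eq_fsbigr => r rf.
rewrite integralZl_indic_nnsfun// integral_indic// setIT hnu//.
have r0 : 0 <= r.
  by move: rf; rewrite inE => -[x _ <-].
under [RHS]eq_integral do rewrite EFinM -muleA.
rewrite ge0_integralZl//; last 2 first.
- apply: emeasurable_funM => //; apply/measurable_EFinP; exact: measurable_indic.
- by move=> x _; rewrite mule_ge0 ?lee_fin.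
congr (_ * _)%E.
rewrite integral_mkcond; apply: eq_integral => x _.
rewrite patchE indicE; case: ifPn => xr; first by rewrite mul1e.
by rewrite mul0e.
Qed.

End gaussian.

Section gaussian_moments.
Context {R : realType}.
Local Notation mu := (@lebesgue_measure R).

Lemma ge0_integral_law d (T : measurableType d) (P : probability T R)
    (Y : T -> R) (nu : measure (measurableTypeR R) R) (phi : R -> \bar R) :
  measurable_fun setT Y -> (forall A, measurable A -> P (Y @^-1` A) = nu A) ->
  measurable_fun setT phi -> (forall y, 0 <= phi y)%E ->
  (\int[P]_w phi (Y w) = \int[nu]_y phi y)%E.
Proof.
move=> mY hnu mphi phi0.
pose Y' : T -> measurableTypeR R := Y.
have mY' : measurable_fun setT Y' by exact: mY.
pose m1 : measure (measurableTypeR R) R :=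
  measure_function_pushforward__canonical__measure_function_Measure P mY'.
transitivity (\int[m1]_y phi y)%E.
  symmetry.
  have := @ge0_integral_pushforward _ _ _ _ R _ mY' P setT phi measurableT mphi.
  by rewrite preimage_setT; apply => y _.
apply: eq_measure_integral => A mA _.
exact: hnu.
Qed.

Lemma ge0_integral_normal (m s : R) (phi : R -> \bar R) :
  measurable_fun setT phi -> (forall y, 0 <= phi y)%E ->
  (\int[normal_prob m s]_y phi y = \int[mu]_y (phi y * (normal_pdf m s y)%:E))%E.
Proof.
move=> mphi phi0; apply: ge0_integral_density => //.
- exact: measurable_normal_pdf.
- by move=> x; exact: normal_pdf_ge0.
Qed.

(** The exponential of a small multiple of the square only widens the normal
    density: the product is proportional to the density with variance doubled,
    with constant [sqrt 2 <= 2]. *)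
Lemma normal_pdf_widen (m s y : R) : s != 0 ->
  expR ((y - m) ^+ 2 / (4 * s ^+ 2)) * normal_pdf m s y <=
  2 * normal_pdf m (Num.sqrt 2 * s) y.
Proof.
move=> s0; have s20 : Num.sqrt 2 * s != 0.
  by rewrite mulf_neq0// gt_eqF// sqrtr_gt0.
rewrite /normal_pdf (negbTE s0) (negbTE s20) /normal_fun.
have -> : (Num.sqrt 2 * s) ^+ 2 = 2 * s ^+ 2.
  by rewrite exprMn sqr_sqrtr.
rewrite mulrCA -expRD.
have -> : (y - m) ^+ 2 / (4 * s ^+ 2) + - (y - m) ^+ 2 / (s ^+ 2 *+ 2) =
   - (y - m) ^+ 2 / ((2 * s ^+ 2) *+ 2) by field.
rewrite [leRHS]mulrA ler_wpM2r ?expR_ge0//.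
rewrite /normal_peak exprMn sqr_sqrtr//.
have p0 : 0 < s ^+ 2 * pi *+ 2.
  by rewrite mulrn_wgt0// mulr_gt0 ?pi_gt0// exprn_even_gt0.
have -> : 2 * s ^+ 2 * pi *+ 2 = 2 * (s ^+ 2 * pi *+ 2) by ring.
rewrite sqrtrM// invfM mulrA ler_peMl ?invr_ge0 ?sqrtr_ge0//.
rewrite ler_pdivlMr ?sqrtr_gt0// mul1r.
rewrite -[leRHS]ger0_norm// -sqrtr_sqr ler_sqrt//; lra.
Qed.

Lemma integral_normal_widen (m s : R) : s != 0 ->
  (\int[mu]_y (expR ((y - m) ^+ 2 / (4 * s ^+ 2)) * normal_pdf m s y)%:E <= 2%:E)%E.
Proof.
move=> s0.
apply: (@le_trans _ _ (\int[mu]_y (2%:E * (normal_pdf m (Num.sqrt 2 * s) y)%:E))%E).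
  apply: ge0_le_integral => //.
  - by move=> y _; rewrite lee_fin mulr_ge0 ?expR_ge0 ?normal_pdf_ge0.
  - apply/measurable_EFinP; apply: measurable_funM; last exact: measurable_normal_pdf.
    apply: measurableT_comp; first exact: measurable_expR.
    by apply: measurable_funM => //; apply: measurable_funX; apply: measurable_funB.
  - apply: emeasurable_funM => //; apply/measurable_EFinP; exact: measurable_normal_pdf.
  - by move=> y _; rewrite -EFinM lee_fin normal_pdf_widen.
rewrite ge0_integralZl//.
- by rewrite integral_normal_pdf mule1.
- by apply/measurable_EFinP; exact: measurable_normal_pdf.
- by move=> y _; rewrite lee_fin normal_pdf_ge0.
Qed.

(** A density bounded by its peak cannot put most of its mass near 0 unless
    the peak is high: the mass outside [[- 2 r, 2 r]], where [r ^ 2 = q], is at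
    most 1/4 by Chebyshev, hence [3/4 <= 4 r peak] bounds [s]. The mean is
    then controlled through [m ^ 2 <= 2 y ^ 2 + 2 (y - m) ^ 2], where the second
    square is at most a multiple of its exponential. *)
Lemma normal_second_moment_bound (m s q : R) : s != 0 -> 0 < q ->
  (\int[mu]_y ((y ^+ 2)%:E * (normal_pdf m s y)%:E) = q%:E)%E ->
  s ^+ 2 <= 8 * q /\ m ^+ 2 <= 130 * q.
Proof.
move=> s0 q0 hq.
pose f y := normal_pdf m s y.
have mf : measurable_fun setT f by exact: measurable_normal_pdf.
have f0 y : 0 <= f y by exact: normal_pdf_ge0.
have my2 : measurable_fun [set: R] (fun y : R => (y ^+ 2)%:E).
  by apply/measurable_EFinP; apply: measurable_funX.
have mfE : measurable_fun [set: R] (fun y : R => (f y)%:E) by apply/measurable_EFinP.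
have my2f : measurable_fun [set: R] (fun y : R => ((y ^+ 2)%:E * (f y)%:E)%E).
  by apply: emeasurable_funM.
have y2f0 y : (0 <= (y ^+ 2)%:E * (f y)%:E)%E by rewrite -EFinM lee_fin mulr_ge0// sqr_ge0.
have s2 : s ^+ 2 <= 8 * q.
  pose r := Num.sqrt q; have r0 : 0 < r by rewrite sqrtr_gt0.
  have rq : r ^+ 2 = q by rewrite sqr_sqrtr// ltW.
  pose D : set R := `[- (2 * r), 2 * r]%classic.
  have mD : measurable D by exact: measurable_itv.
  have mDE : measurable_fun [set: R] (EFin \o (\1_D : R -> R)).
    by apply/measurable_EFinP; exact: measurable_indic.
  pose pk := normal_peak s.
  have pk0 : 0 < pk by apply: normal_peak_gt0.
  have I1 : (\int[mu]_y (f y)%:E <= (pk * (4 * r) + 4^-1)%:E)%E.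
    apply: (@le_trans _ _ (\int[mu]_y (pk%:E * (\1_D y)%:E +
        (4 * q)^-1%:E * ((y ^+ 2)%:E * (f y)%:E)))%E).
      apply: ge0_le_integral => //.
      - by move=> y _; rewrite lee_fin.
      - by apply: emeasurable_funD; apply: emeasurable_funM.
      - move=> y _; rewrite -!EFinM -EFinD lee_fin indicE.
        case: (boolP (y \in D)) => yD /=.
          rewrite mulr1; apply: (@le_trans _ _ pk); first exact: normal_pdf_ub.
          rewrite lerDl; apply: mulr_ge0; first by rewrite invr_ge0; lra.
          exact: mulr_ge0 (sqr_ge0 y) (f0 y).
        rewrite mulr0 add0r mulrA ler_peMl// mulrC ler_pdivlMr ?mulr_gt0// mul1r.
        have : ~ (- (2 * r) <= y <= 2 * r).
          by move: yD; rewrite notin_setE /D/= in_itv/=.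
        move=> /negP; rewrite -ler_norml -ltNge => h.
        rewrite -rq -[4 * _](_ : (2 * r) ^+ 2 = _); last by ring.
        rewrite -[leRHS]real_normK ?num_real// lerXn2r ?nnegrE ?mulr_ge0//; exact: ltW.
    rewrite ge0_integralD//; last 4 first.
    - by move=> y _; rewrite mule_ge0// lee_fin// ltW.
    - by apply: emeasurable_funM.
    - by move=> y _; rewrite mule_ge0// lee_fin invr_ge0; lra.
    - by apply: emeasurable_funM.
    have -> : (\int[mu]_x (pk%:E * (\1_D x)%:E) = pk%:E * mu D)%E.
      rewrite -integral_cst// integral_mkcond; apply: eq_integral => x _.
      by rewrite patchE indicE; case: ifPn => _; rewrite ?mule1 ?mule0.
    rewrite ge0_integralZl//; last by rewrite lee_fin invr_ge0; lra.
    rewrite hq /D lebesgue_measure_itv/= lte_fin ifT; last lra.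
    rewrite -EFinB -!EFinM -EFinD lee_fin lerD//.
      by rewrite ler_pM2l//; lra.
    by rewrite invfM mulfVK// gt_eqF.
  have : 1 <= pk * (4 * r) + 4^-1.
    by move: I1; rewrite /f integral_normal_pdf lee_fin.
  rewrite /pk /normal_peak => H.
  have p0 : 0 < s ^+ 2 * pi *+ 2.
    by rewrite mulrn_wgt0// mulr_gt0 ?pi_gt0// exprn_even_gt0.
  have H2 : 3 * Num.sqrt (s ^+ 2 * pi *+ 2) <= 16 * r.
    have : 3 / 4 <= (Num.sqrt (s ^+ 2 * pi *+ 2))^-1 * (4 * r) by lra.
    rewrite [_^-1 * _]mulrC ler_pdivlMr ?sqrtr_gt0//; lra.
  have H3 : 9 * (s ^+ 2 * pi *+ 2) <= 256 * q.
    have := @lerXn2r R 2 (3 * Num.sqrt (s ^+ 2 * pi *+ 2)) (16 * r).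
    rewrite !nnegrE => /(_ _ _ H2); rewrite !exprMn rq sqr_sqrtr ?(ltW p0)// => h.
    have := h (mulr_ge0 (ler0n _ 3) (sqrtr_ge0 _)) (mulr_ge0 (ler0n _ 16) (ltW r0)).
    by rewrite -!natrX.
  have H4 : s ^+ 2 * 4 <= s ^+ 2 * pi *+ 2.
    have := @pi_ge2 R; have := sqr_ge0 s.
    move: (s ^+ 2) (pi : R) => u v u0 v2.
    have : u * 2 <= u * v by rewrite ler_wpM2l.
    by rewrite -mulr_natr; lra.
  lra.
split => //.
have mE : measurable_fun [set: R] (fun y => (expR ((y - m) ^+ 2 / (4 * s ^+ 2)) * f y)%:E).
  apply/measurable_EFinP; apply: measurable_funM => //.
  apply: measurableT_comp; first exact: measurable_expR.
  by apply: measurable_funM => //; apply: measurable_funX; apply: measurable_funB.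
have E0 y : (0 <= (expR ((y - m) ^+ 2 / (4 * s ^+ 2)) * f y)%:E)%E.
  by rewrite lee_fin mulr_ge0 ?expR_ge0.
have s20 : 0 < s ^+ 2 by rewrite exprn_even_gt0.
have I2 : (\int[mu]_y ((m ^+ 2)%:E * (f y)%:E) <= (2 * q + 8 * s ^+ 2 * 2)%:E)%E.
  apply: (@le_trans _ _ (\int[mu]_y (2%:E * ((y ^+ 2)%:E * (f y)%:E) +
     (8 * s ^+ 2)%:E * (expR ((y - m) ^+ 2 / (4 * s ^+ 2)) * f y)%:E))%E).
    apply: ge0_le_integral => //.
    - by move=> y _; rewrite mule_ge0// lee_fin// sqr_ge0.
    - by apply: emeasurable_funM.
    - by apply: emeasurable_funD; apply: emeasurable_funM.
    - move=> y _; rewrite -!EFinM -EFinD lee_fin.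
      set E := expR _.
      have -> : 2 * (y ^+ 2 * f y) + 8 * s ^+ 2 * (E * f y) =
          (2 * y ^+ 2 + 8 * s ^+ 2 * E) * f y by ring.
      rewrite ler_wpM2r// /E.
      apply: (@le_trans _ _ (2 * y ^+ 2 + 2 * (y - m) ^+ 2)).
        by rewrite -subr_ge0 (_ : _ - _ = (2 * y - m) ^+ 2) ?sqr_ge0//; ring.
      rewrite lerD2l; have := expR_ge1Dx ((y - m) ^+ 2 / (4 * s ^+ 2)).
      have := sqr_ge0 (y - m); move: ((y - m) ^+ 2) => z z0 h.
      rewrite [leLHS](_ : _ = 8 * s ^+ 2 * (z / (4 * s ^+ 2))); last by field.
      by apply: ler_wpM2l; lra.
  rewrite ge0_integralD//; last 4 first.
  - by move=> y _; rewrite mule_ge0.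
  - by apply: emeasurable_funM.
  - by move=> y _; rewrite mule_ge0// lee_fin; lra.
  - by apply: emeasurable_funM.
  rewrite ge0_integralZl// hq -EFinM EFinD leeD2l//.
  rewrite ge0_integralZl//; last by rewrite lee_fin; lra.
  rewrite [X in (_ <= X)%E]EFinM; apply: lee_wpmul2l; first by rewrite lee_fin; lra.
  exact: integral_normal_widen.
rewrite ge0_integralZl// in I2; last 2 first.
- by move=> y _; rewrite lee_fin.
- by rewrite lee_fin sqr_ge0.
rewrite /f integral_normal_pdf mule1 lee_fin in I2.
lra.
Qed.

(** In the degenerate case the variable is constant. Otherwise
    [y ^ 2 <= 2 (y - m) ^ 2 + 2 m ^ 2]; the bound on [m] gives the factor
    [expR 5] and the bound on [s] makes the remaining exponent at most
    [(y - m) ^ 2 / (4 s ^ 2)], which [integral_normal_widen] integrates. *)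
Lemma gaussian_exp_square_moment d (T : measurableType d) (P : probability T R)
    (Y : T -> R) (q : R) :
  measurable_fun setT Y -> gaussian_rv P Y -> 0 < q ->
  (\int[P]_w ((Y w) ^+ 2)%:E = q%:E)%E ->
  (\int[P]_w (expR (64^-1 * (Y w) ^+ 2 / q))%:E <= (2 * expR 5)%:E)%E.
Proof.
move=> mY [m [s hY]] q0 hq.
have my2 : measurable_fun [set: R] (fun y : R => (y ^+ 2)%:E).
  by apply/measurable_EFinP; apply: measurable_funX.
have y20 (y : R) : (0 <= (y ^+ 2)%:E)%E by rewrite lee_fin sqr_ge0.
have mex : measurable_fun [set: R] (fun y : R => (expR (64^-1 * y ^+ 2 / q))%:E).
  apply/measurable_EFinP; apply: measurableT_comp; first exact: measurable_expR.
  by apply: measurable_funM => //; apply: measurable_funM => //; apply: measurable_funX.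
have ex0 (y : R) : (0 <= (expR (64^-1 * y ^+ 2 / q))%:E)%E by rewrite lee_fin expR_ge0.
have [s0|s0] := eqVneq s 0.
  rewrite s0 eqxx in hY.
  have hY' A : measurable A -> P (Y @^-1` A) = @dirac _ (measurableTypeR R) m R A.
    exact: hY.
  rewrite (ge0_integral_law mY hY' my2 y20) integral_dirac// diracT mul1e in hq.
  rewrite (ge0_integral_law mY hY' mex ex0) integral_dirac// diracT mul1e.
  case: hq => ->; rewrite lee_fin mulfK ?gt_eqF//.
  have h1 : expR 64^-1 <= expR 5 :> R by rewrite ler_expR; lra.
  have h2 := expR_gt0 (5 : R); lra.
rewrite (negbTE s0) in hY.
have hY' A : measurable A -> P (Y @^-1` A) = normal_prob m s A by exact: hY.
rewrite (ge0_integral_law mY hY' my2 y20) ge0_integral_normal// in hq.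
rewrite (ge0_integral_law mY hY' mex ex0) ge0_integral_normal//.
have [hs hm] := normal_second_moment_bound s0 q0 hq.
have s20 : 0 < s ^+ 2 by rewrite exprn_even_gt0.
have mE : measurable_fun [set: R]
    (fun y => (expR ((y - m) ^+ 2 / (4 * s ^+ 2)) * normal_pdf m s y)%:E).
  apply/measurable_EFinP; apply: measurable_funM; last exact: measurable_normal_pdf.
  apply: measurableT_comp; first exact: measurable_expR.
  by apply: measurable_funM => //; apply: measurable_funX; apply: measurable_funB.
apply: (@le_trans _ _ (\int[mu]_y ((expR 5)%:E *
    (expR ((y - m) ^+ 2 / (4 * s ^+ 2)) * normal_pdf m s y)%:E))%E).
  apply: ge0_le_integral => //.
  - by move=> y _; rewrite mule_ge0// lee_fin normal_pdf_ge0.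
  - by apply: emeasurable_funM => //; apply/measurable_EFinP; exact: measurable_normal_pdf.
  - by apply: emeasurable_funM.
  - move=> y _; rewrite -!EFinM lee_fin [leRHS]mulrA ler_wpM2r ?normal_pdf_ge0//.
    rewrite -expRD ler_expR.
    have h1 : y ^+ 2 <= 2 * (y - m) ^+ 2 + 2 * m ^+ 2.
      by rewrite -subr_ge0 (_ : _ - _ = (y - 2 * m) ^+ 2) ?sqr_ge0//; ring.
    have h2 : (y - m) ^+ 2 / q <= 8 * ((y - m) ^+ 2 / s ^+ 2).
      rewrite mulrCA ler_wpM2l ?sqr_ge0// ler_pdivlMr// mulrC ler_pdivrMr//.
    have h3 : m ^+ 2 / q <= 130 by rewrite ler_pdivrMr.
    have h4 : y ^+ 2 / q <= (2 * (y - m) ^+ 2 + 2 * m ^+ 2) / q by rewrite ler_pM2r ?invr_gt0.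
    rewrite mulrDl -!mulrA in h4.
    have -> : (y - m) ^+ 2 / (4 * s ^+ 2) = 4^-1 * ((y - m) ^+ 2 / s ^+ 2).
      by field.
    rewrite -mulrA; lra.
rewrite ge0_integralZl//.
- rewrite [2 * _]mulrC [X in (_ <= X)%E]EFinM; apply: lee_wpmul2l.
    by rewrite lee_fin expR_ge0.
  exact: integral_normal_widen.
- by move=> y _; rewrite lee_fin mulr_ge0 ?expR_ge0 ?normal_pdf_ge0.
Qed.

End gaussian_moments.

(** * Increments of fractional Brownian motion on dyadic grids *)

Section fbm_growth.
Context {R : realType}.

Lemma fbm_increment_second_moment d (T : measurableType d) (P : probability T R)
    (H : R) (B : R -> T -> R) (s t : R) :
  0 < H -> is_fbm P H B -> 0 <= s -> 0 <= t ->
  (\int[P]_w ((B t w - B s w) ^+ 2)%:E = (`|t - s| `^ (2 * H))%:E)%E.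
Proof.
move=> H0 [mB _ _ cB _ _] s0 t0.
have ms := mB s s0; have mt := mB t t0.
have E u v : 0 <= u -> 0 <= v -> (\int[P]_w (B v w * B u w)%:E =
    (2^-1 * (u `^ (2 * H) + v `^ (2 * H) - `|v - u| `^ (2 * H)))%:E)%E.
  by move=> u0 v0; have := cB u v u0 v0; rewrite unlock.
have sq u : 0 <= u -> P.-integrable setT (EFin \o (fun w => B u w * B u w)) /\
    \int[P]_w (B u w * B u w) = u `^ (2 * H).
  move=> u0; apply: ge0_integral_EFin_val => //.
  - by apply: measurable_funM; exact: mB.
  - by move=> w _; rewrite -expr2 sqr_ge0.
  - rewrite E// subrr normr0 powR0 ?subr0; last by rewrite mulf_neq0// gt_eqF.
    by congr EFin; lra.
have [js es] := sq s s0; have [jt et] := sq t t0.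
have its : P.-integrable setT (EFin \o (fun w => B t w * B s w)).
  apply: (integrable_le_bound measurableT _ (integrable_add measurableT jt js)).
    exact: measurable_funM.
  move=> w _; rewrite ler_norml; apply/andP; split.
    by have := sqr_ge0 (B t w + B s w); have := sqr_ge0 (B t w);
       have := sqr_ge0 (B s w); rewrite !expr2; lra.
  by have := sqr_ge0 (B t w - B s w); have := sqr_ge0 (B t w);
       have := sqr_ge0 (B s w); rewrite !expr2; lra.
have i2 := integrable_scale (-2) measurableT its.
have i3 := integrable_add measurableT (integrable_add measurableT jt js) i2.
have e3 : (fun w => (B t w - B s w) ^+ 2) =
    (fun w => (B t w * B t w + B s w * B s w) + -2 * (B t w * B s w)).
  by apply/funext => w; ring.
rewrite -(@fineK _ (\int[P]_w ((B t w - B s w) ^+ 2)%:E)%E); last first.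
  apply: integrable_fin_num => //.
  by rewrite -[X in _.-integrable _ X]/(EFin \o (fun w => (B t w - B s w) ^+ 2)) e3.
congr EFin; rewrite -[LHS]/(\int[P]_w ((B t w - B s w) ^+ 2)) e3.
rewrite (RintegralD measurableT (integrable_add measurableT jt js) i2).
rewrite (RintegralD measurableT jt js) (RintegralZl _ measurableT its) es et.
rewrite {1}/Rintegral E//= ; lra.
Qed.

Lemma fbm_increment_exp_moment d (T : measurableType d) (P : probability T R)
    (H : R) (B : R -> T -> R) (s t : R) :
  0 < H -> is_fbm P H B -> 0 <= s -> 0 <= t ->
  (\int[P]_w (expR (64^-1 * (B t w - B s w) ^+ 2 / `|t - s| `^ (2 * H)))%:E <=
   (2 * expR 5)%:E)%E.
Proof.
move=> H0 hB s0 t0; have [<-|st] := eqVneq s t.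
  rewrite (eq_integral (cst 1%E)); last first.
    by move=> w _; rewrite subrr expr0n mulr0 mul0r expR0.
  rewrite integral_cst// mul1e; apply: le_trans (probability_le1 P measurableT) _.
  rewrite lee_fin; have := expR_gt0 (5 : R).
  have : 1 <= expR 5 :> R by rewrite -[leLHS]expR0 ler_expR.
  lra.
have q0 : 0 < `|t - s| `^ (2 * H) by rewrite powR_gt0// normr_gt0 subr_eq0 eq_sym.
apply: gaussian_exp_square_moment => //.
- by apply: measurable_funB; exact: (fbm_measurable hB).
- have := @fbm_gaussian _ _ _ _ _ _ hB 2 (fun i => if i == 0 :> 'I_2 then 1 else -1)
    (fun i => if i == 0 :> 'I_2 then t else s).
  rewrite (_ : (fun w => \sum_(i < 2) _) = (fun w => B t w - B s w)); last first.
    by apply/funext => w; rewrite big_ord_recl big_ord1/= mul1r mulN1r.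
  by apply => i; case: ifP.
- exact: fbm_increment_second_moment.
Qed.

(** Grid points of level [l] up to the time [2 ^ l]: the horizon grows with the
    level. Pairs at distance 0 contribute [expR 0]. *)
Definition grid_exp_sum d (T : measurableType d) (H : R) (B : R -> T -> R) (l : nat) (w : T) : R :=
  \sum_(i < (4 ^ l).+1) \sum_(j < (4 ^ l).+1)
    expR (64^-1 * (B (dyadic R l j) w - B (dyadic R l i) w) ^+ 2 /
          `|dyadic R l j - dyadic R l i| `^ (2 * H)).

Lemma dyadic_ge0 l i : 0 <= dyadic R l i.
Proof. by rewrite divr_ge0// exprn_ge0. Qed.

(** One random constant for all levels and horizons. The grid of level [l] has
    of the order of [16 ^ l] pairs, so the sum of the exponentials weighted by
    [32 ^ (- l)] has a finite mean; its logarithm [V] therefore has all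
    moments. Each single exponential is at most [32 ^ l expR V], and taking
    logarithms bounds the squared increment by [l + V] up to constants. *)
Lemma fbm_dyadic_growth d (T : measurableType d) (P : probability T R)
    (H : R) (B : R -> T -> R) :
  0 < H -> is_fbm P H B ->
  exists (V : {mfun T >-> R}) (C : R), 0 <= C /\
   [/\ forall w, 1 <= V w,
     forall k : nat, P.-integrable setT (EFin \o (fun w => V w ^+ k)) &
     {ae P, forall w, forall l i j : nat, (i <= 4 ^ l)%N -> (j <= 4 ^ l)%N ->
       (B (dyadic R l j) w - B (dyadic R l i) w) ^+ 2 <=
       C * l.+1%:R * V w ^+ 2 * `|dyadic R l j - dyadic R l i| `^ (2 * H)}].
Proof.
move=> H0 hB.
pose G := grid_exp_sum H B.
have G0 l w : 0 <= G l w by do 2 apply: sumr_ge0 => ? _; exact: expR_ge0.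
have mt l i j : measurable_fun setT (fun w : T =>
    expR (64^-1 * (B (dyadic R l j) w - B (dyadic R l i) w) ^+ 2 /
          `|dyadic R l j - dyadic R l i| `^ (2 * H))).
  apply: measurableT_comp; first exact: measurable_expR.
  apply: measurable_funM => //; apply: measurable_funM => //; apply: measurable_funX.
  by apply: measurable_funB; apply: (fbm_measurable hB); exact: dyadic_ge0.
have mG l : measurable_fun setT (G l).
  by do 2 apply: measurable_sum => ?; exact: mt.
have iG l : (\int[P]_w (G l w)%:E <= ((4 ^ l).+1%:R * ((4 ^ l).+1%:R * (2 * expR 5)))%:E)%E.
  under eq_integral do rewrite /G /grid_exp_sum -sumEFin.
  rewrite ge0_integral_sum//; last 2 first.
  - move=> i; apply/measurable_EFinP; apply: measurable_sum => j; exact: mt.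
  - by move=> i w _; rewrite lee_fin; apply: sumr_ge0 => j _; exact: expR_ge0.
  apply: (@le_trans _ _ (\sum_(i < (4 ^ l).+1) ((4 ^ l).+1%:R * (2 * expR 5))%:E)%E); last first.
    by rewrite sumEFin lee_fin sumr_const card_ord -[_ *+ (4 ^ l).+1]mulr_natl.
  apply: lee_sum => i _.
  under eq_integral do rewrite -sumEFin.
  rewrite ge0_integral_sum//; last by move=> j; apply/measurable_EFinP; exact: mt.
  apply: (@le_trans _ _ (\sum_(j < (4 ^ l).+1) (2 * expR 5)%:E)%E); last first.
    by rewrite sumEFin lee_fin sumr_const card_ord -[_ *+ (4 ^ l).+1]mulr_natl.
  apply: lee_sum => j _; apply: fbm_increment_exp_moment => //; exact: dyadic_ge0.
pose u l w : \bar R := ((32 ^+ l)^-1 * G l w)%:E.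
have u0 l w : (0 <= u l w)%E by rewrite lee_fin mulr_ge0// invr_ge0 exprn_ge0.
have mu_ l : measurable_fun setT (u l).
  have : measurable_fun setT (EFin \o (fun w => (32 ^+ l)^-1 * G l w)).
    by apply/measurable_EFinP; apply: measurable_funM.
  by [].
pose S w : \bar R := (\sum_(l <oo) u l w)%E.
have S0 w : (0 <= S w)%E by apply: nneseries_ge0.
have mS : measurable_fun setT S.
  exact: ge0_emeasurable_sum.
have iu l : (\int[P]_w u l w <= (8 * expR 5 * 2^-1 ^+ l)%:E)%E.
  rewrite /u; under eq_integral do rewrite EFinM.
  rewrite ge0_integralZl//; last 2 first.
  - have : measurable_fun setT (EFin \o G l) by apply/measurable_EFinP.
    by [].
  - by move=> w _; rewrite lee_fin.
  apply: (@le_trans _ _ ((32 ^+ l)^-1%:E * ((4 ^ l).+1%:R * ((4 ^ l).+1%:R * (2 * expR 5)))%:E)%E).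
    by apply: lee_wpmul2l => //; rewrite lee_fin invr_ge0 exprn_ge0.
  rewrite -EFinM lee_fin mulrC ler_pdivrMr ?exprn_gt0//.
  have e5 := expR_gt0 (5 : R).
  have f1 : (4 ^ l).+1%:R <= 2 * 4 ^+ l :> R.
    by rewrite -natr1 natrX mulrDl mul1r lerD2l exprn_ege1// ler1n.
  have f0 : 0 <= (4 ^ l).+1%:R :> R by [].
  have -> : 8 * expR 5 * 2^-1 ^+ l * 32 ^+ l = (2 * 4 ^+ l) * ((2 * 4 ^+ l) * (2 * expR 5)) :> R.
    have -> : 32 ^+ l = 2 ^+ l * (4 ^+ l * 4 ^+ l) :> R by rewrite -!exprMn; congr (_ ^+ _); lra.
    rewrite exprVn; field; by rewrite expf_neq0.
  have e50 : 0 <= 2 * expR 5 :> R by lra.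
  apply: (ler_pM f0 _ f1); first exact: mulr_ge0.
  exact: ler_wpM2r.
have iS : (\int[P]_w S w < +oo)%E.
  rewrite /S integral_nneseries//.
  apply: (@le_lt_trans _ _ (8 * expR 5 * 2)%:E); last exact: ltry.
  apply: lime_le.
    by apply: is_cvg_nneseries => l _ _; apply: integral_ge0 => w _; exact: u0.
  apply: nearW => n; apply: (@le_trans _ _ (\sum_(0 <= l < n) (8 * expR 5 * 2^-1 ^+ l)%:E)%E).
    by apply: lee_sum => l _; exact: iu.
  rewrite sumEFin lee_fin -mulr_sumr big_mkord.
  apply: ler_wpM2l; first by have := expR_gt0 (5 : R); lra.
  apply: le_trans (geometric_partial_sum _ _) _; first by apply/andP; split; lra.
  by rewrite (_ : 1 - 2^-1 = 2^-1) ?invrK//; lra.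
have jS : P.-integrable setT S.
  apply/integrableP; split => //.
  by under eq_integral do rewrite gee0_abs//.
pose fS w := fine (S w).
have mfS : measurable_fun setT fS by apply: measurableT_comp.
have fS0 w : 0 <= fS w by rewrite fine_ge0.
have jfS : P.-integrable setT (EFin \o fS).
  apply: (le_integrable measurableT _ _ jS); first by apply/measurable_EFinP.
  by move=> w _; rewrite /fS/=; case: (S w) => [r||] //=; rewrite normr0 leey.
pose V0 w := 1 + ln (1 + fS w).
have mV0 : measurable_fun setT V0.
  apply: measurable_funD => //; apply: measurableT_comp; first exact: measurable_ln.
  exact: measurable_funD.
pose V : {mfun T >-> R} := HB.pack V0 (isMeasurableFun.Build _ _ _ _ _ mV0).
have V1 w : 1 <= V w by rewrite /= /V0 lerDl ln_ge0// lerDl.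
have eV w : expR (V w) = expR 1 * (1 + fS w).
  by rewrite /= /V0 expRD lnK// posrE ltr_pwDl.
(* 64 inverts the factor in the exponent, 32 is the weight of the levels *)
exists V, (64 * (1 + ln 32)); split.
  by rewrite mulr_ge0// addr_ge0// ln_ge0// ler1n.
split => //.
- move=> k.
  have j1 := integrable_scale (k%:R ^+ k * expR 1) measurableT
    (integrable_add measurableT (finite_measure_integrable_cst P 1 measurableT) jfS).
  apply: (integrable_le_bound measurableT _ j1).
    by apply: measurable_funX; exact: mV0.
  move=> w _; have Vw := V1 w; have V0w : 0 <= V w by lra.
  rewrite ger0_norm ?exprn_ge0// -mulrA -eV.
  case: k {j1} => [|k]; first by rewrite !expr0 mul1r -expR0 ler_expR.
  have h : V w <= k.+1%:R * expR (V w / k.+1%:R).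
    by rewrite mulrC -ler_pdivrMr//; apply: le_trans (expR_ge1Dx _); rewrite lerDr.
  have := @lerXn2r R k.+1 (V w) (k.+1%:R * expR (V w / k.+1%:R)).
  rewrite !nnegrE => /(_ V0w (mulr_ge0 (ler0n _ _) (expR_ge0 _)) h).
  by rewrite exprMn -expRM_natr divfK.
- have := integrable_ae measurableT jS; apply: filterS => w /(_ I) Sw l i j il jl.
  have K0 : 0 <= ln 32 :> R by rewrite ln_ge0// ler1n.
  set D := B _ w - B _ w; set q := `|_| `^ _.
  have Vw := V1 w; have V2 : 1 <= V w ^+ 2 by rewrite exprn_ege1.
  have q0 : 0 <= q by exact: powR_ge0.
  have [qz|qnz] := eqVneq q 0.
    have /normr0_eq0 := powR_eq0_eq0 qz => /subr0_eq e.
    by rewrite /D e subrr expr0n qz mulr0.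
  have ql : 0 < q by rewrite lt_def qnz.
  have eG : expR (64^-1 * D ^+ 2 / q) <= G l w.
    have il' : (i < (4 ^ l).+1)%N by []. have jl' : (j < (4 ^ l).+1)%N by [].
    rewrite /G /grid_exp_sum (bigD1 (Ordinal il'))//= (bigD1 (Ordinal jl'))//=.
    rewrite -addrA lerDl addr_ge0// sumr_ge0// => ? _; rewrite ?expR_ge0//.
    by apply: sumr_ge0 => ? _; exact: expR_ge0.
  have uS : (32 ^+ l)^-1 * G l w <= fS w.
    rewrite -lee_fin /fS fineK// -/(u l w).
    apply: (@le_trans _ _ (\sum_(0 <= m < l.+1) u m w)%E).
      by rewrite big_nat_recr//= leeDr// sume_ge0.
    exact: nneseries_lim_ge.
  rewrite mulrC ler_pdivrMr ?exprn_gt0// in uS.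
  have ez : expR (64^-1 * D ^+ 2 / q) <= expR (l%:R * ln 32 + (V w - 1)).
    rewrite expRD expRM_natl lnK ?posrE// /= /V0 addrAC subrr add0r lnK ?posrE ?ltr_pwDl//.
    apply: (le_trans eG); apply: (le_trans uS); rewrite mulrC ler_wpM2l ?exprn_ge0//.
    by rewrite lerDr.
  rewrite ler_expR ler_pdivrMr// in ez.
  have : l%:R * ln 32 + (V w - 1) <= l.+1%:R * (1 + ln 32) * V w ^+ 2.
    have vv : V w <= V w ^+ 2 by rewrite expr2 ler_peMl//; lra.
    have l0 : 0 <= l%:R :> R by [].
    apply: (@le_trans _ _ ((l%:R * ln 32 + 1) * V w ^+ 2)).
      rewrite mulrDl mul1r lerD//; last lra.
      by rewrite ler_peMr// mulr_ge0.
    apply: ler_wpM2r; first lra.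
    have -> : l.+1%:R * (1 + ln 32) = l%:R * ln 32 + 1 + (l%:R + ln 32) :> R.
      by rewrite -natr1; ring.
    lra.
  move=> h.
  have := le_trans ez (ler_wpM2r q0 h) => h2.
  rewrite [leRHS](_ : _ = 64 * (l.+1%:R * (1 + ln 32) * V w ^+ 2 * q)); last by ring.
  lra.
Qed.

End fbm_growth.

(** * Size of the driving noise along a path *)

Section estimator_paths.
Context {R : realType}.
Local Notation mu := (@lebesgue_measure R).
Implicit Types (al theta L C be H x y s t u V : R) (f : R -> R) (k m n : nat).

Lemma locally_hoelder_ge0 (l : R) (f : R -> R) t : 0 < t -> locally_hoelder l f ->
  exists C, 0 <= C /\
    forall s u, 0 <= s <= t -> 0 <= u <= t -> `|f s - f u| <= C * `|s - u| `^ l.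
Proof.
move=> t0 /(_ t t0)[C hC]; exists `|C|; split => // s u sP uP.
apply: le_trans (hC u s uP sP) _; apply: ler_wpM2r; first exact: powR_ge0.
exact: ler_norm.
Qed.

Lemma sde_block_cvg al (l : R) theta (a b x B : R -> R) L m k :
  0 < al < 2^-1 -> 1 - al < l -> l <= 1 -> 0 <= L -> coef_lipschitz a b L ->
  {within `[0, +oo[, continuous x} -> {within `[0, +oo[, continuous B} ->
  locally_hoelder l x -> locally_hoelder l B ->
  (forall t, 0 < t -> gls_integrable al 0 t (b \o x) B /\
    (x t)%:C%C = (x 0 + theta * \int[mu]_(s in `[0, t]) a (x s))%:C%C +
      gls_integral al 0 t (b \o x) B) ->
  block (dterm theta (gls_constant al) a b x B) m k p @[p --> \oo] --> dincr x m k.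
Proof.
move=> alP all l1 L0 lip cx cB hx hB eqs; apply: block_cvg => t t0.
have [C1 [C10 h1]] := locally_hoelder_ge0 t0 hx.
have [C2 [C20 h2]] := locally_hoelder_ge0 t0 hB.
have [gi eq] := eqs t t0.
have sub : (`[0%R, t] `<=` `[(0 : R), +oo[)%classic.
  by move=> s /=; rewrite !in_itv/= => /andP[->].
have meas f : {within `[0, +oo[, continuous f} -> measurable_fun `[0, t] (f : R -> R).
  move=> cf; apply: subspace_continuous_measurable_fun; first exact: (@measurable_itvR _ _).
  exact: (continuous_subspaceW sub).
apply: (@sde_path_euler _ al l t theta a b x B (Num.max C1 C2) L) => //.
- by rewrite le_max C10.
- exact: meas.
- exact: meas.
- move=> s u sP uP; apply: le_trans (h1 s u sP uP) _.
  by apply: ler_wpM2r; rewrite ?powR_ge0// le_max lexx.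
- move=> s u sP uP; apply: le_trans (h2 s u sP uP) _.
  by apply: ler_wpM2r; rewrite ?powR_ge0// le_max lexx orbT.
Qed.

(** Otherwise the intermediate value theorem would give a zero. *)
Lemma nonvanishing_same_sign (f : R -> R) x y :
  continuous f -> (forall z, f z != 0) -> 0 < f x * f y.
Proof.
move=> cf f0.
wlog xy : x y / x <= y.
  by move=> h; have [/h//|/ltW/h] := leP x y; rewrite mulrC.
rewrite lt_neqAle eq_sym mulf_neq0//= leNgt; apply/negP => neg.
have mm : Num.min (f x) (f y) <= 0 <= Num.max (f x) (f y).
  rewrite ge_min le_max; have := f0 x; rewrite neq_lt => /orP[fx|fx].
    have fy : 0 <= f y.
      by rewrite leNgt; apply/negP => fy; move: neg; rewrite ltNge nmulr_rge0// (ltW fy).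
    by rewrite (ltW fx) fy orbT.
  have fy : f y <= 0.
    by rewrite leNgt; apply/negP => fy; move: neg; rewrite ltNge pmulr_rge0// (ltW fy).
  by rewrite (ltW fx) fy orbT.
have [c _ /eqP] := @IVT _ f x y 0 xy (@continuous_subspaceT _ _ _ f cf) mm.
by rewrite (negPf (f0 c)).
Qed.

(** [l s ^ l] is at most the sum of the first [l] powers of [s]. *)
Lemma linear_geometric_bound (s : R) (l : nat) : 0 <= s < 1 ->
  l.+2%:R * s ^+ l <= 2 + (1 - s)^-1.
Proof.
move=> /andP[s0 s1]; rewrite -addn2 natrD mulrDl addrC; apply: lerD.
  by rewrite ler_piMr// exprn_ile1// ltW.
apply: le_trans (geometric_partial_sum l _); last by rewrite s0.
rewrite mulr_natl -[X in s ^+ l *+ X]card_ord -sumr_const; apply: ler_sum => i _.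
by apply: ler_wiXn2l; [|exact: ltW|exact: ltnW].
Qed.

(** A cell of level [l] inside [[0, 2 ^ n]] is a pair of grid points of level
    [n + l], so the growth bound gives [sqrt (n + l + 1) V 2 ^ (- H l)]. The
    gap between [be] and [H] absorbs [sqrt (l + 2)], leaving [sqrt n]. *)
Lemma driving_bound theta kap be H C : 0 <= C -> 0 < be < H -> be < 1 ->
  exists A : R, 1 <= A /\ forall (B : R -> R) (V : R) n, 1 <= V -> (1 <= n)%N ->
  (forall l i j, (i <= 4 ^ l)%N -> (j <= 4 ^ l)%N ->
    (B (dyadic R l j) - B (dyadic R l i)) ^+ 2 <=
      C * l.+1%:R * V ^+ 2 * `|dyadic R l j - dyadic R l i| `^ (2 * H)) ->
  forall l i, (i < 2 ^ n * 2 ^ l)%N ->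
    driving theta kap B l i <= A * V * Num.sqrt n%:R * (2 `^ (- be)) ^+ l.
Proof.
move=> C0 /andP[be0 beH] be1.
set h : R := 2 `^ (- be); have h0 : 0 < h by rewrite powR_gt0.
pose q : R := 2 `^ (- H); have q0 : 0 < q by rewrite powR_gt0.
have qh : q < h by apply: powR_lt_exponent; [rewrite ltr1n | rewrite ltrN2].
have hh : 2^-1 < h.
  have -> : 2^-1 = 2 `^ (-1) :> R by rewrite powRN powRr1.
  by apply: powR_lt_exponent; [rewrite ltr1n | rewrite ltrN2].
(* ratio of the squared Hoelder scales of orders [H] and [be] *)
pose s := (q / h) ^+ 2.
have s01 : 0 <= s < 1.
  rewrite sqr_ge0/= expr_lt1//; first by rewrite ltr_pdivrMr// mul1r.
  by rewrite divr_ge0// ltW.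
pose S := 2 + (1 - s)^-1.
have S0 : 0 <= S by have /andP[_ s1] := s01; rewrite addr_ge0// invr_ge0 subr_ge0 ltW.
exists (1 + `|theta| + `|kap| * Num.sqrt (C * S)); split.
  by rewrite -addrA lerDl addr_ge0// mulr_ge0// sqrtr_ge0.
move=> B V n V1 n1 grow l i il.
have V0 : 0 <= V by lra.
have sn1 : 1 <= Num.sqrt n%:R :> R by rewrite -{1}sqrtr1 ler_wsqrtr// ler1n.
have e2 j : dyadic R (n + l) (j * 2 ^ n) = dyadic R l j.
  by rewrite /dyadic natrM natrX exprD; field; rewrite !expf_neq0.
have lim j : (j <= 2 ^ n * 2 ^ l)%N -> (j * 2 ^ n <= 4 ^ (n + l))%N.
  move=> jl; rewrite -[4%N]/(2 ^ 2)%N -expnM.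
  apply: (@leq_trans (2 ^ n * 2 ^ l * 2 ^ n)); first by rewrite leq_mul2r jl orbT.
  by rewrite -!expnD leq_exp2l// mul2n -addnn leq_add2l leq_addr.
have inc : `|dincr B l i| <= Num.sqrt (C * S) * V * Num.sqrt n%:R * h ^+ l.
  have CS0 : 0 <= C * S by exact: mulr_ge0.
  rewrite -ler_sqr ?nnegrE//; last first.
    by rewrite !mulr_ge0 ?sqrtr_ge0 ?exprn_ge0// ltW.
  rewrite real_normK ?num_real// !exprMn !sqr_sqrtr//.
  have := grow (n + l)%N (i * 2 ^ n)%N (i.+1 * 2 ^ n)%N (lim i (ltnW il)) (lim i.+1 il).
  rewrite !e2 -/(dincr B l i) dyadic_step => le1; apply: (le_trans le1).
  have -> : `|(2 ^+ l)^-1| `^ (2 * H) = s ^+ l * (h ^+ l) ^+ 2 :> R.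
    have -> : s ^+ l * (h ^+ l) ^+ 2 = (q ^+ l) ^+ 2.
      by rewrite /s -exprM mulnC exprM -exprMn -exprMn divfK// gt_eqF.
    have -> : q ^+ l = ((2 ^+ l)^-1) `^ H.
      by rewrite -exprVn exprn_powR ?invr_ge0// -powR_inv1// -powRrM mulN1r.
    rewrite ger0_norm ?invr_ge0 ?exprn_ge0// mulrC powRrM.
    by rewrite -[2 in LHS]/(2%:R) powR_mulrn ?powR_ge0.
  have nl : (n + l).+1%:R <= n%:R * l.+2%:R :> R 
    by rewrite -natrM ler_nat -addnS addnC mulnSr leq_add2r leq_pmull.
  have sS : l.+2%:R * s ^+ l <= S by exact: linear_geometric_bound.
  rewrite (_ : _ * _ = C * V ^+ 2 * (h ^+ l) ^+ 2 * ((n + l).+1%:R * s ^+ l)); last by ring.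
  rewrite [leRHS](_ : _ = C * V ^+ 2 * (h ^+ l) ^+ 2 * (n%:R * S)); last by ring.
  apply: ler_wpM2l; first exact: mulr_ge0 (mulr_ge0 C0 (sqr_ge0 _)) (sqr_ge0 _).
  apply: (@le_trans _ _ (n%:R * (l.+2%:R * s ^+ l))); last exact: ler_wpM2l.
  rewrite mulrA; apply: ler_wpM2r nl; apply: exprn_ge0; exact: sqr_ge0.
rewrite /driving; set W := V * Num.sqrt n%:R * h ^+ l.
have -> : (1 + `|theta| + `|kap| * Num.sqrt (C * S)) * V * Num.sqrt n%:R * h ^+ l =
    W + `|theta| * W + `|kap| * (Num.sqrt (C * S) * V * Num.sqrt n%:R * h ^+ l).
  by rewrite /W; ring.
have hl0 : 0 <= h ^+ l by rewrite exprn_ge0// ltW.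
have hW : h ^+ l <= W.
  by rewrite /W ler_peMl// -[leLHS]mulr1 ler_pM.
apply: lerD; last exact: ler_wpM2l.
apply: (@le_trans _ _ (`|theta| * W)); last by rewrite lerDr (le_trans hl0).
apply: ler_wpM2l => //; apply: le_trans hW; rewrite -exprVn.
by apply: lerXn2r; rewrite ?nnegrE ?invr_ge0// ltW.
Qed.

End estimator_paths.

(** * Rate of convergence along a path *)

Section estimator_rate.
Context {R : realType}.
Implicit Types (theta kap L K M C E be H V gamma : R) (a b x B : R -> R) (k m n N : nat).

(** Dividing the Euler terms by [b (x _)] leaves the drift quotient and a
    telescoping sum of noise increments. *)
Lemma estimator_numerator theta kap a b x B M E m N :
  0 < M -> (forall y, M <= `|b y|) ->
  (forall k, (k < N)%N -> `|dincr x m k - dterm theta kap a b x B m k| <= E) ->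
  `|\sum_(k < N) (b (x (dyadic R m k)))^-1 * dincr x m k -
     theta * ((2 ^+ m)^-1 * \sum_(k < N) (b (x (dyadic R m k)))^-1 * a (x (dyadic R m k))) +
     kap * (B (dyadic R m N) - B (dyadic R m 0))| <= N%:R * (E / M).
Proof.
move=> M0 hb hE.
have -> : B (dyadic R m N) - B (dyadic R m 0) = \sum_(k < N) dincr B m k.
  by rewrite -(telescope_sumr (fun k => B (dyadic R m k)))// big_mkord.
rewrite !mulr_sumr -sumrB -big_split/=; apply: le_trans (ler_norm_sum _ _ _) _.
have -> : N%:R * (E / M) = \sum_(k < N) E / M by rewrite sumr_const card_ord mulr_natl.
apply: ler_sum => k _.
have b0 : b (x (dyadic R m k)) != 0 by rewrite -normr_gt0 (lt_le_trans M0).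
have -> : (b (x (dyadic R m k)))^-1 * dincr x m k -
    theta * ((2 ^+ m)^-1 * ((b (x (dyadic R m k)))^-1 * a (x (dyadic R m k)))) +
    kap * dincr B m k =
    (dincr x m k - dterm theta kap a b x B m k) / b (x (dyadic R m k)).
  by rewrite /dterm /euler_term dyadic_step /dincr; field; rewrite b0 expf_neq0.
rewrite normrM normfV ler_pM ?invr_ge0//; first exact: hE.
by rewrite lef_pV2// posrE (lt_le_trans M0).
Qed.

(** [a / b] is continuous and has no zero, hence a constant sign: there are no
    cancellations in the sum. *)
Lemma estimator_denominator a b K L M (y : nat -> R) N :
  0 < K -> 0 <= L -> 0 < M -> coef_bounded a b K -> coef_lipschitz a b L ->
  coef_nondegenerate a b M ->
  N%:R * (M / K) <= `|\sum_(k < N) (b (y k))^-1 * a (y k)|.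
Proof.
move=> K0 L0 M0 bd lip nd.
pose f z := (b z)^-1 * a z.
have bn z : b z != 0 by rewrite -normr_gt0 (lt_le_trans M0)//; have [] := nd z.
have an z : a z != 0 by rewrite -normr_gt0 (lt_le_trans M0)//; have [] := nd z.
have cf : continuous f.
  have ca : continuous a.
    apply: (lipschitz_bound_continuous L0) => z z'.
    by apply: le_trans (lip z z'); rewrite lerDl.
  have cb : continuous b.
    apply: (lipschitz_bound_continuous L0) => z z'.
    by apply: le_trans (lip z z'); rewrite lerDr.
  by move=> z; apply: cvgM; [apply: cvgV => //; exact: cb | exact: ca].
have fn z : f z != 0 by rewrite mulf_neq0 ?invr_eq0.
have lb z : M / K <= `|f z|.
  rewrite normrM normfV mulrC ler_pM ?invr_ge0 ?(ltW M0) ?(ltW K0)//; last by have [] := nd z.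
  rewrite lef_pV2 ?posrE ?normr_gt0//; apply: le_trans (bd z); rewrite lerDr//.
have sg z : `|f z| = Num.sg (f 0) * f z.
  have := nonvanishing_same_sign 0 z cf fn.
  have := fn 0; rewrite neq_lt => /orP[f0|f0].
    by rewrite (nmulr_rgt0 _ f0) => fz; rewrite ltr0_norm// ltr0_sg// mulN1r.
  by rewrite (pmulr_rgt0 _ f0) => fz; rewrite gtr0_norm// gtr0_sg// mul1r.
have -> : `|\sum_(k < N) f (y k)| = \sum_(k < N) `|f (y k)|.
  under [RHS]eq_bigr do rewrite sg.
  rewrite -mulr_sumr -[RHS]ger0_norm; first by rewrite normrM normr_sg fn mul1r.
  by rewrite mulr_sumr sumr_ge0// => k _; rewrite -sg.
have -> : N%:R * (M / K) = \sum_(k < N) M / K by rewrite sumr_const card_ord mulr_natl.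
by apply: ler_sum => k _.
Qed.

Lemma hoelder_dincr (be : R) x n : 0 < be -> locally_hoelder be x ->
  exists D : R, 0 <= D /\ forall l i, (i < 2 ^ n * 2 ^ l)%N ->
    `|dincr x l i| <= D * (2 `^ (- be)) ^+ l.
Proof.
move=> be0 hx.
have [D [D0 hD]] := locally_hoelder_ge0 (exprn_gt0 n (ltr0n R 2)) hx.
exists D; split => // l i il.
have rng j : (j <= 2 ^ n * 2 ^ l)%N -> 0 <= dyadic R l j <= 2 ^+ n.
  move=> jl; rewrite /dyadic divr_ge0 ?exprn_ge0//= ler_pdivrMr ?exprn_gt0//.
  by rewrite -!natrX -natrM ler_nat.
apply: le_trans (hD _ _ (rng i.+1 il) (rng i (ltnW il))) _.
rewrite dyadic_step ger0_norm ?invr_ge0 ?exprn_ge0// -exprVn exprn_powR ?invr_ge0//.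
by rewrite -powR_inv1// -powRrM mulN1r.
Qed.

Lemma powR2_exprn (c : R) n : 2 `^ (c * n%:R) = (2 `^ c) ^+ n :> R.
Proof. by rewrite powRrM powR_mulrn// powR_ge0. Qed.

(** The noise over the whole observation window is of order
    [sqrt n V 2 ^ (H n)] and the local errors add up to
    [4 ^ n Lam ^ (1 + be^-1) 2 ^ (- 2 be n)] with [Lam] of order [sqrt n V],
    while the denominator is at least of order [2 ^ n]. Since
    [1 + be^-1 <= 3] and [1/2 < gamma], both quotients are at most a multiple
    of [V ^ 3 n ^ (gamma / be + gamma)] times the slower of the two rates. *)
Lemma estimator_rate theta kap a b be H C K L M gamma :
  0 <= C -> 2^-1 < be < H -> H < 1 -> 0 < K -> 0 <= L -> 0 < M -> 2^-1 < gamma ->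
  coef_bounded a b K -> coef_lipschitz a b L -> coef_nondegenerate a b M ->
  exists A : R, 0 <= A /\ forall x B V, 1 <= V -> locally_hoelder be x ->
  (forall m k, block (dterm theta kap a b x B) m k p @[p --> \oo] --> dincr x m k) ->
  (forall l i j, (i <= 4 ^ l)%N -> (j <= 4 ^ l)%N ->
    (B (dyadic R l j) - B (dyadic R l i)) ^+ 2 <=
      C * l.+1%:R * V ^+ 2 * `|dyadic R l j - dyadic R l i| `^ (2 * H)) ->
  forall n, (1 <= n)%N ->
  `|(\sum_(1 <= k < 2 ^ (2 * n)) (b (x (dyadic R n k.-1)))^-1 *
       (x (dyadic R n k) - x (dyadic R n k.-1))) /
    ((2 ^+ n)^-1 * \sum_(1 <= k < 2 ^ (2 * n))
       (b (x (dyadic R n k.-1)))^-1 * a (x (dyadic R n k.-1))) - theta| <=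
  A * V ^+ 3 * n%:R `^ (gamma / be + gamma) *
    2 `^ (- (Num.min (1 - H) (2 * be - 1) * n%:R)).
Proof.
move=> C0 /andP[be2 beH] H1 K0 L0 M0 gam bd lip nd.
have be1 : be < 1 by lra.
have be0 : 0 < be by lra.
have [A1 [A11 drv]] := driving_bound theta kap C0 (introT andP (conj be0 beH)) be1.
have [Ce [Ce0 err]] := dyadic_increment_error (introT andP (conj be2 be1)) (ltW K0) L0.
pose p := 1 + be^-1.
pose c1 := `|kap| * Num.sqrt (2 * C) * 2 * (K / M).
pose c2 := Ce * A1 `^ p * (K / M ^+ 2).
have c10 : 0 <= c1.
  by rewrite /c1 !mulr_ge0 ?sqrtr_ge0 ?invr_ge0// ltW.
have c20 : 0 <= c2.
  by rewrite /c2 !mulr_ge0 ?powR_ge0 ?invr_ge0 ?exprn_ge0// ltW.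
exists (c1 + c2); split; first exact: addr_ge0.
move=> x B V V1 hx lim grow n n1.
have V0 : 0 < V by lra.
have [D [D0 hD]] := hoelder_dincr n be0 hx.
set h : R := 2 `^ (- be) in hD drv err *.
pose sn : R := Num.sqrt n%:R.
have sn1 : 1 <= sn by rewrite -[leLHS]sqrtr1 ler_wsqrtr// ler1n.
pose Lam := A1 * V * sn.
have Lam1 : 1 <= Lam.
  rewrite /Lam -[leLHS]mulr1 ler_pM// -[leLHS]mulr1 ler_pM//.
have E k (kn : (k < 2 ^ n * 2 ^ n)%N) := err theta kap a b x B Lam D (2 ^ n)%N n
  lip bd Lam1 D0 lim (drv B V n V1 n1 grow) hD k kn.
rewrite !big_add1 !big_mkord /=.
set N := (2 ^ (2 * n)).-1.
have NE : (N.+1 = 2 ^ n * 2 ^ n)%N by rewrite prednK ?expn_gt0// mul2n -addnn expnD.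
have N2 : 2 ^+ n * 2 ^+ n <= 2 * N%:R :> R.
  rewrite -!natrX -!natrM ler_nat -NE mul2n -addnn.
  rewrite -[N.+1]add1n leq_add2r -ltnS NE -expnD (@leq_trans (2 ^ 1))//.
  by rewrite leq_exp2l// ltn_addr.
have nb y : M <= `|b y| by have [] := nd y.
have num := @estimator_numerator theta kap a b x B M _ n N M0 nb
  (fun k kN => E k (leq_trans kN (ltnW (eq_leq NE)))).
have den := @estimator_denominator a b K L M (fun k => x (dyadic R n k)) N
  K0 L0 M0 bd lip nd.
rewrite /= in den.
set Q := \sum_(k < N) _ in num *.
set S := \sum_(k < N) _ in num den *.
pose g : R := 2 `^ H; pose u := (g / 2) ^+ n; pose v := (2 * h ^+ 2) ^+ n.
pose G := n%:R `^ (gamma / be + gamma) : R.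
pose t : R := 2 `^ (- (Num.min (1 - H) (2 * be - 1) * n%:R)).
have n1R : 1 <= n%:R :> R by rewrite ler1n.
have pB y z : 2 `^ (y - z) = 2 `^ y / 2 `^ z :> R.
  by apply: powRB; apply/implyP => _; rewrite pnatr_eq0.
have ut : u <= t.
  have -> : u = 2 `^ (- (1 - H) * n%:R).
    by rewrite powR2_exprn opprB pB powRr1.
  by rewrite mulNr ler_powR ?ler1n// lerN2 ler_wpM2r// ge_min lexx.
have vt : v <= t.
  have -> : v = 2 `^ (- (2 * be - 1) * n%:R).
    rewrite powR2_exprn; congr (_ ^+ n); rewrite /h -powR_mulrn ?powR_ge0// -powRrM.
    by rewrite opprB pB powRr1// mulNr powRN [be * 2]mulrC.
  by rewrite mulNr ler_powR ?ler1n// lerN2 ler_wpM2r// ge_min lexx orbT.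
have be_inv : be^-1 < 2 by rewrite -[2]invrK ltf_pV2 ?posrE ?invr_gt0.
have ibe : 0 < be^-1 by rewrite invr_gt0.
have snE : sn = n%:R `^ 2^-1 by rewrite powR12_sqrt.
have pG : 2^-1 * p <= gamma / be + gamma.
  have : 2^-1 * be^-1 <= gamma * be^-1 by apply: ler_wpM2r; exact: ltW.
  by rewrite /p; lra.
have snG : (V * sn) <= V ^+ 3 * G.
  rewrite ler_pM//; [exact: ltW|exact: le_trans sn1|by rewrite ler_eXnr|].
  by rewrite snE ler_powR//; move: pG; rewrite /p; lra.
have pVG : (V * sn) `^ p <= V ^+ 3 * G.
  rewrite powRM ?(ltW V0) ?(le_trans _ sn1)// ler_pM ?powR_ge0//.
    by rewrite -powR_mulrn ?(ltW V0)// ler_powR// /p; lra.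
  by rewrite snE -powRrM ler_powR.
have N0 : 0 < N%:R :> R.
  have := exprn_gt0 n (ltr0n R 2) => e0.
  by have := lt_le_trans (mulr_gt0 e0 e0) N2; rewrite pmulr_rgt0.
have dB : `|B (dyadic R n N) - B (dyadic R n 0)| <= Num.sqrt (2 * C) * V * sn * g ^+ n.
  have g0 : 0 <= g by rewrite powR_ge0.
  rewrite -ler_sqr ?nnegrE//; last first.
    by rewrite !mulr_ge0 ?sqrtr_ge0 ?exprn_ge0// ltW.
  rewrite real_normK ?num_real// !exprMn !sqr_sqrtr ?mulr_ge0//.
  have N4 : (N <= 4 ^ n)%N by rewrite /N expnM leq_pred.
  apply: le_trans (grow n 0%N N (leq0n _) N4) _.
  have -> : `|dyadic R n N - dyadic R n 0| = dyadic R n N.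
    by rewrite {2}/dyadic mul0r subr0 ger0_norm// dyadic_ge0.
  have dle : dyadic R n N <= 2 ^+ n.
    rewrite /dyadic ler_pdivrMr ?exprn_gt0// -!natrX -natrM ler_nat.
    exact: ltnW (eq_leq NE).
  have pw : dyadic R n N `^ (2 * H) <= (g ^+ n) ^+ 2.
    rewrite /g -exprn_powR// -[X in _ <= X]powR_mulrn ?powR_ge0// -powRrM mulrC.
    by apply: ge0_ler_powR; rewrite ?nnegrE ?dyadic_ge0 ?exprn_ge0 ?mulr_ge0//; lra.
  have nn : n.+1%:R <= 2 * n%:R :> R.
    by rewrite -natrM ler_nat mul2n -addnn -[n.+1]add1n leq_add2r.
  rewrite (_ : _ * _ = C * V ^+ 2 * (n.+1%:R * dyadic R n N `^ (2 * H))); last by ring.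
  rewrite [leRHS](_ : _ = C * V ^+ 2 * (2 * n%:R * (g ^+ n) ^+ 2)); last by ring.
  apply: ler_wpM2l; first exact: mulr_ge0 C0 (sqr_ge0 _).
  by apply: ler_pM => //; exact: powR_ge0.
have p2 : 0 < 2 ^+ n :> R by rewrite exprn_gt0.
have S0 : 0 < `|S| by apply: lt_le_trans den; rewrite mulr_gt0// divr_gt0.
have -> : Q / ((2 ^+ n)^-1 * S) - theta = (Q - theta * ((2 ^+ n)^-1 * S)) / ((2 ^+ n)^-1 * S).
  by field; rewrite gt_eqF//= -normr_gt0.
set r := Q - theta * _ in num *.
have r1 : `|r| <= N%:R * (Ce * Lam `^ p * h ^+ (2 * n) / M) +
    `|kap| * (Num.sqrt (2 * C) * V * sn * g ^+ n).
  rewrite -[r](addrK (kap * (B (dyadic R n N) - B (dyadic R n 0)))).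
  apply: le_trans (ler_normB _ _) _; apply: lerD num _.
  by rewrite normrM; apply: ler_wpM2l.
rewrite normrM normfV ler_pdivrMr; last first.
  by rewrite normrM mulr_gt0// normr_gt0 invr_eq0 gt_eqF.
rewrite normrM [`|(2 ^+ n)^-1|]ger0_norm ?invr_ge0 ?(ltW p2)//.
have u0 : 0 <= u by rewrite exprn_ge0// divr_ge0// powR_ge0.
have v0 : 0 <= v by rewrite exprn_ge0// mulr_ge0// sqr_ge0.
have w0 : 0 <= V * sn by apply: mulr_ge0; [exact: ltW | exact: le_trans sn1].
have Z1 : c1 * (V * sn * u) + c2 * ((V * sn) `^ p * v) <= (c1 + c2) * V ^+ 3 * G * t.
  have -> : (c1 + c2) * V ^+ 3 * G * t =
    c1 * (V ^+ 3 * G * t) + c2 * (V ^+ 3 * G * t) by ring.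
  apply: lerD; apply: ler_wpM2l => //; apply: ler_pM => //; exact: powR_ge0.
have Z2 : N%:R * (Ce * Lam `^ p * h ^+ (2 * n) / M) =
    c2 * ((V * sn) `^ p * v) * ((2 ^+ n)^-1 * (N%:R * (M / K))).
  have -> : Lam `^ p = A1 `^ p * (V * sn) `^ p.
    by rewrite /Lam -mulrA powRM// (le_trans _ A11).
  have -> : v = 2 ^+ n * h ^+ (2 * n) by rewrite /v exprMn -exprM.
  by rewrite /c2; field; rewrite !gt_eqF.
have Z3 : `|kap| * (Num.sqrt (2 * C) * V * sn * g ^+ n) <=
    c1 * (V * sn * u) * ((2 ^+ n)^-1 * (N%:R * (M / K))).
  have -> : c1 * (V * sn * u) * ((2 ^+ n)^-1 * (N%:R * (M / K))) =
      `|kap| * (Num.sqrt (2 * C) * V * sn * g ^+ n) * (2 * N%:R / (2 ^+ n * 2 ^+ n)).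
    by rewrite /c1 /u expr_div_n; field; rewrite !gt_eqF.
  rewrite ler_peMr//; last by rewrite ler_pdivlMr ?mul1r// mulr_gt0.
  have g0 : 0 <= g ^+ n by rewrite exprn_ge0// powR_ge0.
  by rewrite -[_ * V * sn]mulrA; apply: mulr_ge0 => //; apply: mulr_ge0 => //; apply: mulr_ge0.
apply: (le_trans r1); apply: (@le_trans _ _ ((c1 * (V * sn * u) + c2 * ((V * sn) `^ p * v)) *
    ((2 ^+ n)^-1 * (N%:R * (M / K))))).
  by rewrite [leRHS]mulrDl -Z2 addrC; apply: lerD.
apply: ler_pM.
- by apply: addr_ge0; apply: mulr_ge0 => //; apply: mulr_ge0 => //; exact: powR_ge0.
- by apply: mulr_ge0; [rewrite invr_ge0 ltW | rewrite mulr_ge0// divr_ge0// ltW].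
- exact: Z1.
- by apply: ler_wpM2l den; rewrite invr_ge0 ltW.
Qed.

(** Half of the exponential decay, shared out as the [G]-th power of a geometric
    sequence, keeps the polynomial factor bounded. *)
Lemma powR_exp_decay (G rho : R) : 0 < G -> 0 < rho ->
  n%:R `^ G * 2 `^ (- (rho * n%:R)) @[n --> \oo] --> (0 : R).
Proof.
move=> G0 rho0.
have lt1 (y : R) : 0 < y -> 0 <= (2 `^ (- y) : R) < 1.
  by move=> y0; rewrite powR_ge0/= -[ltRHS](powRr0 2) powR_lt_exponent ?ltr1n ?oppr_lt0.
have rG : 0 < rho / 2 / G by rewrite !divr_gt0.
(* [s ^ G] and [r] are both half of the decay *)
pose s : R := 2 `^ (- (rho / 2 / G)); pose r : R := 2 `^ (- (rho / 2)).
have s01 := lt1 _ rG; have /andP[r0 r1] := lt1 (rho / 2) (divr_gt0 rho0 (ltr0n R 2)).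
have s0 : 0 <= s by rewrite powR_ge0.
have bound n : n%:R `^ G * 2 `^ (- (rho * n%:R)) <= (2 + (1 - s)^-1) `^ G * r ^+ n.
  have -> : 2 `^ (- (rho * n%:R)) = (s ^+ n) `^ G * r ^+ n :> R.
    rewrite exprn_powR// /s -powRrM -!powR_mulrn ?powR_ge0// -!powRrM -powRD; last first.
      by apply/implyP => _; rewrite pnatr_eq0.
    by congr (_ `^ _); field; rewrite gt_eqF.
  rewrite mulrA -powRM ?exprn_ge0//; apply: ler_wpM2r; first exact: exprn_ge0.
  have h := linear_geometric_bound n s01.
  have h2 : n%:R * s ^+ n <= 2 + (1 - s)^-1.
    apply: le_trans h; apply: ler_wpM2r; first exact: exprn_ge0.
    by rewrite ler_nat -addn2 leq_addr.
  have h0 : 0 <= n%:R * s ^+ n by rewrite mulr_ge0// exprn_ge0.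
  by apply: ge0_ler_powR; rewrite ?nnegrE ?(ltW G0)// (le_trans h0).
apply: (@squeeze_cvgr _ _ _ _ (fun=> 0) (fun n => (2 + (1 - s)^-1) `^ G * r ^+ n)).
- by apply: nearW => n; rewrite bound mulr_ge0 ?powR_ge0.
- exact: cvg_cst.
- rewrite -(mulr0 ((2 + (1 - s)^-1) `^ G)); apply: cvgMl_tmp; apply: cvg_expr.
  by rewrite ger0_norm.
Qed.

End estimator_rate.

Theorem theorem4 (R : realType) (d : measure_display) (T : measurableType d)
    (P : probability T R) (hP : measure_is_complete P)
    (H alpha beta gamma kappa : R)
    (hH : 2^-1 < H < 1)
    (halpha : 1 - H < alpha < 2^-1)
    (hbeta : 1 - alpha < beta < H)
    (hgamma : 2^-1 < gamma)
    (hkappa : kappa = gamma / beta)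
    (a b : R -> R) (hab : coef_assumptions H a b)
    (theta x0 : R) (B X : R -> T -> R)
    (hB : is_fbm P H B)
    (hX : is_sde_solution P H alpha theta a b x0 B X) :
  {ae P, forall w, (fun n => theta_hat2 a b X n w) @ \oo --> theta} /\
  exists eta : {RV P >-> R},
    (forall k : nat, P.-integrable setT (fun w => (eta w ^+ k)%:E)) /\
    {ae P, forall w, forall n : nat, (1 <= n)%N ->
       `|theta_hat2 a b X n w - theta| <=
         eta w * n%:R `^ (kappa + gamma) *
         2 `^ (- (Num.min (1 - H) (2 * beta - 1) * n%:R))}.
Proof.
have /andP[H2 H1] := hH; have /andP[al1 al2] := halpha; have /andP[be1 be2] := hbeta.
have H0 : 0 < H by lra.
have be0 : 0 < beta by lra.
have [de [K [L [M [RN [[_ [K0 L0 M0 _]] [bd lip _ nd]]]]]]] := hab.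
have [V [C [C0 [V1 jV grow]]]] := fbm_dyadic_growth H0 hB.
have bP : 2^-1 < beta < H by rewrite be2 andbT; lra.
have [A [A0 rate]] := @estimator_rate R theta (gls_constant alpha) a b beta H C K L M gamma
  C0 bP H1 K0 (ltW L0) M0 hgamma bd lip nd.
have mE : measurable_fun setT (fun w => A * V w ^+ 3).
  by apply: measurable_funM => //; apply: measurable_funX.
pose eta : {mfun T >-> R} := HB.pack (fun w => A * V w ^+ 3) (isMeasurableFun.Build _ _ _ _ _ mE).
have main : {ae P, forall w, forall n : nat, (1 <= n)%N ->
    `|theta_hat2 a b X n w - theta| <=
      eta w * n%:R `^ (kappa + gamma) *
      2 `^ (- (Num.min (1 - H) (2 * beta - 1) * n%:R))}.
  have hbB := fbm_hoelder hB; have hbX := sde_hoelder hX; have heq := sde_equation hX.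
  have aeF := ae_filter_ringOfSetsType P.
  have hXeq := @filterI _ _ aeF _ _ hbX heq.
  apply: (@filterS3 _ _ aeF _ _ _ _ _ grow hbB hXeq) => w gw hBw [hXw eqw] n n1.
  rewrite hkappa.
  have bP' : 0 < beta < H by rewrite be0.
  apply: (rate (X^~ w) (B^~ w) (V w)) => //; first exact: hXw.
  move=> m k; apply: (@sde_block_cvg _ alpha beta theta a b _ _ L) => //.
  - by apply/andP; split => //; lra.
  - by lra.
  - exact: ltW.
  - exact: sde_continuous hX w.
  - exact: fbm_continuous hB w.
  - exact: hXw.
  - exact: hBw.
have G0 : 0 < kappa + gamma by rewrite hkappa addr_gt0 ?divr_gt0//; lra.
have rho0 : 0 < Num.min (1 - H) (2 * beta - 1) by rewrite lt_min; apply/andP; split; lra.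
split.
  move: main; apply: filterS => w hw.
  apply/cvgrPdist_le => /= e e0.
  have lim : eta w * (n%:R `^ (kappa + gamma) *
      2 `^ (- (Num.min (1 - H) (2 * beta - 1) * n%:R))) @[n --> \oo] --> (0 : R).
    by rewrite -(mulr0 (eta w)); apply: cvgMl_tmp; exact: powR_exp_decay.
  move/cvgrPdist_le : lim => /(_ e e0) /= lim.
  near=> n; rewrite distrC; apply: le_trans (hw n _) _; first by near: n; exists 1%N.
  rewrite -mulrA; apply: le_trans (ler_norm _) _; rewrite -normrN -[X in `|X|]add0r.
  by near: n.
exists eta; split => // k.
have := integrable_scale (A ^+ k) measurableT (jV (3 * k)%N).
congr (_.-integrable _ _); apply/funext => w /=.
by rewrite exprMn exprM.
Unshelve. all: by end_near. Qed.
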